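(* For every integer $d\ge2$, $\frac43\le\mathfrak{q}(d)\le\frac{2}{1+2^{1-d}}$.
   Context: $\mathbb{T}^d$ is the $d$-fold torus with normalized Haar measure. $H^p(\mathbb{T}^d)$ denotes the Hardy space (for $p\ge1$: functions in $L^p(\mathbb{T}^d)$ with Fourier coefficients supported in $\mathbb{N}_0^d$; for $0<p<1$ the usual Hardy space on the polydisc). The Riesz projection is $P_+\psi=\sum_{\alpha\in\mathbb{N}_0^d}\widehat\psi(\alpha)z^\alpha$. For nontrivial $\varphi$ in some $H^p(\mathbb{T}^d)$, $\|\varphi\|_0:=\exp\left(\int_{\mathbb{T}^d}\log|\varphi|\right)$. For $1\le q\le\infty$, $\mathfrak{p}_d(q):=\sup\{p\ge0: \|P_+\psi\|_p\le\|\psi\|_q \text{ for every }\psi\in L^q(\mathbb{T}^d)\}$ if this set is nonempty, and $\mathfrak{p}_d(q):=-1$ otherwise. The minimal admissible exponent is $\mathfrak{q}(d):=\inf\{q:\mathfrak{p}_d(q)\ge0\}$. *)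

(* Defs.v *)
From HB Require Import structures.
From mathcomp Require Import all_boot all_order all_algebra.
From mathcomp Require Import all_classical all_reals all_analysis.
From mathcomp Require Import complex.

Set Implicit Arguments.
Unset Strict Implicit.
Unset Printing Implicit Defensive.

Import Order.TTheory GRing.Theory Num.Theory.
Import numFieldNormedType.Exports.

Local Open Scope classical_set_scope.
Local Open Scope ring_scope.

(* The torus T^d is parametrized by x in [0,1]^d (as 'rV[R]_d) via           *)
(* z_j = exp(2 pi i x_j); normalized Haar measure = Lebesgue measure on      *)
(* [0,1]^d.  Complex values live in R[i] (record with fields Re, Im).        *)

Section Torus.
Variable R : realType.

(* iterated integral over [0,1]^d (equals the product-measure integral by  *)
(* Fubini/Tonelli for the measurable functions it is applied to)           *)
Fixpoint tint (d : nat) : ('rV[R]_d -> \bar R) -> \bar R :=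
  match d with
  | 0 => fun f => f 0
  | d'.+1 => fun f =>
      (\int[@lebesgue_measure R]_(x in `[0%R, 1%R]) @tint d' (fun v => f (row_mx (x : R)%:M v)))%E
  end.

Definition torus_measurable (d : nat) : set (set 'rV[R]_d) :=
  <<s [set A | exists (j : 'I_d) (B : set R),
          measurable B /\ A = (fun v : 'rV[R]_d => v ord0 j) @^-1` B] >>.

Definition tmeasurable_fun (d : nat) (f : 'rV[R]_d -> R) : Prop :=
  forall B : set R, measurable B -> torus_measurable (f @^-1` B).

Definition cmeasurable (d : nat) (f : 'rV[R]_d -> R[i]) : Prop :=
  tmeasurable_fun (fun x => complex.Re (f x)) /\ tmeasurable_fun (fun x => complex.Im (f x)).

Definition cabs (z : R[i]) : R := Num.sqrt (complex.Re z ^+ 2 + complex.Im z ^+ 2).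

Definition Lpnorm (d : nat) (p : R) (f : 'rV[R]_d -> R[i]) : \bar R :=
  ((tint (fun x => ((cabs (f x)) `^ p)%:E)) `^ p^-1)%E.

Definition Linfnorm (d : nat) (f : 'rV[R]_d -> R[i]) : \bar R :=
  ereal_inf [set M%:E | M in [set M : R |
     tint (fun x => ((M < cabs (f x))%R%:R)%:E) = 0%E]].

Definition Lqnorm (d : nat) (q : \bar R) (f : 'rV[R]_d -> R[i]) : \bar R :=
  match q with
  | r%:E => Lpnorm r f
  | +oo%E => Linfnorm f
  | -oo%E => +oo%E
  end.

Definition L0norm (d : nat) (f : 'rV[R]_d -> R[i]) : \bar R :=
  expeR (tint (fun x => if cabs (f x) == 0 then -oo%E else (ln (cabs (f x)))%:E)).

Definition Lnorm_p (d : nat) (p : R) (f : 'rV[R]_d -> R[i]) : \bar R :=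
  if p == 0 then L0norm f else Lpnorm p f.

Definition inLq (d : nat) (q : \bar R) (f : 'rV[R]_d -> R[i]) : Prop :=
  cmeasurable f /\ (Lqnorm q f < +oo)%E.

(* complex integral over T^d (for integrable functions) *)
Definition cint (d : nat) (f : 'rV[R]_d -> R[i]) : R[i] :=
  Complex (fine (tint (fun x => (complex.Re (f x))%:E)))
          (fine (tint (fun x => (complex.Im (f x))%:E))).

(* Fourier coefficient  \hat f(alpha) = int f(x) exp(-2 pi i alpha.x) dx *)
Definition fourier (d : nat) (f : 'rV[R]_d -> R[i]) (alpha : 'rV[int]_d) : R[i] :=
  cint (fun x =>
    let t := (2 * pi * \sum_(j < d) (alpha ord0 j)%:~R * x ord0 j)%R in
    Complex (complex.Re (f x) * cos t + complex.Im (f x) * sin t)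
            (complex.Im (f x) * cos t - complex.Re (f x) * sin t)).

Definition is_Riesz_proj (d : nat) (psi g : 'rV[R]_d -> R[i]) : Prop :=
  cmeasurable g /\ (tint (fun x => (cabs (g x))%:E) < +oo)%E /\
  forall alpha : 'rV[int]_d,
    fourier g alpha =
      if [forall j, (0 <= alpha ord0 j)%R] then fourier psi alpha
      else Complex 0 0.

Definition admissible_p (d : nat) (q : \bar R) : set R :=
  [set p : R | (0 <= p)%R /\
     forall psi g : 'rV[R]_d -> R[i],
       inLq q psi -> is_Riesz_proj psi g -> (Lnorm_p p g <= Lqnorm q psi)%E].

Definition pfrak (d : nat) (q : \bar R) : \bar R :=
  if `[< admissible_p d q !=set0 >] then ereal_sup (EFin @` admissible_p d q)
  else (-1)%E.

Definition qfrak (d : nat) : \bar R :=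
  ereal_inf [set q : \bar R | (1 <= q)%E /\ (0 <= pfrak d q)%E].

End Torus.

(* Main.v *)
Require Import Defs.
From HB Require Import structures.
From mathcomp Require Import all_boot all_order all_algebra.
From mathcomp Require Import all_classical all_reals all_analysis.
From mathcomp Require Import measurable_realfun complex ring lra zify.

(* Upper bound.  Let 1/q = 1/2 + 2^-d.  For a polynomial G with frequencies in N^d, let W be
   analytic in the first variable with Re W = ln |G| and put h = G exp(-W).  Then |h| = 1 and
   the mean of G conj(h) is the mean of exp(W), that is exp(int ln |G|).  The one-variable Riesz
   projection is a contraction from L^oo to L^4 and, interpolating with L^2, from L^r to L^s
   whenever 4/s = 1 + 2/r.  Applied in the remaining d - 1 variables, these projections turn h
   into an analytic H with ||H||_q' <= 1, where 1/q' = 1/2 - 2^-d is conjugate to q.  If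
   G = P_+ psi, then <G, h> = <G, H> = <psi, H> <= ||psi||_q.  Fejer means reduce the general
   case to polynomials, and ln |G| is replaced by the smooth function ln (|G|^2 + eps^2) / 2.

   Lower bound.  With s = z1 / z2 + z2 / z1 and psi = z1 z2 (1 + i t s) (1 + t^2 s^2) one has
   P_+ psi = z1 z2 (1 + 2 t^2 + i t (1 + 3 t^2) s), and as t -> 0
   exp(q int ln |P_+ psi|) - int |psi|^q = q (3 - 9 q / 4) t^4 + O(t^6),
   which is positive for q < 4/3. *)

Set Implicit Arguments.
Unset Strict Implicit.
Unset Printing Implicit Defensive.
Import Order.TTheory GRing.Theory Num.Theory.
Import numFieldNormedType.Exports.
Local Open Scope classical_set_scope.
Local Open Scope ring_scope.

(** * The torus and its Haar measure *)

(** The relation [4/s = 1 + 2/r] says [1/2 - 1/s = (1/2 - 1/r) / 2]: every projection halves the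
    distance of the reciprocal exponent from 1/2. As [h] is already analytic in one variable, only
    [d - 1] halvings occur, starting from the distance 1/2 at [L^oo]; hence [2^-d]. The obstacle is
    that [exp(-W)] has infinite spectrum and that projections are bounded neither on [L^1] nor on
    [L^oo]. The analysis is therefore carried out on trigonometric polynomials: exponentials become
    Euler powers [(1 + z/n)^n], a projection becomes a splitting of a finite spectrum, and
    interpolation is run on a Fejer mean followed by a projection, with a polynomial in [z] as
    analytic family. For the lower bound, Jensen's inequality reduces every exponent [p] to [p = 0].
    The choice of [psi] comes from [q = 4/3]: as [|psi| = (1 + t^2 s^2)^(3/2)], the function
    [|psi|^(q-2) psi] is then [z1 z2 (1 + i t s)], whose frequencies lie in N^d. This is the
    condition for [psi] to have least [L^q] norm among the functions with the same projection. *)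

Section TorusMeasure.
Variable R : realType.
Local Notation RT := (g_sigma_algebraType R.-ocitv.-measurable).

Definition coord_cylinders (d : nat) : set (set 'rV[R]_d) :=
  [set A | exists (j : 'I_d) (B : set R),
     measurable B /\ A = (fun v : 'rV[R]_d => v ord0 j) @^-1` B].

(** The row vectors carrying the sigma-algebra of [torus_measurable], so that [cmeasurable] and
    measurability on this type agree by unfolding. The carrier is unchanged; the casts to ['rV[R]_d]
    only recover the matrix structure. *)
Definition torus (d : nat) := g_sigma_algebraType (@coord_cylinders d).

HB.instance Definition _ d := Measurable.on (torus d).

Lemma measurable_coord (d : nat) (j : 'I_d) :
  measurable_fun setT (fun v : torus d => (v : 'rV[R]_d) ord0 j).
Proof.
move=> _ B mB; rewrite setTI; apply: sub_sigma_algebra.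
by exists j, B.
Qed.

Definition torus_cons (d : nat) (p : RT * torus d) : torus d.+1 :=
  row_mx (p.1 : R)%:M (p.2 : 'rV[R]_d).

Lemma torus_cons0 (d : nat) (p : RT * torus d) :
  (torus_cons p : 'rV[R]_d.+1) ord0 ord0 = p.1.
Proof.
have -> : (ord0 : 'I_d.+1) = lshift d (ord0 : 'I_1) by exact: val_inj.
by rewrite /torus_cons (row_mxEl (p.1%:M : 'rV_1)) mxE eqxx.
Qed.

Lemma torus_consS (d : nat) (p : RT * torus d) (j : 'I_d) :
  (torus_cons p : 'rV[R]_d.+1) ord0 (lift ord0 j) = (p.2 : 'rV[R]_d) ord0 j.
Proof.
have -> : (lift ord0 j : 'I_d.+1) = rshift 1 j by exact: val_inj.
by rewrite /torus_cons (row_mxEr (p.1%:M : 'rV_1)).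
Qed.

Lemma measurable_torus_cons (d : nat) :
  measurable_fun setT (@torus_cons d).
Proof.
apply: (measurability (@coord_cylinders d.+1 : set (set (torus d.+1)))) => //.
move=> _ [_ [j [B [mB ->]]] <-]; rewrite setTI.
have [->|[j' ->]] : j = ord0 \/ exists j', j = lift ord0 j'.
  by case: (unliftP ord0 j) => [k|] ->; [right; exists k|left].
- rewrite (_ : _ @^-1` _ = fst @^-1` B); last first.
    by apply/seteqP; split => p /=; rewrite torus_cons0.
  by have := @measurable_fst _ _ (RT) (torus d) measurableT B mB; rewrite setTI.
- rewrite (_ : _ @^-1` _ = (fun p : RT * torus d => (p.2 : 'rV[R]_d) ord0 j') @^-1` B); last first.
    by apply/seteqP; split => p /=; rewrite torus_consS.
  have := measurableT_comp (measurable_coord j') (@measurable_snd _ _ (RT) (torus d)).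
  by move=> /(_ measurableT B mB); rewrite setTI.
Qed.

HB.instance Definition _ d := @isMeasurableFun.Build _ _ _ _ _ (@measurable_torus_cons d).

Notation unif := (uniform_prob (@ltr01 R)).

(** Built by the recursion of [tint]: the law of [torus_cons] under the product of the uniform law
    on [[0, 1]] and the measure in one dimension less. Comparing the two takes one use of Fubini per
    dimension. *)
Fixpoint haar (d : nat) : probability (torus d) R :=
  match d return probability (torus d) R with
  | 0 => [the probability (torus 0) R of @dirac _ (torus 0) (0 : 'rV[R]_0) R]
  | d'.+1 => [the probability (torus d'.+1) R of
      distribution [the probability _ _ of (unif \x haar d')%E] (@torus_cons d')]
  end.

Lemma integral_unif (f : RT -> \bar R) : measurable_fun setT f ->
  (\int[unif]_x f x = \int[@lebesgue_measure R]_(x in `[0%R, 1%R]) f x)%E.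
Proof.
move=> mf; rewrite integralE [RHS]integralE.
rewrite !integral_uniform //; [|exact: measurable_funeneg|exact: measurable_funepos].
by rewrite !subr0 invr1 !mul1e.
Qed.

Lemma measurable_fubini_section d1 d2 (T1 : measurableType d1) (T2 : measurableType d2)
    (m2 : {sigma_finite_measure set T2 -> \bar R}) (f : T1 * T2 -> \bar R) :
  measurable_fun setT f -> measurable_fun setT (fun x => \int[m2]_y f (x, y))%E.
Proof.
move=> mf; rewrite (_ : (fun x => _) =
  (fun x => fubini_F m2 (f^\+)%E x - fubini_F m2 (f^\-)%E x)%E).
  by apply: emeasurable_funB; apply: measurable_fun_fubini_tonelli_F => //;
    [exact: measurable_funepos|exact: measurable_funeneg].
apply/funext => x; rewrite [LHS]integralE /fubini_F.
under eq_integral do rewrite funepos_comp/=.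
by under [X in (_ - X)%E = _]eq_integral do rewrite funeneg_comp/=.
Qed.

(** The parameter space is arbitrary because the induction moves the first coordinate of the torus
    into it. *)
Lemma measurable_tint (d : nat) dP (P : measurableType dP) (F : P * torus d -> \bar R) :
  measurable_fun setT F -> measurable_fun setT (fun p => @tint R d (fun v => F (p, v))).
Proof.
elim: d dP P F => [|d IHd] dP P F mF /=.
  exact: (measurableT_comp mF (pair2_measurable _)).
pose G (q : P * RT) := @tint R d (fun v => F (q.1, torus_cons (q.2, v))).
have mG : measurable_fun setT G.
  pose F' (q : (P * RT) * torus d) := F (q.1.1, torus_cons (q.1.2, q.2)).
  apply: (IHd _ _ F'); apply: (measurableT_comp mF).
  apply: measurable_fun_pair; first exact: (measurableT_comp measurable_fst measurable_fst).
  apply: (measurableT_comp (@measurable_torus_cons d)).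
  apply: measurable_fun_pair; last exact: measurable_snd.
  exact: (measurableT_comp measurable_snd measurable_fst).
rewrite (_ : (fun p => _) = (fun p => \int[unif]_y G (p, y))%E).
  exact: measurable_fubini_section.
apply/funext => p; rewrite integral_unif //.
exact: (measurableT_comp mG (pair1_measurable _)).
Qed.

Lemma tint_ge0 (d : nat) (f : torus d -> \bar R) :
  measurable_fun setT f -> (forall x, 0 <= f x)%E ->
  @tint R d f = (\int[haar d]_x f x)%E.
Proof.
elim: d f => [|d IHd] f mf f0 /=.
  by rewrite integral_dirac // diracT mul1e.
have mfc : measurable_fun setT (f \o @torus_cons d).
  exact: (measurableT_comp mf (@measurable_torus_cons d)).
rewrite (ge0_integral_distribution (@torus_cons d)) // fubini_tonelli1 //; last by move=> x; exact: f0.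
rewrite integral_unif; last by apply: measurable_fun_fubini_tonelli_F => // x; exact: f0.
apply: eq_integral => x _; rewrite IHd //.
exact: (measurableT_comp mfc (pair1_measurable _)).
Qed.

(** Fubini makes the sections of [f] integrable only almost everywhere, so the induction hypothesis
    equates the inner integrals almost everywhere; [measurable_tint] supplies the measurability that
    turns this into an equality of integrals. *)
Lemma tint_integrable (d : nat) (f : torus d -> \bar R) :
  (haar d).-integrable setT f -> @tint R d f = (\int[haar d]_x f x)%E.
Proof.
elim: d f => [|d IHd] f intf /=; have mf := measurable_int _ intf.
  by rewrite integral_dirac // diracT mul1e.
have mfc : measurable_fun setT (f \o @torus_cons d).
  exact: (measurableT_comp mf (@measurable_torus_cons d)).
have intfc : (unif \x haar d)%E.-integrable setT (f \o @torus_cons d).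
  move/integrableP: intf => [_ intf]; apply/integrableP; split=> //.
  rewrite (ge0_integral_distribution (@torus_cons d)) // in intf.
  exact: measurableT_comp.
rewrite (integral_distribution mf intfc) -integral12_prod_meas1 //.
have mt : measurable_fun setT (fun x : RT => @tint R d (fun v => f (torus_cons (x, v)))).
  exact: (@measurable_tint d _ (RT) (f \o @torus_cons d)).
rewrite -(integral_unif mt); apply: ae_eq_integral => //.
  exact: measurable_fubini_section.
have := ae_integrable1 intfc.
by apply: filterS => x intfx _; rewrite IHd.
Qed.

End TorusMeasure.

Local Open Scope complex_scope.
Local Notation "z ^*" := (conjc z) : ring_scope.

(** * Integration of complex functions *)

Section ComplexModulus.
Variable R : realType.
Implicit Types (z w : R[i]) (x : R).

Lemma cabs_normc z : cabs z = ComplexField.Normc.normc z.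
Proof. by case: z. Qed.

Lemma cabs_ge0 z : 0 <= cabs z.
Proof. exact: sqrtr_ge0. Qed.

Lemma sqr_cabs z : cabs z ^+ 2 = complex.Re z ^+ 2 + complex.Im z ^+ 2.
Proof. by rewrite sqr_sqrtr // addr_ge0 ?sqr_ge0. Qed.

Lemma cabs0 : cabs (0 : R[i]) = 0.
Proof. by rewrite cabs_normc ComplexField.Normc.normc0. Qed.

Lemma cabsM z w : cabs (z * w) = cabs z * cabs w.
Proof. by rewrite !cabs_normc ComplexField.Normc.normcM. Qed.

Lemma cabsV z : cabs z^-1 = (cabs z)^-1.
Proof. by rewrite !cabs_normc ComplexField.Normc.normcV. Qed.

Lemma cabsD z w : cabs (z + w) <= cabs z + cabs w.
Proof. by rewrite !cabs_normc complex.le_normcD. Qed.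

Lemma cabsN z : cabs (- z) = cabs z.
Proof. by rewrite !cabs_normc complex.normcN. Qed.

Lemma cabsB z w : cabs (z - w) <= cabs z + cabs w.
Proof. by rewrite (le_trans (cabsD _ _)) // cabsN. Qed.

Lemma cabsJ z : cabs z^* = cabs z.
Proof. by case: z => a b; rewrite /cabs /= sqrrN. Qed.

Lemma cabs_real x : cabs x%:C = `|x|.
Proof. by rewrite /cabs /= expr0n addr0 sqrtr_sqr. Qed.

Lemma cabs1 : cabs (1 : R[i]) = 1.
Proof. by rewrite (cabs_real 1) normr1. Qed.

Lemma cabsX z n : cabs (z ^+ n) = cabs z ^+ n.
Proof.
by elim: n => [|n IHn]; rewrite ?expr0 ?cabs1 // !exprS cabsM IHn.
Qed.

Lemma cabs_sum I (r : seq I) (Q : pred I) (F : I -> R[i]) :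
  cabs (\sum_(i <- r | Q i) F i) <= \sum_(i <- r | Q i) cabs (F i).
Proof.
elim/big_rec2: _ => [|i x z _ h]; first by rewrite cabs0.
by rewrite (le_trans (cabsD _ _)) // lerD2l.
Qed.

Lemma Re_le_cabs z : `|complex.Re z| <= cabs z.
Proof. by rewrite -sqrtr_sqr /cabs ler_wsqrtr // lerDl sqr_ge0. Qed.

Lemma Im_le_cabs z : `|complex.Im z| <= cabs z.
Proof. by rewrite -sqrtr_sqr /cabs ler_wsqrtr // lerDr sqr_ge0. Qed.

Lemma mulc_conj z : z * z^* = (cabs z ^+ 2)%:C.
Proof.
rewrite sqr_cabs; case: z => a b /=; apply/eqP; rewrite eq_complex /=.
by apply/andP; split; apply/eqP; ring.
Qed.

Lemma cabs_lerB z w : `|cabs z - cabs w| <= cabs (z - w).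
Proof.
rewrite ler_norml; apply/andP; split.
  rewrite lerNl opprB lerBlDr -(cabsN (z - w)) opprB.
  by rewrite (le_trans _ (cabsD _ _)) // subrK.
by rewrite lerBlDr (le_trans _ (cabsD _ _)) // subrK.
Qed.

Lemma ReD z w : complex.Re (z + w) = complex.Re z + complex.Re w.
Proof. by case: z w => [a b] [c e]. Qed.
Lemma ImD z w : complex.Im (z + w) = complex.Im z + complex.Im w.
Proof. by case: z w => [a b] [c e]. Qed.
Lemma ReM z w : complex.Re (z * w) = complex.Re z * complex.Re w - complex.Im z * complex.Im w.
Proof. by case: z w => [a b] [c e]. Qed.
Lemma ImM z w : complex.Im (z * w) = complex.Re z * complex.Im w + complex.Im z * complex.Re w.
Proof. by case: z w => [a b] [c e]. Qed.
Lemma ReJ z : complex.Re z^* = complex.Re z. Proof. by case: z. Qed.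
Lemma ImJ z : complex.Im z^* = - complex.Im z. Proof. by case: z. Qed.
Lemma complexP z w : complex.Re z = complex.Re w -> complex.Im z = complex.Im w -> z = w.
Proof. by case: z w => [a b] [c e] /= -> ->. Qed.
End ComplexModulus.

Arguments conjc : simpl never.

Section RealExpectation.
Context {R : realType} d {T : measurableType d} (P : probability T R).
Implicit Types (u v : T -> R).

Definition rL1 u := P.-integrable setT (EFin \o u).
Definition rbdd u := measurable_fun setT u /\ exists M, forall x, `|u x| <= M.

Lemma rL1_meas u : rL1 u -> measurable_fun setT u.
Proof. by move=> /measurable_int /measurable_EFinP. Qed.

Lemma rL1_le u v : measurable_fun setT u -> (forall x, `|u x| <= v x) -> rL1 v -> rL1 u.
Proof.
move=> mu uv; apply: le_integrable => //; first exact/measurable_EFinP.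
by move=> x _ /=; rewrite lee_fin (le_trans (uv x)) // ler_norm.
Qed.

Lemma rL1_cst c : rL1 (fun=> c).
Proof. exact: finite_measure_integrable_cst. Qed.

Lemma rbdd_L1 u : rbdd u -> rL1 u.
Proof. by move=> [mu [M uM]]; apply: (rL1_le mu uM); exact: rL1_cst. Qed.

Lemma rL1D u v : rL1 u -> rL1 v -> rL1 (fun x => u x + v x).
Proof. by move=> iu iv; exact: (integrableD measurableT iu iv). Qed.

Lemma rL1N u : rL1 u -> rL1 (fun x => - u x).
Proof. by move=> iu; exact: (integrableN iu). Qed.

Lemma rL1B u v : rL1 u -> rL1 v -> rL1 (fun x => u x - v x).
Proof. by move=> iu iv; apply: rL1D => //; exact: rL1N. Qed.

Lemma rL1Z c u : rL1 u -> rL1 (fun x => c * u x).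
Proof. by move=> iu; exact: (integrableZl measurableT c iu). Qed.

Lemma rL1_norm u : rL1 u -> rL1 (fun x => `|u x|).
Proof. by move=> iu; exact: (integrable_norm iu). Qed.

Lemma rbdd_cst c : rbdd (fun=> c).
Proof. by split=> //; exists `|c|. Qed.

Lemma rbddD u v : rbdd u -> rbdd v -> rbdd (fun x => u x + v x).
Proof.
move=> [mu [M uM]] [mv [N vN]]; split; first exact: measurable_funD.
by exists (M + N) => x; rewrite (le_trans (ler_normD _ _)) // lerD.
Qed.

Lemma rbddM u v : rbdd u -> rbdd v -> rbdd (fun x => u x * v x).
Proof.
move=> [mu [M uM]] [mv [N vN]]; split; first exact: measurable_funM.
by exists (M * N) => x; rewrite normrM ler_pM.
Qed.

Lemma rbddX u n : rbdd u -> rbdd (fun x => u x ^+ n).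
Proof.
move=> [mu [M uM]]; split; first exact: measurable_funX.
by exists (M ^+ n) => x; rewrite normrX lerXn2r // nnegrE // (le_trans _ (uM x)).
Qed.

Lemma rbdd_sum I (r : seq I) (F : I -> T -> R) :
  (forall i, rbdd (F i)) -> rbdd (fun x => \sum_(i <- r) F i x).
Proof.
move=> bF; elim: r => [|i r IHr].
  by under eq_fun do rewrite big_nil; exact: rbdd_cst.
by under eq_fun do rewrite big_cons; exact: rbddD.
Qed.

Definition Er u : R := \int[P]_x u x.

Lemma ErD u v : rL1 u -> rL1 v -> Er (fun x => u x + v x) = Er u + Er v.
Proof. by move=> iu iv; exact: RintegralD. Qed.

Lemma ErZ c u : rL1 u -> Er (fun x => c * u x) = c * Er u.
Proof. by move=> iu; exact: RintegralZl. Qed.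

Lemma ErB u v : rL1 u -> rL1 v -> Er (fun x => u x - v x) = Er u - Er v.
Proof. by move=> iu iv; exact: RintegralB. Qed.

Lemma Er_cst c : Er (fun=> c) = c.
Proof.
rewrite /Er Rintegral_cst //.
have -> : fine (P [set: T]) = 1 by rewrite (@probability_setT _ _ _ P).
by rewrite mulr1.
Qed.

Lemma le_Er u v : rL1 u -> rL1 v -> (forall x, u x <= v x) -> Er u <= Er v.
Proof. by move=> iu iv uv; apply: le_Rintegral. Qed.

Lemma Er_ge0 u : (forall x, 0 <= u x) -> 0 <= Er u.
Proof. by move=> u0; apply: Rintegral_ge0. Qed.

Lemma normr_Er u : rL1 u -> `|Er u| <= Er (fun x => `|u x|).
Proof. by move=> iu; exact: le_normr_Rintegral. Qed.

Lemma EFin_Er u : rL1 u -> (Er u)%:E = (\int[P]_x (u x)%:E)%E.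
Proof. by move=> iu; rewrite /Er /Rintegral fineK //; exact: integrable_fin_num. Qed.

End RealExpectation.

Section ComplexExpectation.
Context {R : realType} d {T : measurableType d} (P : probability T R).
Implicit Types (f g : T -> R[i]) (u : T -> R).
Local Notation rL1 := (rL1 P).
Local Notation Er := (Er P).

Definition cmeas f := measurable_fun setT (fun x => complex.Re (f x)) /\
                      measurable_fun setT (fun x => complex.Im (f x)).
Definition cbdd f := cmeas f /\ exists M, forall x, cabs (f x) <= M.
Definition cL1 f := cmeas f /\ rL1 (fun x => cabs (f x)).
Definition Ec f : R[i] :=
  Complex (Er (fun x => complex.Re (f x))) (Er (fun x => complex.Im (f x))).

Lemma cmeas_cabs f : cmeas f -> measurable_fun setT (fun x => cabs (f x)).
Proof.
move=> [mr mi]; rewrite /cabs; under eq_fun do rewrite -powR12_sqrt ?addr_ge0 ?sqr_ge0 //.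
apply: (@measurableT_comp _ _ _ _ _ _ (fun x => x `^ 2^-1)).
  exact: measurable_powR.
by apply: measurable_funD; exact: measurable_funX.
Qed.

Lemma cmeasD f g : cmeas f -> cmeas g -> cmeas (fun x => f x + g x).
Proof.
move=> [? ?] [? ?]; split.
  by under eq_fun do rewrite ReD; exact: measurable_funD.
by under eq_fun do rewrite ImD; exact: measurable_funD.
Qed.

Lemma cmeasM f g : cmeas f -> cmeas g -> cmeas (fun x => f x * g x).
Proof.
move=> [? ?] [? ?]; split.
  by under eq_fun do rewrite ReM; apply: measurable_funB; exact: measurable_funM.
by under eq_fun do rewrite ImM; apply: measurable_funD; exact: measurable_funM.
Qed.

Lemma cmeasJ f : cmeas f -> cmeas (fun x => (f x)^*).
Proof.
move=> [? ?]; split; first by under eq_fun do rewrite ReJ.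
by under eq_fun do rewrite ImJ; exact: measurableT_comp.
Qed.

Lemma cmeas_real u : measurable_fun setT u -> cmeas (fun x => (u x)%:C).
Proof. by split => //=; exact: measurable_cst. Qed.

Lemma cmeas_cst (c : R[i]) : cmeas (fun=> c).
Proof. by split; exact: measurable_cst. Qed.

Lemma cbdd_cst (c : R[i]) : cbdd (fun=> c).
Proof. by split; [exact: cmeas_cst|exists (cabs c)]. Qed.

Lemma cbddD f g : cbdd f -> cbdd g -> cbdd (fun x => f x + g x).
Proof.
move=> [mf [M fM]] [mg [N gN]]; split; first exact: cmeasD.
by exists (M + N) => x; rewrite (le_trans (cabsD _ _)) // lerD.
Qed.

Lemma cbddM f g : cbdd f -> cbdd g -> cbdd (fun x => f x * g x).
Proof.
move=> [mf [M fM]] [mg [N gN]]; split; first exact: cmeasM.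
by exists (M * N) => x; rewrite cabsM ler_pM ?cabs_ge0.
Qed.

Lemma cbddJ f : cbdd f -> cbdd (fun x => (f x)^*).
Proof.
move=> [mf [M fM]]; split; first exact: cmeasJ.
by exists M => x; rewrite cabsJ.
Qed.

Lemma cbdd_real u : rbdd u -> cbdd (fun x => (u x)%:C).
Proof.
move=> [mu [M uM]]; split; first exact: cmeas_real.
by exists M => x; rewrite cabs_real.
Qed.

Lemma cbddN f : cbdd f -> cbdd (fun x => - f x).
Proof.
by move=> bf; under eq_fun do rewrite -mulN1r; apply: cbddM => //; exact: cbdd_cst.
Qed.

Lemma cbddB f g : cbdd f -> cbdd g -> cbdd (fun x => f x - g x).
Proof. by move=> bf bg; apply: cbddD => //; exact: cbddN. Qed.

Lemma cbdd_sum I (r : seq I) (F : I -> T -> R[i]) :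
  (forall i, cbdd (F i)) -> cbdd (fun x => \sum_(i <- r) F i x).
Proof.
move=> bF; elim: r => [|i r IHr].
  by under eq_fun do rewrite big_nil; exact: cbdd_cst.
by under eq_fun do rewrite big_cons; exact: cbddD.
Qed.

Lemma cbdd_cabs f : cbdd f -> rbdd (fun x => cabs (f x)).
Proof.
move=> [mf [M fM]]; split; first exact: cmeas_cabs.
by exists M => x; rewrite ger0_norm ?cabs_ge0.
Qed.

Lemma cbdd_Re f : cbdd f -> rbdd (fun x => complex.Re (f x)).
Proof.
by move=> [[mf _] [M fM]]; split=> //; exists M => x; rewrite (le_trans (Re_le_cabs _)).
Qed.

Lemma cbdd_L1 f : cbdd f -> cL1 f.
Proof. by move=> bf; split; [case: bf|exact/rbdd_L1/cbdd_cabs]. Qed.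

Lemma cL1_le f u : cmeas f -> (forall x, cabs (f x) <= u x) -> rL1 u -> cL1 f.
Proof.
move=> mf fu iu; split=> //; apply: rL1_le iu; first exact: cmeas_cabs.
by move=> x; rewrite ger0_norm ?cabs_ge0.
Qed.

Lemma cL1D f g : cL1 f -> cL1 g -> cL1 (fun x => f x + g x).
Proof.
move=> [mf lf] [mg lg]; apply: (cL1_le _ (fun x => cabsD (f x) (g x))); first exact: cmeasD.
exact: rL1D.
Qed.

Lemma cL1M f g : cL1 f -> cbdd g -> cL1 (fun x => f x * g x).
Proof.
move=> [mf lf] [mg [M gM]].
apply: (@cL1_le _ (fun x => M * cabs (f x))); first exact: cmeasM.
  by move=> x; rewrite cabsM mulrC ler_wpM2r ?cabs_ge0.
exact: rL1Z.
Qed.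

Lemma cL1N f : cL1 f -> cL1 (fun x => - f x).
Proof.
move=> lf; under eq_fun do rewrite -mulrN1; apply: cL1M => //; exact: cbdd_cst.
Qed.

Lemma cL1B f g : cL1 f -> cL1 g -> cL1 (fun x => f x - g x).
Proof. by move=> lf lg; apply: cL1D => //; exact: cL1N. Qed.

Lemma cL1_Re f : cL1 f -> rL1 (fun x => complex.Re (f x)).
Proof. by move=> [[m _] l]; apply: rL1_le l => // x; exact: Re_le_cabs. Qed.

Lemma cL1_Im f : cL1 f -> rL1 (fun x => complex.Im (f x)).
Proof. by move=> [[_ m] l]; apply: rL1_le l => // x; exact: Im_le_cabs. Qed.

Lemma EcD f g : cL1 f -> cL1 g -> Ec (fun x => f x + g x) = Ec f + Ec g.
Proof.
move=> lf lg; apply: complexP => /=.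
  by under eq_fun do rewrite ReD; rewrite ErD //; exact: cL1_Re.
by under eq_fun do rewrite ImD; rewrite ErD //; exact: cL1_Im.
Qed.

Lemma EcZ c f : cL1 f -> Ec (fun x => c * f x) = c * Ec f.
Proof.
move=> lf; have lr := cL1_Re lf; have li := cL1_Im lf; apply: complexP => /=.
  under eq_fun do rewrite ReM; rewrite ErB ?ErZ //; [by rewrite ReM|exact: rL1Z|exact: rL1Z].
under eq_fun do rewrite ImM; rewrite ErD ?ErZ //; [by rewrite ImM|exact: rL1Z|exact: rL1Z].
Qed.

Lemma EcB f g : cL1 f -> cL1 g -> Ec (fun x => f x - g x) = Ec f - Ec g.
Proof.
move=> lf lg; rewrite EcD //; last exact: cL1N.
congr (_ + _); rewrite -mulN1r -EcZ //; congr Ec; apply/funext => x.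
by rewrite mulN1r.
Qed.

Lemma Ec_real u : Ec (fun x => (u x)%:C) = (Er u)%:C.
Proof. by apply: complexP => //=; exact: Er_cst. Qed.

Lemma Ec_cst c : Ec (fun=> c) = c.
Proof. by apply: complexP => /=; exact: Er_cst. Qed.

Lemma Ec_sum I (r : seq I) (F : I -> T -> R[i]) :
  (forall i, cL1 (F i)) -> Ec (fun x => \sum_(i <- r) F i x) = \sum_(i <- r) Ec (F i).
Proof.
move=> iF.
have h : cL1 (fun x => \sum_(i <- r) F i x) /\
         Ec (fun x => \sum_(i <- r) F i x) = \sum_(i <- r) Ec (F i).
  elim: r => [|i r [IH1 IH2]].
    rewrite big_nil; under eq_fun do rewrite big_nil.
    by split; [exact/cbdd_L1/cbdd_cst|exact: Ec_cst].
  rewrite big_cons -IH2; under eq_fun do rewrite big_cons.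
  by split; [exact: cL1D|exact: EcD].
by case: h.
Qed.

(** Multiplying [f] by the conjugate of [Ec f] makes the mean equal to [|Ec f|^2], and a real part
    is at most the modulus. *)
Lemma cabs_Ec f : cL1 f -> cabs (Ec f) <= Er (fun x => cabs (f x)).
Proof.
move=> lf; have [E0|E0] := eqVneq (cabs (Ec f)) 0.
  by rewrite E0; apply: Er_ge0 => x; exact: cabs_ge0.
have E1 : 0 < cabs (Ec f) by rewrite lt0r E0 cabs_ge0.
rewrite -(ler_pM2l E1) -expr2.
have lJ : cL1 (fun x => (Ec f)^* * f x).
  by under eq_fun do rewrite mulrC; apply: cL1M => //; exact: cbdd_cst.
have -> : cabs (Ec f) ^+ 2 = complex.Re (Ec (fun x => (Ec f)^* * f x)).
  by rewrite EcZ // mulrC mulc_conj.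
rewrite -ErZ; last by case: lf.
apply: le_Er; [exact: cL1_Re|by apply: rL1Z; case: lf|].
by move=> x; rewrite (le_trans (ler_norm _)) // (le_trans (Re_le_cabs _)) // cabsM cabsJ.
Qed.

Lemma Re_Ec f : complex.Re (Ec f) = Er (fun x => complex.Re (f x)).
Proof. by []. Qed.

End ComplexExpectation.

(** * Characters *)

Section UnitCircle.
Variable R : realType.
Implicit Types (s t : R).

Definition cis t : R[i] := Complex (cos t) (sin t).

Lemma cis0 : cis 0 = 1.
Proof. by rewrite /cis cos0 sin0. Qed.

Lemma cisD s t : cis (s + t) = cis s * cis t.
Proof. by apply: complexP; rewrite /= ?cosD ?sinD // addrC. Qed.

Lemma cisN t : cis (- t) = (cis t)^*.
Proof. by apply: complexP; rewrite /= ?cosN ?sinN. Qed.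

Lemma cabs_cis t : cabs (cis t) = 1.
Proof. by rewrite /cabs /= cos2Dsin2 sqrtr1. Qed.

Lemma cis_int (k : int) : cis (2 * pi * k%:~R) = 1.
Proof.
have h (n : nat) : cis (2 * pi * n%:R) = 1.
  elim: n => [|n IHn]; first by rewrite mulr0 cis0.
  rewrite -(natr1 n) mulrDr mulr1 cisD IHn mul1r /cis.
  by rewrite mulrC mulr_natr cos2pi sin2pi.
case: k => n; first exact: h.
by rewrite NegzE mulrNz mulrN cisN h; apply: complexP => //=; rewrite oppr0.
Qed.

End UnitCircle.

Section Characters.
Variable R : realType.
Local Notation RT := (g_sigma_algebraType R.-ocitv.-measurable).
Local Notation unif := (uniform_prob (@ltr01 R)).
Local Notation haar := (@haar R).
Local Notation torus := (@torus R).

Lemma measurable_cos : measurable_fun setT (@cos R : R -> R).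
Proof. by apply: continuous_measurable_fun; exact: continuous_cos. Qed.

Lemma measurable_sin : measurable_fun setT (@sin R : R -> R).
Proof. by apply: continuous_measurable_fun; exact: continuous_sin. Qed.

Lemma cbdd_cis d (T : measurableType d) (u : T -> R) :
  measurable_fun setT u -> cbdd (fun x => cis (u x)).
Proof.
move=> mu; split; last by exists 1 => x; rewrite cabs_cis.
by split => /=; apply: measurableT_comp => //; [exact: measurable_cos|exact: measurable_sin].
Qed.

Lemma Er_unif (u : RT -> R) : measurable_fun setT u ->
  Er unif u = fine (\int[@lebesgue_measure R]_(x in `[0%R, 1%R]) (u x)%:E)%E.
Proof. by move=> mu; rewrite /Er /Rintegral integral_unif //; exact/measurable_EFinP. Qed.

Lemma Er_unif_deriv (f F : R -> R) :
  continuous f -> (forall x : R, is_derive x 1 F (f x)) -> Er unif (f : RT -> R) = F 1 - F 0.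
Proof.
move=> cf dF; rewrite Er_unif; last exact: continuous_measurable_fun.
have cF x : {for x, continuous F}.
  by apply: differentiable_continuous; apply/derivable1_diffP; have [] := dF x.
rewrite (@continuous_FTC2 R f F 0 1) //=.
- exact: continuous_subspaceT.
- split.
  + by move=> x _; have [] := dF x.
  + exact/cvg_at_right_filter/cF.
  + exact/cvg_at_left_filter/cF.
- by move=> x _; rewrite derive1E; have [_ ->] := dF x.
Qed.

(** For [k != 0] the primitives [sin (c x) / c] and [- cos (c x) / c], with [c = 2 pi k], take equal
    values at 0 and 1. *)
Lemma Ec_unif_cis (k : int) :
  Ec unif (fun x : RT => cis (2 * pi * (k%:~R * (x : R)))) = (k == 0)%:R.
Proof.
have [->|k0] := eqVneq k 0.
  under eq_fun do rewrite mul0r mulr0 cis0; exact: Ec_cst.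
pose c : R := 2 * pi * k%:~R.
have c0 : c != 0 by rewrite !mulf_neq0 ?intr_eq0 // gt_eqF ?pi_gt0.
have cM (x : R) : 2 * pi * (k%:~R * x) = c * x by rewrite mulrA.
have [cosc sinc] : cos c = 1 /\ sin c = 0 by have := cis_int R k; case.
have dl (x : R) : is_derive x 1 (fun x => c * x) c.
  have := is_deriveZ c (is_derive_id x (1 : R)).
  by rewrite /GRing.scale /= mulr1.
have dS (x : R) : is_derive x 1 (fun x => c^-1 * sin (c * x)) (cos (c * x)).
  have h : is_derive x 1 (@sin R \o (fun x => c * x)) (c * cos (c * x)).
    by have := is_derive1_comp (is_derive_sin (c * x)) (dl x); rewrite mulrC.
  have := is_deriveZ c^-1 h.
  by rewrite /GRing.scale /= mulrA mulVf // mul1r.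
have dC (x : R) : is_derive x 1 (fun x => - c^-1 * cos (c * x)) (sin (c * x)).
  have h : is_derive x 1 (@cos R \o (fun x => c * x)) (c * - sin (c * x)).
    by have := is_derive1_comp (is_derive_cos (c * x)) (dl x); rewrite mulrC.
  have := is_deriveZ (- c^-1) h.
  by rewrite /GRing.scale /= mulrA mulNr mulVf // mulN1r opprK.
apply: complexP => /=; under eq_fun do rewrite cM.
- rewrite (Er_unif_deriv _ dS); first by rewrite !mulr1 mulr0 sin0 sinc subrr.
  by move=> x; apply: continuous_comp; [exact: mulrl_continuous|exact: continuous_cos].
- rewrite (Er_unif_deriv _ dC); first by rewrite !mulr1 mulr0 cos0 cosc subrr.
  by move=> x; apply: continuous_comp; [exact: mulrl_continuous|exact: continuous_sin].
Qed.

Lemma Er_prod d1 d2 (T1 : measurableType d1) (T2 : measurableType d2)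
    (P1 : probability T1 R) (P2 : probability T2 R) (u : T1 -> R) (v : T2 -> R) :
  rbdd u -> rbdd v ->
  Er [the probability _ _ of (P1 \x P2)%E] (fun z => u z.1 * v z.2) = Er P1 u * Er P2 v.
Proof.
move=> bu bv.
have buv : rbdd (fun z : T1 * T2 => u z.1 * v z.2).
  apply: rbddM.
    by case: bu => mu [M uM]; split; [exact: measurableT_comp|exists M => x].
  by case: bv => mv [M vM]; split; [exact: measurableT_comp|exists M => x].
have ib : (P1 \x P2)%E.-integrable setT (EFin \o (fun z : T1 * T2 => u z.1 * v z.2)).
  exact: (rbdd_L1 [the probability _ _ of (P1 \x P2)%E] buv).
rewrite /Er /Rintegral -(integral12_prod_meas1 ib) /fubini_F /=.
have iu := rbdd_L1 P1 bu; have iv := rbdd_L1 P2 bv.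
have -> : (fun x => \int[P2]_y (u x * v y)%:E)%E = (fun x => (Er P2 v * u x)%:E).
  by apply/funext => x; rewrite mulrC -(ErZ _ iv) EFin_Er //; exact: (rL1Z _ iv).
by rewrite -(EFin_Er (rL1Z _ iu)) /= (ErZ _ iu) mulrC.
Qed.

Lemma Ec_prod d1 d2 (T1 : measurableType d1) (T2 : measurableType d2)
    (P1 : probability T1 R) (P2 : probability T2 R) (f : T1 -> R[i]) (g : T2 -> R[i]) :
  cbdd f -> cbdd g ->
  Ec [the probability _ _ of (P1 \x P2)%E] (fun z => f z.1 * g z.2) = Ec P1 f * Ec P2 g.
Proof.
move=> bf bg.
have bIm (d3 : measure_display) (T3 : measurableType d3) (h : T3 -> R[i]) :
    cbdd h -> rbdd (fun x => complex.Im (h x)).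
  by move=> [[_ mh] [M hM]]; split=> //; exists M => x; rewrite (le_trans (Im_le_cabs _)).
have br := @cbdd_Re R.
have b1 (u : T1 -> R) : rbdd u -> rbdd (fun z : T1 * T2 => u z.1).
  by case=> mu [M uM]; split; [exact: measurableT_comp|exists M => x].
have b2 (u : T2 -> R) : rbdd u -> rbdd (fun z : T1 * T2 => u z.2).
  by case=> mu [M uM]; split; [exact: measurableT_comp|exists M => x].
have bp u v : rbdd u -> rbdd v ->
    rL1 [the probability _ _ of (P1 \x P2)%E] (fun z : T1 * T2 => u z.1 * v z.2).
  by move=> bu bv; apply: rbdd_L1; apply: rbddM; [exact: b1|exact: b2].
apply: complexP => /=.
  under eq_fun do rewrite ReM.
  rewrite ErB; [|exact: (bp _ _ (br _ _ _ bf) (br _ _ _ bg))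
               |exact: (bp _ _ (bIm _ _ _ bf) (bIm _ _ _ bg))].
  by rewrite (Er_prod P1 P2 (br _ _ _ bf) (br _ _ _ bg)) (Er_prod P1 P2 (bIm _ _ _ bf) (bIm _ _ _ bg)).
under eq_fun do rewrite ImM.
rewrite ErD; [|exact: (bp _ _ (br _ _ _ bf) (bIm _ _ _ bg))
             |exact: (bp _ _ (bIm _ _ _ bf) (br _ _ _ bg))].
by rewrite (Er_prod P1 P2 (br _ _ _ bf) (bIm _ _ _ bg)) (Er_prod P1 P2 (bIm _ _ _ bf) (br _ _ _ bg)).
Qed.

Lemma Ec_haarS (d : nat) (f : torus d.+1 -> R[i]) : cbdd f ->
  Ec (haar d.+1) f =
  Ec [the probability _ _ of (unif \x haar d)%E] (f \o @torus_cons R d).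
Proof.
move=> bf.
have h (u : torus d.+1 -> R) : rbdd u -> Er (haar d.+1) u =
    Er [the probability _ _ of (unif \x haar d)%E] (u \o @torus_cons R d).
  move=> bu; rewrite /Er /Rintegral /=; congr fine.
  rewrite (@integral_distribution _ _ _ _ _ _ (@torus_cons R d) (EFin \o u)) //.
    by apply/measurable_EFinP; case: bu.
  have [mu [M uM]] := bu.
  apply: (@rbdd_L1 R _ _ [the probability _ _ of (unif \x haar d)%E] (u \o @torus_cons R d)).
  split; last by exists M => x; exact: uM.
  by apply: (measurableT_comp mu); exact: measurable_torus_cons.
apply: complexP => /=; rewrite h //; first exact: cbdd_Re.
by case: bf => [[_ mh] [M hM]]; split=> //; exists M => x; rewrite (le_trans (Im_le_cabs _)).
Qed.

Definition dotp (d : nat) (a : 'rV[int]_d) (x : 'rV[R]_d) : R :=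
  \sum_(j < d) (a ord0 j)%:~R * x ord0 j.

Definition ex (d : nat) (a : 'rV[int]_d) (x : torus d) : R[i] :=
  cis (2 * pi * dotp a (x : 'rV[R]_d)).

Lemma dotpD d (a b : 'rV[int]_d) x : dotp (a + b) x = dotp a x + dotp b x.
Proof.
rewrite /dotp -big_split /=; apply: eq_bigr => j _.
by rewrite mxE intrD mulrDl.
Qed.

Lemma dotpN d (a : 'rV[int]_d) x : dotp (- a) x = - dotp a x.
Proof.
rewrite /dotp -sumrN; apply: eq_bigr => j _.
by rewrite mxE intrN mulNr.
Qed.

Lemma exD d (a b : 'rV[int]_d) x : ex (a + b) x = ex a x * ex b x.
Proof. by rewrite /ex dotpD mulrDr cisD. Qed.

Lemma exN d (a : 'rV[int]_d) x : ex (- a) x = (ex a x)^*.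
Proof. by rewrite /ex dotpN mulrN cisN. Qed.

Lemma ex0 d (x : torus d) : ex 0 x = 1.
Proof. by rewrite /ex /dotp big1 ?mulr0 ?cis0 // => j _; rewrite mxE mul0r. Qed.

Lemma cabs_ex d (a : 'rV[int]_d) x : cabs (ex a x) = 1.
Proof. exact: cabs_cis. Qed.

Lemma cbdd_ex d (a : 'rV[int]_d) : cbdd (ex a).
Proof.
apply: cbdd_cis; apply: measurable_funM => //.
apply: measurable_sum => j; apply: measurable_funM => //; exact: measurable_coord.
Qed.

Lemma Ec_ex d (a : 'rV[int]_d) : Ec (haar d) (ex a) = (a == 0)%:R.
Proof.
elim: d a => [|d IHd] a.
  rewrite [a]thinmx0 eqxx (_ : ex 0 = fun=> 1); first exact: Ec_cst.
  by apply/funext => x; rewrite ex0.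
rewrite Ec_haarS; last exact: cbdd_ex.
pose a' : 'rV[int]_d := \row_j a ord0 (lift ord0 j).
have -> : (ex a \o @torus_cons R d) =
    (fun z => cis (2 * pi * ((a ord0 ord0)%:~R * z.1)) * ex a' z.2).
  apply/funext => z; rewrite /= /ex -cisD -mulrDr /dotp big_ord_recl torus_cons0.
  congr (cis (_ * (_ + _))); apply: eq_bigr => j _; rewrite torus_consS.
  by rewrite mxE.
rewrite (Ec_prod _ (haar d) (f := fun x : RT => cis (2 * pi * ((a ord0 ord0)%:~R * (x : R))))).
- rewrite Ec_unif_cis IHd -natrM mulnb; congr (nat_of_bool _)%:R.
  apply/andP/eqP => [[/eqP a0 /eqP aS]|a0]; last first.
    by rewrite /a' a0 mxE; split=> //; apply/eqP/rowP => j; rewrite !mxE.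
  apply/rowP => j; rewrite mxE; case: (unliftP ord0 j) => [k|] -> //.
  by have /rowP/(_ k) := aS; rewrite !mxE.
- by apply: cbdd_cis; apply: measurable_funM => //; exact: measurable_funM.
- exact: cbdd_ex.
Qed.

Lemma fourierE d (f : torus d -> R[i]) (a : 'rV[int]_d) : cL1 (haar d) f ->
  fourier f a = Ec (haar d) (fun x => f x * (ex a x)^*).
Proof.
move=> lf; rewrite /fourier /cint.
have lg : cL1 (haar d) (fun x => f x * (ex a x)^*).
  by apply: cL1M => //; apply: cbddJ; exact: cbdd_ex.
have h (u w : torus d -> R) : rL1 (haar d) u -> (forall x, w x = u x) ->
    fine (tint (fun x => (w x)%:E)) = Er (haar d) u.
  move=> iu wu; rewrite (_ : (fun x => (w x)%:E) = EFin \o u); last first.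
    by apply/funext => x; rewrite wu.
  by rewrite (@tint_integrable R d (EFin \o u)).
apply: complexP => /=; apply: h; try exact: (cL1_Re lg); try exact: (cL1_Im lg).
  by move=> x; rewrite ReM /= mulrN opprK.
by move=> x; rewrite ImM /= mulrN addrC.
Qed.

End Characters.

(** * Trigonometric polynomials *)

Section TrigPoly.
Variables (R : realType) (d : nat).
Local Notation torus := (@torus R d).
Local Notation P := (@haar R d).
Implicit Types (S : 'rV[int]_d -> bool) (f g : torus -> R[i]).

(** Frequencies may repeat and coefficients may vanish: sums are concatenations, and [S] bounds the
    spectrum without any Fourier coefficient being computed. *)
Definition trig S f := exists2 s : seq (R[i] * 'rV[int]_d),
  all (fun p => S p.2) s & forall x, f x = \sum_(p <- s) p.1 * ex p.2 x.

Lemma trig_ext S f g : f =1 g -> trig S f -> trig S g.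
Proof. by move=> fg [s sS fE]; exists s => // x; rewrite -fg. Qed.

Lemma trig_sub S S' f : (forall a, S a -> S' a) -> trig S f -> trig S' f.
Proof. by move=> SS' [s sS fE]; exists s => //; apply: sub_all sS => p; exact: SS'. Qed.

Lemma trig_ex S c a : S a -> trig S (fun x => c * ex a x).
Proof.
by move=> Sa; exists [:: (c, a)] => [|x]; rewrite /= ?Sa // big_seq1.
Qed.

Lemma trig0 S : trig S (fun=> 0).
Proof. by exists [::] => // x; rewrite big_nil. Qed.

Lemma trig_cst S c : S 0 -> trig S (fun=> c).
Proof. by move=> S0; apply: trig_ext (trig_ex c S0) => x; rewrite ex0 mulr1. Qed.

Lemma trigD S f g : trig S f -> trig S g -> trig S (fun x => f x + g x).
Proof.
move=> [s sS fE] [t tS gE]; exists (s ++ t) => [|x]; first by rewrite all_cat sS.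
by rewrite big_cat -fE -gE.
Qed.

Lemma trig_sum S I (r : seq I) (F : I -> torus -> R[i]) :
  (forall i, trig S (F i)) -> trig S (fun x => \sum_(i <- r) F i x).
Proof.
move=> tF; elim: r => [|i r IHr].
  by apply: trig_ext (trig0 S) => x; rewrite big_nil.
by apply: trig_ext (trigD (tF i) IHr) => x; rewrite big_cons.
Qed.

(** The predicate must respect pointwise equality because a polynomial comes with some list of
    terms, not with a canonical one. *)
Lemma trig_elim S (Q : (torus -> R[i]) -> Prop) :
  (forall f g, f =1 g -> Q f -> Q g) -> Q (fun=> 0) ->
  (forall c a f, S a -> Q f -> Q (fun x => c * ex a x + f x)) ->
  forall f, trig S f -> Q f.
Proof.
move=> Qe Q0 QD f [s sS fE]; apply: (Qe _ _ (fsym fE)) => {f fE}.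
elim: s sS => [|[c a] s IHs] /=; first by move=> _; apply: Qe Q0 => x; rewrite big_nil.
move=> /andP[Sa sS]; apply: Qe (QD c a _ Sa (IHs sS)) => x.
by rewrite big_cons.
Qed.

Lemma trigZ S c f : trig S f -> trig S (fun x => c * f x).
Proof.
elim/trig_elim => {f} [f g fg|| c' a f Sa].
- by apply: trig_ext => x; rewrite fg.
- by apply: trig_ext (trig0 S) => x; rewrite mulr0.
- by move/(trigD (trig_ex (c * c') Sa)); apply: trig_ext => x; rewrite mulrDr mulrA.
Qed.

Lemma trigN S f : trig S f -> trig S (fun x => - f x).
Proof. by move/(trigZ (-1)); apply: trig_ext => x; rewrite mulN1r. Qed.

Lemma trigB S f g : trig S f -> trig S g -> trig S (fun x => f x - g x).
Proof. by move=> tf tg; apply: trigD => //; exact: trigN. Qed.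

Lemma trigM S S' S'' f g : (forall a b, S a -> S' b -> S'' (a + b)) ->
  trig S f -> trig S' g -> trig S'' (fun x => f x * g x).
Proof.
move=> SS' tf tg; elim/trig_elim: f / tf => [f f' ff'||c a f Sa].
- by apply: trig_ext => x; rewrite ff'.
- by apply: trig_ext (trig0 _) => x; rewrite mul0r.
suff tag : trig S'' (fun x => c * ex a x * g x).
  by move/(trigD tag); apply: trig_ext => x; rewrite mulrDl.
elim/trig_elim: g / tg => [g g' gg'||e b g S'b].
- by apply: trig_ext => x; rewrite gg'.
- by apply: trig_ext (trig0 _) => x; rewrite mulr0.
move/(trigD (trig_ex (c * e) (SS' _ _ Sa S'b))); apply: trig_ext => x.
by rewrite exD mulrDr mulrACA.
Qed.

Lemma trigX S f n : S 0 -> (forall a b, S a -> S b -> S (a + b)) ->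
  trig S f -> trig S (fun x => f x ^+ n).
Proof.
move=> S0 SD tf; elim: n => [|n IHn]; first exact: (trig_cst 1 S0).
by apply: trig_ext (trigM SD tf IHn) => x; rewrite exprS.
Qed.

Lemma trigJ S S' f : (forall a, S a -> S' (- a)) ->
  trig S f -> trig S' (fun x => (f x)^*).
Proof.
move=> SS'; elim/trig_elim => {f} [f g fg||c a f Sa].
- by apply: trig_ext => x; rewrite fg.
- by apply: trig_ext (trig0 _) => x; rewrite rmorph0.
move/(trigD (trig_ex c^* (SS' _ Sa))); apply: trig_ext => x.
by rewrite exN rmorphD rmorphM.
Qed.

(* The decomposition of f according to a set A of frequencies replaces the corresponding projection. *)
Lemma trig_split S (A : 'rV[int]_d -> bool) f : trig S f ->
  exists g h, [/\ trig (fun a => S a && A a) g, trig (fun a => S a && ~~ A a) h &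
                  forall x, f x = g x + h x].
Proof.
elim/trig_elim => {f} [f g fg [u [v [tu tv E]]]||c a f Sa [g [h [tg th E]]]].
- by exists u, v; split=> // x; rewrite -fg.
- by exists (fun=> 0), (fun=> 0); split=> [||x]; rewrite ?addr0 //; exact: trig0.
- have [Aa|nAa] := boolP (A a).
    exists (fun x => c * ex a x + g x), h; split=> // [|x].
      by apply: trigD => //; apply: trig_ex; rewrite Sa Aa.
    by rewrite E addrA.
  exists g, (fun x => c * ex a x + h x); split=> // [|x].
    by apply: trigD => //; apply: trig_ex; rewrite Sa nAa.
  by rewrite E addrCA.
Qed.

Lemma trig_cbdd S f : trig S f -> cbdd f.
Proof.
move=> [s _ fE]; rewrite (_ : f = fun x => \sum_(p <- s) p.1 * ex p.2 x); last exact/funext.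
by apply: cbdd_sum => p; apply: cbddM; [exact: cbdd_cst|exact: cbdd_ex].
Qed.

Lemma trig_cL1 S f : trig S f -> cL1 P f.
Proof. by move=> /trig_cbdd; exact: cbdd_L1. Qed.

Lemma Ec_mul_trigJ0 S f h : cL1 P f ->
  (forall a, S a -> Ec P (fun x => f x * (ex a x)^*) = 0) -> trig S h ->
  Ec P (fun x => f x * (h x)^*) = 0.
Proof.
move=> lf f0 [s sS hE].
have lfe a : cL1 P (fun x => f x * (ex a x)^*).
  by apply: cL1M => //; apply: cbddJ; exact: cbdd_ex.
have lfe' (c : R[i]) a : cL1 P (fun x => c * (f x * (ex a x)^*)).
  by under eq_fun do rewrite mulrC; apply: cL1M => //; exact: cbdd_cst.
rewrite (_ : (fun x => _) = fun x => \sum_(p <- s) p.1^* * (f x * (ex p.2 x)^*)); last first.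
  apply/funext => x; rewrite hE rmorph_sum mulr_sumr; apply: eq_bigr => p _.
  by rewrite rmorphM; ring.
rewrite Ec_sum // big1_seq // => p /andP[_ ps].
by rewrite EcZ // f0 ?mulr0 //; move/allP: sS; exact.
Qed.

Lemma Ec_ex_exJ a b : Ec P (fun x => ex a x * (ex b x)^*) = (a == b)%:R.
Proof.
rewrite (_ : (fun x => _) = @ex R d (a - b)); first by rewrite Ec_ex subr_eq0.
by apply/funext => x; rewrite exD exN.
Qed.

Lemma Ec_trig0 S f : ~~ S 0 -> trig S f -> Ec P f = 0.
Proof.
move=> S0 [s sS fE]; rewrite (_ : f = fun x => \sum_(p <- s) p.1 * ex p.2 x); last exact/funext.
have l a : cL1 P (@ex R d a) by exact/cbdd_L1/cbdd_ex.
rewrite Ec_sum; last first.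
  by move=> p; apply: cbdd_L1; apply: cbddM; [exact: cbdd_cst|exact: cbdd_ex].
rewrite big1_seq // => p /andP[_ ps]; rewrite EcZ // Ec_ex.
have [p0|] := eqVneq p.2 0; last by rewrite mulr0.
by move/allP: sS => /(_ _ ps); rewrite p0 (negbTE S0).
Qed.

Lemma Ec_trig_ortho S S' f g : (forall a, S a -> ~~ S' a) ->
  trig S f -> trig S' g -> Ec P (fun x => f x * (g x)^*) = 0.
Proof.
move=> SS' tf tg; pose D (c : 'rV[int]_d) := c != 0.
apply: (@Ec_trig0 D); first by rewrite /D eqxx.
apply: (trigM (S' := fun b => S' (- b))) tf (trigJ _ tg) => [a b Sa Sb|a]; last by rewrite opprK.
by rewrite /D addr_eq0; apply: contraL Sb => /eqP <-; exact: SS'.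
Qed.

End TrigPoly.

(** * One-variable projections from L^oo to L^4 *)

Section Contractions.
Variables (R : realType) (d : nat).
Local Notation torus := (@torus R d).
Local Notation P := (@haar R d).
Implicit Types (S : 'rV[int]_d -> bool) (f g : torus -> R[i]).

Lemma sqr_cabsD (z w : R[i]) :
  cabs (z + w) ^+ 2 = cabs z ^+ 2 + cabs w ^+ 2 + 2 * complex.Re (z * w^*).
Proof. by rewrite !sqr_cabs ReD ImD ReM ReJ ImJ; ring. Qed.

Lemma rbdd_cabsX f n : cbdd f -> rbdd (fun x => cabs (f x) ^+ n).
Proof. by move=> /cbdd_cabs bf; exact: rbddX. Qed.

Lemma Er_pythagoras S S' f g : (forall a, S a -> ~~ S' a) -> trig S f -> trig S' g ->
  Er P (fun x => cabs (f x + g x) ^+ 2) =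
  Er P (fun x => cabs (f x) ^+ 2) + Er P (fun x => cabs (g x) ^+ 2).
Proof.
move=> SS' tf tg; under eq_fun do rewrite sqr_cabsD.
have bf := trig_cbdd tf; have bg := trig_cbdd tg.
have l1 := rbdd_L1 P (rbdd_cabsX 2 bf); have l2 := rbdd_L1 P (rbdd_cabsX 2 bg).
have l3 : rL1 P (fun x => complex.Re (f x * (g x)^*)).
  by apply: cL1_Re; apply: cbdd_L1; apply: cbddM => //; exact: cbddJ.
rewrite ErD; [|exact: rL1D|exact: rL1Z]; rewrite ErD // ErZ // -Re_Ec.
by rewrite (Ec_trig_ortho SS' tf tg) /= mulr0 addr0.
Qed.

Definition nneg (j : 'I_d) (a : 'rV[int]_d) := 0 <= a ord0 j.

Lemma projection_L2 (j : 'I_d) f g h :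
  trig (nneg j) g -> trig (fun a => ~~ nneg j a) h -> (forall x, f x = g x + h x) ->
  Er P (fun x => cabs (g x) ^+ 2) <= Er P (fun x => cabs (f x) ^+ 2).
Proof.
move=> tg th fE; have {fE}-> : f = (fun x => g x + h x) by exact/funext.
rewrite (Er_pythagoras _ tg th) => [|a ->] //.
by rewrite lerDl; apply: Er_ge0 => x; rewrite exprn_ge0 ?cabs_ge0.
Qed.

(* With |g|^2 = c + p + conj p, p having positive and c zero frequencies in the j-th variable,
   conj f * g = c + (p + conj h * g) + conj p is an orthogonal decomposition. *)
Lemma projection_Loo_L4 (j : 'I_d) M f g h :
  trig (nneg j) g -> trig (fun a => ~~ nneg j a) h -> (forall x, f x = g x + h x) ->
  (forall x, cabs (f x) <= M) ->
  Er P (fun x => cabs (g x) ^+ 4) <= M ^+ 4.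
Proof.
move=> tg th fE fM.
pose T (a : 'rV[int]_d) := true; pose Z (a : 'rV[int]_d) := a ord0 j == 0.
pose pos (a : 'rV[int]_d) := 0 < a ord0 j; pose neg (a : 'rV[int]_d) := a ord0 j < 0.
have tq : trig T (fun x => g x * (g x)^*).
  by apply: (trigM (S' := T)) tg (trigJ _ tg).
have [c [q1 [tc tq1 qE]]] := trig_split Z tq.
have [p [m [tp tm q1E]]] := trig_split pos tq1.
have {}tc : trig Z c by apply: trig_sub tc => a.
have {}tp : trig pos p by apply: trig_sub tp => a /andP[].
have {}tm : trig neg m.
  apply: trig_sub tm => a /andP[/andP[_]]; rewrite /Z /pos /neg => a0.
  by rewrite -leNgt le_eqVlt (negbTE a0).
(* [trig_split] does not record that [m] is the conjugate of [p]. Averaging restores this symmetry,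
   which is legitimate because [g * conj g] is real. *)
pose p' x := 2^-1 * (p x + (m x)^*).
pose c' x : R := complex.Re (c x).
have Jpos a : pos a -> neg (- a) by rewrite /pos /neg mxE oppr_lt0.
have Jneg a : neg a -> pos (- a) by rewrite /pos /neg mxE oppr_gt0.
have JZ a : Z a -> Z (- a) by rewrite /Z mxE oppr_eq0.
have tp' : trig pos p' by apply: trigZ; apply: trigD => //; exact: trigJ tm.
have tc' : trig Z (fun x => (c' x)%:C).
  apply: trig_ext (trigZ 2^-1 (trigD tc (trigJ JZ tc))) => x.
  by apply: complexP; rewrite !(ReD, ImD, ReM, ImM, ReJ, ImJ) /= /c'; field.
have qE' x : g x * (g x)^* = (c' x)%:C + p' x + (p' x)^*.
  have qr : g x * (g x)^* = 2^-1 * (g x * (g x)^* + (g x * (g x)^*)^*).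
    by apply: complexP; rewrite !(ReD, ImD, ReM, ImM, ReJ, ImJ) /=; field.
  rewrite qr qE q1E /p'; apply: complexP.
    by rewrite !(ReD, ImD, ReM, ImM, ReJ, ImJ) /c' /=; field.
  by rewrite !(ReD, ImD, ReM, ImM, ReJ, ImJ) /c' /=; field.
pose K x := p' x + (h x)^* * g x.
have tK : trig pos K.
  apply: trigD => //; apply: (trigM (S := pos)) (trigJ _ th) tg => [a b|a]; rewrite /pos /nneg !mxE.
    by move=> a0 b0; rewrite ltr_wpDr.
  by rewrite -ltNge oppr_gt0.
have tJp' : trig neg (fun x => (p' x)^*) by exact: trigJ tp'.
have Zpos a : Z a -> ~~ pos a by rewrite /Z /pos => /eqP ->; rewrite ltxx.
have Zneg a : (Z a || pos a) -> ~~ neg a.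
  by rewrite /Z /pos /neg -leNgt => /orP[/eqP ->//|/ltW].
have tZ (u v : torus -> R[i]) : trig Z u -> trig pos v -> trig (fun a => Z a || pos a) (fun x => u x + v x).
  move=> tu tv; apply: trigD; first by apply: trig_sub tu => a ->.
  by apply: trig_sub tv => a ->; rewrite orbT.
have bc : rbdd c' by exact/cbdd_Re/(trig_cbdd tc).
have bg := trig_cbdd tg.
have Ef : Er P (fun x => cabs (f x * g x) ^+ 2) =
   Er P (fun x => c' x ^+ 2) + Er P (fun x => cabs (K x) ^+ 2) + Er P (fun x => cabs (p' x) ^+ 2).
  transitivity (Er P (fun x => cabs (((c' x)%:C + K x) + (p' x)^*) ^+ 2)).
    congr Er; apply/funext => x; congr (_ ^+ 2).
    transitivity (cabs ((f x)^* * g x)); first by rewrite !cabsM cabsJ.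
    congr cabs; rewrite fE rmorphD mulrDl [_^* * _]mulrC qE' /K; ring.
  rewrite (Er_pythagoras Zneg (tZ _ _ tc' tK) tJp') (Er_pythagoras Zpos tc' tK).
  congr (_ + _ + _); congr Er; apply/funext => x; last by rewrite cabsJ.
  by rewrite cabs_real real_normK ?num_real.
have Eg : Er P (fun x => cabs (g x) ^+ 4) =
   Er P (fun x => c' x ^+ 2) + Er P (fun x => cabs (p' x) ^+ 2) + Er P (fun x => cabs (p' x) ^+ 2).
  transitivity (Er P (fun x => cabs (((c' x)%:C + p' x) + (p' x)^*) ^+ 2)).
    congr Er; apply/funext => x; rewrite -qE' cabsM cabsJ; ring.
  rewrite (Er_pythagoras Zneg (tZ _ _ tc' tp') tJp') (Er_pythagoras Zpos tc' tp').
  congr (_ + _ + _); congr Er; apply/funext => x; last by rewrite cabsJ.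
  by rewrite cabs_real real_normK ?num_real.
have Ec2 : Er P (fun x => cabs (g x) ^+ 2) = Er P c'.
  transitivity (complex.Re (Ec P (fun x => g x * (g x)^*))).
    by rewrite Re_Ec; congr Er; apply/funext => x; rewrite mulc_conj.
  rewrite (_ : (fun x => _) = fun x => (c' x)%:C + p' x + (p' x)^*); last exact/funext.
  rewrite EcD; [|exact: cL1D (trig_cL1 tc') (trig_cL1 tp')|exact: trig_cL1 tJp'].
  rewrite EcD; [|exact: trig_cL1 tc'|exact: trig_cL1 tp'].
  have -> : Ec P p' = 0 by apply: Ec_trig0 tp'; rewrite /pos mxE ltxx.
  have -> : Ec P (fun x => (p' x)^*) = 0 by apply: Ec_trig0 tJp'; rewrite /neg mxE ltxx.
  by rewrite !addr0 Ec_real.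
have lfg : Er P (fun x => cabs (f x * g x) ^+ 2) <= M ^+ 2 * Er P (fun x => cabs (g x) ^+ 2).
  have bf : cbdd f.
    rewrite (_ : f = fun x => g x + h x); last exact/funext.
    exact: cbddD bg (trig_cbdd th).
  rewrite -ErZ; last exact/rbdd_L1/rbdd_cabsX.
  apply: le_Er => [||x].
  - exact/rbdd_L1/rbdd_cabsX/cbddM.
  - exact/rL1Z/rbdd_L1/rbdd_cabsX.
  - rewrite cabsM exprMn ler_wpM2r ?exprn_ge0 ?cabs_ge0 //.
    by rewrite lerXn2r // nnegrE ?cabs_ge0 // (le_trans (cabs_ge0 _) (fM x)).
have K0 : 0 <= Er P (fun x => cabs (K x) ^+ 2).
  by apply: Er_ge0 => x; rewrite exprn_ge0 ?cabs_ge0.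
have sq : 0 <= Er P (fun x => (M ^+ 2 - c' x) ^+ 2).
  by apply: Er_ge0 => x; rewrite sqr_ge0.
have Esq : Er P (fun x => (M ^+ 2 - c' x) ^+ 2) =
    M ^+ 4 - 2 * M ^+ 2 * Er P c' + Er P (fun x => c' x ^+ 2).
  have lc := rbdd_L1 P bc; have lc2 := rbdd_L1 P (rbddX 2 bc).
  rewrite (_ : (fun x => _) = fun x => M ^+ 4 - 2 * M ^+ 2 * c' x + c' x ^+ 2); last first.
    by apply/funext => x; ring.
  rewrite ErD //; last by apply: rL1B; [exact: rL1_cst|exact: rL1Z].
  rewrite ErB; [|exact: rL1_cst|exact: rL1Z].
  by rewrite Er_cst ErZ.
rewrite Ec2 in lfg.
(* With norms in [L^2], [||g||_4^4 = 2 (||c'||^2 + ||p'||^2) - ||c'||^2]. Dropping [||K||^2] bounds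
   this by [2 M^2 E c' - E c'^2], which is at most [M^4] by [sq]. *)
move: Ef Eg lfg K0 sq; rewrite Esq; do ![move: (Er P _) => ?]; lra.
Qed.

End Contractions.

(** * Fejer means *)

Lemma conjM (R : realType) (z w : R[i]) : (z * w)^* = z^* * w^*.
Proof. exact: rmorphM. Qed.

Lemma Re_mulJN (R : realType) (z w : R[i]) :
  complex.Re (z * (- w)^*) = - complex.Re (z * w^*).
Proof. by case: w => c e; rewrite !(ReM, ReJ, ImJ) /=; ring. Qed.

Section Fejer.
Variables (R : realType) (d n : nat).
Local Notation torus := (@torus R d).
Local Notation P := (@haar R d).
Local Notation box := {ffun 'I_d -> 'I_n.+1}.
Implicit Types (f g : torus -> R[i]) (b c : box).

Definition freq (b : box) : 'rV[int]_d := \row_j (b j : nat)%:Z.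

Definition fcoef f a := Ec P (fun y => f y * (ex a y)^*).

(** The convolution of [f] with [fker], the squared modulus of a Dirichlet kernel over the number of
    box points. Written as a sum over pairs of box points it is a trigonometric polynomial by
    construction; [fejerE] recovers the positive kernel on which the norm bounds rest. *)
Definition fejer f (x : torus) : R[i] :=
  (#|box|%:R)^-1 * \sum_(p : box * box) fcoef f (freq p.1 - freq p.2) * ex (freq p.1 - freq p.2) x.

Definition fker (x y : torus) : R :=
  (#|box|%:R)^-1 * cabs (\sum_(b : box) ex (freq b) x * (ex (freq b) y)^*) ^+ 2.

Lemma fker_ge0 x y : 0 <= fker x y.
Proof. by rewrite mulr_ge0 ?invr_ge0 ?ler0n ?exprn_ge0 ?cabs_ge0. Qed.

Lemma freq_inj : injective freq.
Proof.
move=> b c /rowP bc; apply/ffunP => j; apply: val_inj.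
by have := bc j; rewrite !mxE => -[].
Qed.

Lemma cL1_exJ f a : cL1 P f -> cL1 P (fun y => f y * (ex a y)^*).
Proof. by move=> lf; apply: cL1M => //; apply: cbddJ; exact: cbdd_ex. Qed.

Lemma fkerE x y : (fker x y)%:C =
  (#|box|%:R)^-1 * \sum_(p : box * box) ex (freq p.1 - freq p.2) x * (ex (freq p.1 - freq p.2) y)^*.
Proof.
rewrite /fker (rmorphM (real_complex R)) /= -mulc_conj fmorphV rmorph_nat; congr (_ * _).
rewrite rmorph_sum mulr_suml -(pair_bigA _ (fun b c => ex (freq b - freq c) x * (ex (freq b - freq c) y)^*)) /=.
apply: eq_bigr => b _; rewrite mulr_sumr; apply: eq_bigr => c _.
by rewrite !exD !exN !conjM !conjcK; ring.
Qed.

Lemma cbdd_fker x : cbdd (fun y => (fker x y)%:C).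
Proof.
rewrite (_ : (fun y => _) = (fun y => (#|box|%:R)^-1 * \sum_(p : box * box) ex (freq p.1 - freq p.2) x * (ex (freq p.1 - freq p.2) y)^*)); last first.
  by apply/funext => y; rewrite fkerE.
apply: cbddM; first exact: cbdd_cst.
apply: cbdd_sum => p; apply: cbddM; first exact: cbdd_cst.
by apply: cbddJ; exact: cbdd_ex.
Qed.

Lemma rbdd_fker x : rbdd (fker x).
Proof. exact: (cbdd_Re (cbdd_fker x)). Qed.

Lemma fejerE f x : cL1 P f -> fejer f x = Ec P (fun y => f y * (fker x y)%:C).
Proof.
move=> lf; rewrite /fejer; under [in RHS]eq_fun do rewrite fkerE mulrCA mulr_sumr.
have lp (p : box * box) : cL1 P (fun y => f y * (ex (freq p.1 - freq p.2) x * (ex (freq p.1 - freq p.2) y)^*)).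
  apply: cL1M => //; apply: cbddM; first exact: cbdd_cst.
  by apply: cbddJ; exact: cbdd_ex.
rewrite EcZ; last first.
  elim: (index_enum _) => [|p r IHr].
    by under eq_fun do rewrite big_nil; exact/cbdd_L1/cbdd_cst.
  by under eq_fun do rewrite big_cons; exact: cL1D.
rewrite Ec_sum //; congr (_ * _); apply: eq_bigr => p _.
rewrite /fcoef mulrC -EcZ; last exact: cL1_exJ.
by congr Ec; apply/funext => y; rewrite mulrCA.
Qed.

Lemma fcoef_cst (c : R[i]) a : fcoef (fun=> c) a = c * (a == 0)%:R.
Proof.
rewrite /fcoef EcZ; last by apply: cbdd_L1; apply: cbddJ; exact: cbdd_ex.
rewrite (_ : (fun y => _) = @ex R d (- a)); last by apply/funext => y; rewrite exN.
by rewrite Ec_ex oppr_eq0.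
Qed.

Lemma freq_sub_eq0 (p : box * box) : (freq p.1 - freq p.2 == 0) = (p.1 == p.2).
Proof. by rewrite subr_eq0 (inj_eq freq_inj). Qed.

Lemma sum_diag (F : box -> R[i]) :
  \sum_(p : box * box) (p.1 == p.2)%:R * F p.1 = \sum_b F b.
Proof.
rewrite -(pair_bigA _ (fun b c => (b == c)%:R * F b)) /=; apply: eq_bigr => b _.
by rewrite (bigD1 b) //= eqxx mul1r big1 ?addr0 // => c; rewrite eq_sym => /negbTE ->; rewrite mul0r.
Qed.

Lemma sum_box_cst (c : R[i]) : \sum_(b : box) c = #|box|%:R * c.
Proof. by rewrite -sum1_card natr_sum mulr_suml; apply: eq_bigr => b _; rewrite mul1r. Qed.

Lemma box_neq0 : (#|box|%:R : R[i]) != 0.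
Proof. by rewrite pnatr_eq0 card_ffun card_ord expn_eq0. Qed.

Lemma fejer_cst (c : R[i]) x : fejer (fun=> c) x = c.
Proof.
rewrite /fejer (eq_bigr (fun p : box * box => (p.1 == p.2)%:R * c)); last first.
  move=> p _; rewrite fcoef_cst freq_sub_eq0.
  have [->|_] := eqVneq p.1 p.2; last by rewrite mulr0 !mul0r.
  by rewrite subrr ex0 mulr1 mulrC.
by rewrite sum_diag sum_box_cst mulKf // box_neq0.
Qed.

Lemma Er_fker x : Er P (fker x) = 1.
Proof.
have /(congr1 (@complex.Re R)) := fejerE x (cbdd_L1 P (cbdd_cst (1 : R[i]))).
rewrite fejer_cst => h; transitivity (complex.Re (1 : R[i])) => //; rewrite h.
by rewrite Re_Ec; congr Er; apply/funext => y; rewrite mul1r.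
Qed.

Lemma fejer_trig S f : (forall a, ~~ S a -> fcoef f a = 0) -> trig S (fejer f).
Proof.
move=> f0; apply: trigZ; apply: trig_sum => p.
have [Sa|nSa] := boolP (S (freq p.1 - freq p.2)); first exact: trig_ex.
by apply: trig_ext (trig0 R S) => x; rewrite f0 // mul0r.
Qed.

Lemma fejer_trigT f : trig xpredT (fejer f).
Proof. exact: fejer_trig. Qed.

Lemma Ec_fejer f : Ec P (fejer f) = Ec P f.
Proof.
have l a : cL1 P (@ex R d a) by exact/cbdd_L1/cbdd_ex.
have bs (p : box * box) : cbdd (fun x : torus => fcoef f (freq p.1 - freq p.2) * ex (freq p.1 - freq p.2) x).
  by apply: cbddM; [exact: cbdd_cst|exact: cbdd_ex].
rewrite EcZ; last exact/cbdd_L1/cbdd_sum.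
rewrite Ec_sum; last by move=> p; exact/cbdd_L1.
rewrite (eq_bigr (fun p : box * box => (p.1 == p.2)%:R * Ec P f)); last first.
  move=> p _; rewrite EcZ // Ec_ex freq_sub_eq0.
  have [->|_] := eqVneq p.1 p.2; last by rewrite mulr0 !mul0r.
  rewrite subrr mulrC; congr (_ * _); rewrite /fcoef; congr Ec.
  by apply/funext => y; rewrite ex0 rmorph1 mulr1.
by rewrite (sum_diag (fun=> Ec P f)) sum_box_cst mulKf // box_neq0.
Qed.

Lemma cL1_fker f x : cL1 P f -> cL1 P (fun y => f y * (fker x y)%:C).
Proof. by move=> lf; apply: cL1M => //; exact: cbdd_fker. Qed.

Lemma cabs_fejer f x : cL1 P f ->
  cabs (fejer f x) <= complex.Re (fejer (fun y => (cabs (f y))%:C) x).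
Proof.
move=> lf; have lc : cL1 P (fun y => (cabs (f y))%:C).
  case: lf => mf lf; split; first exact/cmeas_real/cmeas_cabs.
  by under eq_fun do rewrite cabs_real ger0_norm ?cabs_ge0 //.
rewrite !fejerE // (le_trans (cabs_Ec (cL1_fker x lf))) // Re_Ec.
apply: le_Er; [by case: (cL1_fker x lf)|exact: cL1_Re (cL1_fker x lc)|].
by move=> y; rewrite cabsM cabs_real ger0_norm ?fker_ge0 //= mulr0 subr0.
Qed.

Lemma fejer_sup f M x : cbdd f -> (forall y, cabs (f y) <= M) -> cabs (fejer f x) <= M.
Proof.
move=> bf fM; have lf := cbdd_L1 P bf.
rewrite fejerE // (le_trans (cabs_Ec (cL1_fker x lf))) //.
rewrite -[leRHS]mulr1 -(Er_fker x) -ErZ; last exact/rbdd_L1/rbdd_fker.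
apply: le_Er; [by case: (cL1_fker x lf)|exact/rL1Z/rbdd_L1/rbdd_fker|].
by move=> y; rewrite cabsM cabs_real ger0_norm ?fker_ge0 // ler_wpM2r ?fker_ge0.
Qed.

(** Positivity of the kernel bounds [|fejer f|] by the Fejer mean of [|f|], and Fejer means preserve
    integrals. *)
Lemma fejer_L1 f : cL1 P f -> Er P (fun x => cabs (fejer f x)) <= Er P (fun x => cabs (f x)).
Proof.
move=> lf; pose g y := (cabs (f y))%:C.
have -> : Er P (fun x => cabs (f x)) = Er P (fun x => complex.Re (fejer g x)).
  by rewrite -Re_Ec Ec_fejer Ec_real.
apply: le_Er => [||x]; last exact: cabs_fejer.
  exact/rbdd_L1/cbdd_cabs/(trig_cbdd (fejer_trigT f)).
exact/rbdd_L1/cbdd_Re/(trig_cbdd (fejer_trigT g)).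
Qed.

(* Jensen's inequality: the variance of f with respect to fker x is nonnegative. *)
Lemma sqr_cabs_fejer f x : cbdd f ->
  cabs (fejer f x) ^+ 2 <= complex.Re (fejer (fun y => (cabs (f y) ^+ 2)%:C) x).
Proof.
move=> bf; have lf := cbdd_L1 P bf; set c := fejer f x.
have b2 : rbdd (fun y => cabs (f y) ^+ 2) by exact: rbdd_cabsX.
have bJ : cbdd (fun y => f y * c^*) by apply: cbddM => //; exact: cbdd_cst.
have bk := rbdd_fker x.
have : 0 <= Er P (fun y => cabs (f y - c) ^+ 2 * fker x y).
  by apply: Er_ge0 => y; rewrite mulr_ge0 ?fker_ge0 ?exprn_ge0 ?cabs_ge0.
rewrite (_ : (fun y => _) = fun y => (cabs (f y) ^+ 2 * fker x y + cabs c ^+ 2 * fker x y)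
    - 2 * (complex.Re (f y * c^*) * fker x y)); last first.
  by apply/funext => y; rewrite sqr_cabsD cabsN Re_mulJN; ring.
have l1 : rL1 P (fun y => cabs (f y) ^+ 2 * fker x y) by apply: rbdd_L1; exact: rbddM.
have l2 : rL1 P (fun y => complex.Re (f y * c^*) * fker x y).
  by apply: rbdd_L1; apply: rbddM => //; exact: cbdd_Re.
have l3 := rbdd_L1 P bk.
rewrite ErB; [|by apply: rL1D => //; exact: rL1Z|exact: rL1Z].
rewrite ErD //; last exact: rL1Z.
have E1 : Er P (fun y => fker x y) = 1 := Er_fker x.
rewrite (ErZ _ l3) (ErZ _ l2) E1 mulr1.
have -> : Er P (fun y => complex.Re (f y * c^*) * fker x y) = cabs c ^+ 2.
  transitivity (complex.Re (c * c^*)); last by rewrite mulc_conj.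
  have cE : c = Ec P (fun y => f y * (fker x y)%:C) by rewrite /c fejerE.
  rewrite [in RHS]mulrC [X in _ * X]cE -EcZ; last exact: cL1_fker.
  rewrite Re_Ec; congr Er; apply/funext => y.
  by rewrite !(ReM, ReJ, ImJ, ImM) /=; ring.
have -> : complex.Re (fejer (fun y => (cabs (f y) ^+ 2)%:C) x) =
          Er P (fun y => cabs (f y) ^+ 2 * fker x y).
  rewrite fejerE; last exact/cbdd_L1/cbdd_real.
  by rewrite Re_Ec; congr Er; apply/funext => y; rewrite ReM /= mulr0 subr0.
lra.
Qed.

Lemma fejer_L2 f : cbdd f ->
  Er P (fun x => cabs (fejer f x) ^+ 2) <= Er P (fun x => cabs (f x) ^+ 2).
Proof.
move=> bf; pose g y := (cabs (f y) ^+ 2)%:C.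
have -> : Er P (fun x => cabs (f x) ^+ 2) = Er P (fun x => complex.Re (fejer g x)).
  by rewrite -Re_Ec Ec_fejer Ec_real.
apply: le_Er => [||x]; last exact: sqr_cabs_fejer.
  exact/rbdd_L1/rbdd_cabsX/(trig_cbdd (fejer_trigT f)).
exact/rbdd_L1/cbdd_Re/(trig_cbdd (fejer_trigT g)).
Qed.

Lemma fcoefD f g a : cL1 P f -> cL1 P g -> fcoef (fun x => f x + g x) a = fcoef f a + fcoef g a.
Proof.
move=> lf lg; rewrite /fcoef -EcD; [|exact: cL1_exJ|exact: cL1_exJ].
by congr Ec; apply/funext => x; rewrite mulrDl.
Qed.

Lemma fcoefZ (c : R[i]) f a : cL1 P f -> fcoef (fun x => c * f x) a = c * fcoef f a.
Proof.
move=> lf; rewrite /fcoef -EcZ; last exact: cL1_exJ.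
by congr Ec; apply/funext => x; rewrite mulrA.
Qed.

Lemma fejerD f g x : cL1 P f -> cL1 P g ->
  fejer (fun x => f x + g x) x = fejer f x + fejer g x.
Proof.
move=> lf lg; rewrite /fejer -mulrDr -big_split /=; congr (_ * _); apply: eq_bigr => p _.
by rewrite fcoefD // mulrDl.
Qed.

Lemma fejerZ (c : R[i]) f x : cL1 P f -> fejer (fun x => c * f x) x = c * fejer f x.
Proof.
move=> lf; rewrite /fejer mulrCA; congr (_ * _); rewrite mulr_sumr; apply: eq_bigr => p _.
by rewrite fcoefZ // mulrA.
Qed.

Lemma fejerB f g x : cL1 P f -> cL1 P g ->
  fejer (fun x => f x - g x) x = fejer f x - fejer g x.
Proof.
move=> lf lg; rewrite fejerD //; last exact: cL1N.
congr (_ + _); rewrite -[RHS]mulN1r -(fejerZ _ x lg); congr fejer; apply/funext => y.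
by rewrite mulN1r.
Qed.

End Fejer.

(** * Uniform convergence of Fejer means of trigonometric polynomials *)

Lemma sum_ord_lt (m t : nat) : (\sum_(k < m) (k < t) = minn m t)%N.
Proof. by elim: m => [|m IHm]; rewrite ?big_ord0 ?min0n // big_ord_recr /= IHm; lia. Qed.

(** The Weierstrass product inequality, carried together with the bounds on the product that its
    induction uses. *)
Lemma prod_1subr_ge (R : realType) I (r : seq I) (t : I -> R) :
  (forall i, 0 <= t i <= 1) -> 1 - \sum_(i <- r) t i <= \prod_(i <- r) (1 - t i).
Proof.
move=> t01.
suff : 0 <= \prod_(i <- r) (1 - t i) <= 1 /\
       1 - \sum_(i <- r) t i <= \prod_(i <- r) (1 - t i) by case.
elim: r => [|i r [/andP[p0 p1] IHr]]; first by rewrite !big_nil subr0 ler01 lexx.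
rewrite !big_cons; have /andP[t0 t1] := t01 i; split; last by nra.
by rewrite mulr_ge0 ?subr_ge0 //= mulr_ile1 ?subr_ge0 // gerBl.
Qed.

Section FejerConvergence.
Variables (R : realType) (d : nat).
Local Notation torus := (@torus R d).
Local Notation P := (@haar R d).
Implicit Types (f g : torus -> R[i]).

(** The Fejer multiplier at the frequency [a]: the number of pairs of box points with difference
    [a], over the number of box points. It is the product of the [1 - |a_j| / (n + 1)] as soon as
    all [|a_j| <= n + 1]. *)
Definition kap n (a : 'rV[int]_d) : R :=
  (#|{ffun 'I_d -> 'I_n.+1}|%:R)^-1 *
  \sum_(p : {ffun 'I_d -> 'I_n.+1} * {ffun 'I_d -> 'I_n.+1}) (a == freq p.1 - freq p.2)%:R.

Lemma fejer_ex n a x : fejer n (@ex R d a) x = (kap n a)%:C * ex a x.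
Proof.
rewrite /fejer /kap (rmorphM (real_complex R)) /= fmorphV rmorph_nat -mulrA; congr (_ * _).
rewrite rmorph_sum mulr_suml; apply: eq_bigr => p _ /=.
rewrite /fcoef Ec_ex_exJ rmorph_nat.
by have [->|_] := eqVneq a (freq p.1 - freq p.2); rewrite ?mul0r.
Qed.

Lemma sum_shift n (z : int) : (`|z| <= n.+1)%N ->
  (\sum_(k < n.+1) \sum_(l < n.+1) (k%:Z == z + l%:Z)%R)%N = (n.+1 - `|z|)%N.
Proof.
have h (A : nat) : (A <= n.+1)%N ->
    (\sum_(k < n.+1) \sum_(l < n.+1) (l%:Z == A%:Z + k%:Z)%R)%N = (n.+1 - A)%N.
  move=> An; rewrite -[RHS](minn_idPr (leq_subr A n.+1)) -sum_ord_lt; apply: eq_bigr => k _.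
  have [Akn|Akn] := ltnP (A + k) n.+1.
    rewrite (bigD1 (Ordinal Akn)) //= PoszD eqxx big1.
      by rewrite ltn_subRL Akn.
    move=> l /eqP lk; apply/eqP; rewrite eqb0; apply/eqP => e; apply: lk.
    by apply: val_inj => /=; move: e; rewrite -PoszD => -[].
  rewrite big1 => [|l _]; first by rewrite ltn_subRL ltnNge Akn.
  by apply/eqP; rewrite eqb0; apply/eqP => e; move: (ltn_ord l); lia.
case: z => A An; last first.
  rewrite NegzE -[RHS](h A.+1) //; apply: eq_bigr => k _; apply: eq_bigr => l _.
  by congr nat_of_bool; apply/eqP/eqP; lia.
by rewrite exchange_big /= h.
Qed.

Lemma kapE n (a : 'rV[int]_d) : kap n a =
  \prod_(j < d) ((\sum_(k < n.+1) \sum_(l < n.+1) (k%:Z == a ord0 j + l%:Z)%R)%N%:R / n.+1%:R).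
Proof.
rewrite /kap prodf_div prodr_const card_ffun !card_ord natrX mulrC; congr (_ / _).
rewrite -natr_prod (bigA_distr_bigA (fun (j : 'I_d) (k : 'I_n.+1) => \sum_(l < n.+1) (k%:Z == a ord0 j + l%:Z)%R))%N /=.
rewrite -(pair_bigA _ (fun b c => (a == freq b - freq c)%:R)) /= natr_sum.
apply: eq_bigr => b _; rewrite (bigA_distr_bigA (fun (j : 'I_d) (l : 'I_n.+1) => ((b j)%:Z == a ord0 j + l%:Z)%R : nat))%N /= natr_sum.
apply: eq_bigr => c _; congr (_%:R).
have -> : (a == freq b - freq c) = [forall j, (b j)%:Z == a ord0 j + (c j)%:Z].
  rewrite -subr_eq0 opprB addrA subr_eq0 eq_sym.
  apply/eqP/forallP => [/rowP e j|e]; first by have := e j; rewrite !mxE => ->.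
  by apply/rowP => j; rewrite !mxE; apply/eqP; exact: e.
case: forallP => [e|ne]; first by rewrite big1 // => j _; rewrite e.
have [j nj] : exists j, ~~ ((b j)%:Z == a ord0 j + (c j)%:Z).
  by apply/existsP; rewrite -negb_forall; apply/negP => /forallP.
by rewrite (bigD1 j) //= (negbTE nj) mul0n.
Qed.

Lemma kap_bounds n (a : 'rV[int]_d) : (forall j, (`|a ord0 j| <= n.+1)%N) ->
  1 - (\sum_(j < d) `|a ord0 j|)%N%:R / n.+1%:R <= kap n a <= 1.
Proof.
move=> an; rewrite kapE; pose t j : R := `|a ord0 j|%N%:R / n.+1%:R.
have n0 : 0 < n.+1%:R :> R by rewrite ltr0n.
have tE j : (\sum_(k < n.+1) \sum_(l < n.+1) (k%:Z == a ord0 j + l%:Z)%R)%N%:R / n.+1%:R = 1 - t j.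
  by rewrite sum_shift // natrB // mulrBl divff // gt_eqF.
have t01 j : 0 <= t j <= 1.
  by rewrite divr_ge0 ?ler0n //= ler_pdivrMr // mul1r ler_nat.
rewrite (eq_bigr (fun j => 1 - t j)); last by move=> j _; exact: tE.
apply/andP; split; last first.
  by apply: prodr_ile1 => j _; have := t01 j; lra.
by rewrite natr_sum mulr_suml; exact: prod_1subr_ge.
Qed.

Lemma fejer_cvg_trig S f : trig S f ->
  forall e, 0 < e -> exists n, forall x, cabs (fejer n f x - f x) <= e.
Proof.
move=> tf.
(* The error bound is strengthened to all large [n], so that the ranks obtained for one term and for
   the remaining ones can be combined. *)
suff h : trig xpredT f /\ forall e, 0 < e ->
    exists m, forall n, (m <= n)%N -> forall x, cabs (fejer n f x - f x) <= e.
  by move=> e /(proj2 h) [m hm]; exists m; exact: hm.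
elim/trig_elim: f / tf => [f g /funext <- //||c a f _ [tf IHf]].
  split=> [|e e0]; first exact: trig0.
  by exists 0%N => n _ x; rewrite fejer_cst subrr cabs0 ltW.
split=> [|e e0]; first exact: trigD (trig_ex _ _) tf.
have lf := trig_cL1 tf.
have [m hm] := IHf (e / 2) (divr_gt0 e0 (ltr0n _ 2)).
pose A := (\sum_(j < d) `|a ord0 j|)%N.
pose B := (cabs c * A%:R / (e / 2)).
have B0 : 0 <= B by rewrite !mulr_ge0 ?cabs_ge0 // invr_ge0 divr_ge0 // ltW.
exists (maxn m (maxn A (Num.bound B))) => n; rewrite !geq_max => /andP[mn /andP[An Bn]] x.
have le : cL1 P (fun x => c * ex a x).
  by apply: cbdd_L1; apply: cbddM; [exact: cbdd_cst|exact: cbdd_ex].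
rewrite fejerD // fejerZ; last exact/cbdd_L1/cbdd_ex.
rewrite fejer_ex.
have -> : c * ((kap n a)%:C * ex a x) + fejer n f x - (c * ex a x + f x) =
    c * ex a x * (kap n a - 1)%:C + (fejer n f x - f x).
  by rewrite (rmorphB (real_complex R)) /= rmorph1; ring.
rewrite (le_trans (cabsD _ _)) // [leRHS](splitr e) lerD ?hm //.
rewrite !cabsM cabs_ex mulr1 cabs_real.
have /andP[k1 k2] : 1 - A%:R / n.+1%:R <= kap n a <= 1.
  apply: kap_bounds => j; apply: leq_trans (leqW An).
  by rewrite /A (bigD1 j) //= leq_addr.
have n0 : 0 < n.+1%:R :> R by rewrite ltr0n.
apply: (@le_trans _ _ (cabs c * (A%:R / n.+1%:R))).
  by rewrite ler_wpM2l ?cabs_ge0 // ler0_norm ?subr_le0 // opprB lerBlDr addrC -lerBlDr.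
have Bn1 : B <= n.+1%:R.
  by rewrite (le_trans (ltW (archi_boundP B0))) // ler_nat (leq_trans Bn).
move: Bn1; rewrite /B ler_pdivrMr ?divr_gt0 // => Bn1.
by rewrite mulrA ler_pdivrMr // [leRHS]mulrC.
Qed.

End FejerConvergence.

(** * Interpolation *)

Section ThreeCircles.
Variable R : realType.

Lemma bernoulli_ineq (x : R) n : -1 <= x -> 1 + n%:R * x <= (1 + x) ^+ n.
Proof.
move=> x1; elim: n => [|n IHn]; first by rewrite mul0r addr0.
rewrite exprS; have n0 : 0 <= n%:R :> R by rewrite ler0n.
rewrite -[n.+1%:R]natr1.
have h : (1 + x) * (1 + n%:R * x) <= (1 + x) * (1 + x) ^+ n by rewrite ler_wpM2l //; lra.
have x2 : 0 <= n%:R * x ^+ 2 by rewrite mulr_ge0 // sqr_ge0.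
lra.
Qed.

(** If [y = 1 + e] with [e > 0], Bernoulli gives [y^(2 m) >= (m e)^2], which outgrows every bound
    linear in [m]. *)
Lemma le1_of_exp_linear (y s : R) : 0 <= y -> 0 <= s ->
  (forall n, y ^+ n <= n%:R * s + 1) -> y <= 1.
Proof.
move=> y0 s0 h; rewrite leNgt; apply/negP => y1; pose e := y - 1.
have e0 : 0 < e by rewrite subr_gt0.
have hm (m : nat) : (0 < m)%N -> m%:R * e ^+ 2 <= 2 * s + 1.
  move=> m0; have m1 : 1 <= m%:R :> R by rewrite ler1n.
  have b := bernoulli_ineq m (x := e); have {}b : 1 + m%:R * e <= y ^+ m.
    by rewrite (le_trans (b _)) ?/e ?subrKC //; lra.
  have me : 0 <= m%:R * e by rewrite mulr_ge0 // ltW.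
  have h2 := h (m * 2)%N; rewrite exprM natrM in h2.
  have h3 : (m%:R * e) ^+ 2 <= m%:R * 2 * s + 1 by rewrite (le_trans _ h2) // lerXn2r ?nnegrE ?exprn_ge0 // (le_trans _ b) // lerDr ler01.
  rewrite -(@ler_pM2l _ m%:R) ?ltr0n //; apply: (@le_trans _ _ (m%:R * 2 * s + 1)); last by lra.
  by apply: le_trans h3; rewrite exprMn; lra.
have e2 : 0 < e ^+ 2 by rewrite exprn_gt0.
have B0 : 0 <= (2 * s + 1) / e ^+ 2 by rewrite divr_ge0 //; lra.
have := hm (Num.bound ((2 * s + 1) / e ^+ 2)).+1 isT.
apply/negP; rewrite -ltNge -ltr_pdivrMr //.
by rewrite (lt_le_trans (archi_boundP B0)) // ler_nat leqnSn.
Qed.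

Lemma exX d (a : 'rV[int]_d) n x : ex a x ^+ n = @ex R d (a *+ n) x.
Proof. by elim: n => [|n IHn]; rewrite ?expr0 ?mulr0n ?ex0 // exprS mulrS exD IHn. Qed.

(** The [k]-th coefficient times [a^k] is a Fourier coefficient of [Q] on the circle of radius [a],
    parametrized by the one-dimensional torus, so the orthogonality of characters applies. *)
Lemma cauchy_estimate (Q : {poly R[i]}) (a A : R) k : 0 <= a ->
  (forall z, cabs z = a -> cabs Q.[z] <= A) -> cabs Q`_k * a ^+ k <= A.
Proof.
move=> a0 QA; pose e1 : 'rV[int]_1 := const_mx 1.
pose f (x : torus R 1) : R[i] := Q.[a%:C * ex e1 x].
have fA x : cabs (f x) <= A by apply: QA; rewrite cabsM cabs_ex mulr1 cabs_real ger0_norm.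
have A0 : 0 <= A.
  by rewrite (le_trans (cabs_ge0 (f (0 : 'rV_1)))).
have [kQ|kQ] := leqP (size Q) k; first by rewrite nth_default // cabs0 mul0r.
have bt (i : 'I_(size Q)) : cbdd (fun x : torus R 1 => Q`_i * a%:C ^+ i * ex (e1 *+ i) x).
  by apply: cbddM; [exact: cbdd_cst|exact: cbdd_ex].
have fE : f = fun x => \sum_(i < size Q) Q`_i * a%:C ^+ i * ex (e1 *+ i) x.
  apply/funext => x; rewrite /f horner_coef; apply: eq_bigr => i _.
  by rewrite exprMn exX mulrA.
have bf : cbdd f by rewrite fE; exact: cbdd_sum.
have e1_inj (i j : nat) : (e1 *+ i == e1 *+ j) = (i == j).
  apply/eqP/eqP => [/rowP/(_ ord0)|->] //; rewrite !mulmxnE !mxE.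
  by rewrite !natz => -[].
have cE : fcoef f (e1 *+ k) = Q`_k * a%:C ^+ k.
  rewrite /fcoef fE.
  under eq_fun do rewrite mulr_suml.
  rewrite Ec_sum; last first.
    by move=> i; apply: cbdd_L1; apply: cbddM => //; apply: cbddJ; exact: cbdd_ex.
  rewrite (eq_bigr (fun i : 'I_(size Q) => Q`_i * a%:C ^+ i * (i == k :> nat)%:R)); last first.
    move=> i _; rewrite (_ : (fun x => _) =
      fun x => (Q`_i * a%:C ^+ i) * (ex (e1 *+ i) x * (ex (e1 *+ k) x)^*)); last first.
      by apply/funext => x; rewrite mulrA.
    rewrite EcZ ?Ec_ex_exJ ?e1_inj //.
    by apply: cbdd_L1; apply: cbddM; [exact: cbdd_ex|apply: cbddJ; exact: cbdd_ex].
  rewrite (bigD1 (Ordinal kQ)) //= eqxx mulr1 big1 ?addr0 // => i ik.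
  by rewrite (_ : _ == _ = false) ?mulr0 //; apply: contraNF ik => /eqP ik; exact/eqP/val_inj.
have -> : cabs Q`_k * a ^+ k = cabs (fcoef f (e1 *+ k)).
  by rewrite cE cabsM cabsX cabs_real ger0_norm.
have lf := cL1_exJ (e1 *+ k) (cbdd_L1 (haar R 1) bf).
rewrite (le_trans (cabs_Ec lf)) // -(Er_cst (haar R 1) A).
apply: le_Er; [by case: lf|exact: rL1_cst|move=> x].
by rewrite cabsM cabsJ cabs_ex mulr1.
Qed.

Lemma powR_exprn (x p : R) n : 0 <= x -> (x `^ p) ^+ n = (x ^+ n) `^ p.
Proof. by move=> x0; rewrite -(powR_mulrn n (powR_ge0 x p)) -(powR_mulrn n x0) -!powRrM (mulrC p). Qed.

(* Hadamard's three circles theorem, up to the number of coefficients; applying this to the powers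
   of Q removes that factor. *)
Lemma three_circles (Q : {poly R[i]}) (rho th : R) (N : nat) : 1 < rho -> 0 <= th <= 1 ->
  (forall z, cabs z = 1 -> cabs Q.[z] <= 1) ->
  (forall z, cabs z = rho -> cabs Q.[z] <= rho ^+ N) ->
  cabs Q.[(rho `^ th)%:C] <= rho `^ (th * N%:R).
Proof.
move=> rho1 /andP[th0 th1] Q1 Q2; have rho0 : 0 < rho by exact: lt_trans rho1.
set y := cabs _; pose B := rho `^ (th * N%:R); have B0 : 0 < B by rewrite powR_gt0.
rewrite -(@ler_pM2r _ B^-1) ?invr_gt0 // divff ?gt_eqF //.
apply: (@le1_of_exp_linear _ (size Q)%:R); rewrite ?ler0n ?divr_ge0 ?cabs_ge0 ?ltW // => n.
rewrite exprMn exprVn ler_pdivrMr ?exprn_gt0 //.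
(* Cauchy's estimates on the two circles, [|c| <= 1] and [|c| rho^k <= rho^(N n)], are combined in a
   geometric mean with weights [1 - th] and [th]. *)
have hk k : cabs (Q ^+ n)`_k * (rho `^ th) ^+ k <= B ^+ n.
  have [c0|c0] := eqVneq (cabs (Q ^+ n)`_k) 0.
    by rewrite c0 mul0r exprn_ge0 // ltW.
  have {}c0 : 0 < cabs (Q ^+ n)`_k by rewrite lt0r c0 cabs_ge0.
  have h1 : cabs (Q ^+ n)`_k <= 1.
    have := @cauchy_estimate (Q ^+ n) 1 1 k ler01; rewrite expr1n mulr1; apply => z z1.
    by rewrite horner_exp cabsX exprn_ile1 ?cabs_ge0 ?Q1.
  have h2 : cabs (Q ^+ n)`_k * rho ^+ k <= rho ^+ (N * n).
    apply: cauchy_estimate; first exact: ltW.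
    move=> z z1; rewrite horner_exp cabsX exprM lerXn2r ?nnegrE ?cabs_ge0 ?Q2 //.
    by rewrite exprn_ge0 // ltW.
  have -> : cabs (Q ^+ n)`_k * (rho `^ th) ^+ k =
      cabs (Q ^+ n)`_k `^ (1 - th) * (cabs (Q ^+ n)`_k * rho ^+ k) `^ th.
    rewrite powRM ?exprn_ge0 ?(ltW c0) ?(ltW rho0) // mulrA -powRD; last by apply/implyP => _; rewrite gt_eqF.
    rewrite subrK powRr1 ?(ltW c0) //; congr (_ * _); exact: powR_exprn (ltW rho0).
  have -> : B ^+ n = 1 * (rho ^+ (N * n)) `^ th.
    rewrite mul1r exprM -powR_exprn ?exprn_ge0 ?(ltW rho0) //; congr (_ ^+ n).
    by rewrite /B mulrC powRrM powR_mulrn ?(ltW rho0).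
  rewrite ler_pM ?powR_ge0 //; last by rewrite ge0_ler_powR ?nnegrE ?mulr_ge0 ?exprn_ge0 // ?ltW.
  have p1 : 1 `^ (1 - th) = 1 :> R by rewrite powR1.
  by rewrite -[leRHS]p1 ge0_ler_powR ?nnegrE ?subr_ge0 // ltW.
have -> : y ^+ n = cabs (Q ^+ n).[(rho `^ th)%:C] by rewrite horner_exp cabsX.
rewrite horner_coef (le_trans (cabs_sum _ _ _)) //.
apply: (@le_trans _ _ (\sum_(i < size (Q ^+ n)%R) B ^+ n)).
  apply: ler_sum => i _; rewrite cabsM cabsX cabs_real ger0_norm ?powR_ge0 //; exact: hk.
rewrite sumr_const card_ord -[leLHS]mulr_natl ler_wpM2r ?exprn_ge0 ?(ltW B0) //.
(* [Q^n] has at most [n * size Q + 1] coefficients: the count is linear in [n], as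
   [le1_of_exp_linear] requires. *)
by rewrite -natrM natr1 ler_nat (leq_trans (size_exp_leq _ _)) // ltnS mulnC leq_mul2l leq_pred orbT.
Qed.

End ThreeCircles.

(** * Powers and levels of a sequence *)

Section Powers.
Variable R : realType.

Lemma powRVl (A p : R) : 0 <= A -> A^-1 `^ p = (A `^ p)^-1.
Proof. by move=> A0; rewrite -powR_inv1 // -powRrM mulN1r powRN. Qed.

Lemma ex_expr_gt (q B : R) : 1 < q -> exists n, B < q ^+ n.
Proof.
move=> q1; have q0 : 0 < q - 1 by rewrite subr_gt0.
have B0 : 0 <= `|B| / (q - 1) by rewrite divr_ge0 // ltW.
exists (Num.bound (`|B| / (q - 1))); apply: le_lt_trans (ler_norm B) _.
have := archi_boundP B0; rewrite ltr_pdivrMr // => h.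
have := @bernoulli_ineq R (q - 1) (Num.bound (`|B| / (q - 1))).
rewrite subrKC => b; apply: lt_le_trans (b _); first by lra.
by lra.
Qed.

Lemma ex_level (a : nat -> R) (y : R) D : a 0%N <= y -> y < a D ->
  exists2 i, (i < D)%N & a i <= y < a i.+1.
Proof.
elim: D => [|D IHD] a0 aD; first by move: (le_lt_trans a0 aD); rewrite ltxx.
have [yD|Dy] := ltP y (a D); last by exists D; rewrite ?Dy.
by have [i iD ai] := IHD a0 yD; exists i => //; exact: ltnW.
Qed.

End Powers.

(** * Hoelder's inequality and step approximation on a geometric scale *)

Section Hoelder.
Context {R : realType} d {T : measurableType d} (P : probability T R).
Implicit Types (f g : T -> R[i]).

Lemma measurable_cabs_powR f p : cmeas f -> measurable_fun setT (fun x => cabs (f x) `^ p).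
Proof.
move=> /cmeas_cabs mf; exact: (@measurableT_comp _ _ _ _ _ _ (fun x => x `^ p)).
Qed.

Lemma rbdd_cabs_powR f p : 0 <= p -> cbdd f -> rbdd (fun x => cabs (f x) `^ p).
Proof.
move=> p0 [mf [M fM]]; split; first exact: measurable_cabs_powR.
exists (M `^ p) => x; rewrite ger0_norm ?powR_ge0 // ge0_ler_powR // nnegrE ?cabs_ge0 //.
exact: le_trans (cabs_ge0 _) (fM x).
Qed.

(** Positive upper bounds [A] and [B] take the place of the norms, so that Young's inequality can be
    applied to [|f| / A] and [|g| / B] without a separate case of zero norm. *)
Lemma hoelder_Ec f g (p q A B : R) : cmeas f -> cmeas g ->
  rL1 P (fun x => cabs (f x) `^ p) -> rL1 P (fun x => cabs (g x) `^ q) ->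
  0 < p -> 0 < q -> p^-1 + q^-1 = 1 -> 0 < A -> 0 < B ->
  Er P (fun x => cabs (f x) `^ p) <= A `^ p ->
  Er P (fun x => cabs (g x) `^ q) <= B `^ q ->
  cL1 P (fun x => f x * g x) /\ cabs (Ec P (fun x => f x * g x)) <= A * B.
Proof.
move=> mf mg lf lg p0 q0 pq A0 B0 fA gB.
pose w x := A * B / (A `^ p * p) * cabs (f x) `^ p + A * B / (B `^ q * q) * cabs (g x) `^ q.
have Ap : 0 < A `^ p by rewrite powR_gt0.
have Bq : 0 < B `^ q by rewrite powR_gt0.
have lw : rL1 P w by apply: rL1D; exact: rL1Z.
have fgw x : cabs (f x * g x) <= w x.
  rewrite cabsM.
  have := conjugate_powR (divr_ge0 (cabs_ge0 (f x)) (ltW A0)) (divr_ge0 (cabs_ge0 (g x)) (ltW B0)) p0 q0 pq.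
  rewrite !powRM ?cabs_ge0 ?invr_ge0 ?(ltW A0) ?(ltW B0) // !powRVl ?(ltW A0) ?(ltW B0) //.
  rewrite -(ler_pM2l (mulr_gt0 A0 B0)) => h.
  have -> : cabs (f x) * cabs (g x) = A * B * (cabs (f x) / A * (cabs (g x) / B)).
    by field; rewrite !gt_eqF.
  apply: (le_trans h); rewrite /w le_eqVlt; apply/orP; left; apply/eqP.
  by field; rewrite !gt_eqF.
have lfg : cL1 P (fun x => f x * g x) by apply: (cL1_le _ fgw lw); exact: cmeasM.
split=> //; rewrite (le_trans (cabs_Ec lfg)) //.
apply: (@le_trans _ _ (Er P w)); first by apply: le_Er => //; case: lfg.
rewrite ErD; [|exact: rL1Z|exact: rL1Z]; rewrite (ErZ _ lf) (ErZ _ lg).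
have h1 : A * B / (A `^ p * p) * Er P (fun x => cabs (f x) `^ p) <= A * B * p^-1.
  rewrite invfM mulrA -!mulrA ler_pM2l // ler_pM2l // mulrCA ler_piMr ?invr_ge0 ?(ltW p0) //.
  by rewrite mulrC ler_pdivrMr // mul1r.
have h2 : A * B / (B `^ q * q) * Er P (fun x => cabs (g x) `^ q) <= A * B * q^-1.
  rewrite invfM mulrA -!mulrA ler_pM2l // ler_pM2l // mulrCA ler_piMr ?invr_ge0 ?(ltW q0) //.
  by rewrite mulrC ler_pdivrMr // mul1r.
by rewrite (le_trans (lerD h1 h2)) // -mulrDr pq mulr1.
Qed.

(** The [u i] are meant as the phases of one function on disjoint level sets: at each point at most
    one is nonzero, and it is unimodular. Powers of the modulus then pass through linear
    combinations, as in [selects_sum]. *)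
Definition selects D (u : 'I_D -> T -> R[i]) := forall x,
  (forall i, u i x = 0) \/
  exists i, cabs (u i x) = 1 /\ forall i', i' != i -> u i' x = 0.

Lemma selects_sum D (u : 'I_D -> T -> R[i]) (c : 'I_D -> R[i]) p x :
  selects u -> 0 < p ->
  cabs (\sum_i c i * u i x) `^ p = \sum_i cabs (u i x) * cabs (c i) `^ p.
Proof.
move=> /(_ x) su p0; have [u0|[i [ui u0]]] := su.
  rewrite !big1 ?cabs0 ?powR0 ?gt_eqF // => i _; rewrite u0 ?mulr0 // cabs0 mul0r //.
rewrite (bigD1 i) //= big1 ?addr0 => [|j ji]; last by rewrite u0 ?mulr0.
rewrite (bigD1 i) //= big1 ?addr0 => [|j ji]; last by rewrite u0 ?cabs0 ?mul0r.
by rewrite cabsM ui mulr1 mul1r.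
Qed.

(** The modulus of [f] is rounded down to the scale of the powers of [rho^al]. On such a scale it
    enters only through an integer [i], so the complex powers of interpolation amount to replacing a
    power of [rho] by [z^i]. The shift [M0] puts the lowest level at most at [eta]; smaller values
    of [f] are dropped. *)
Lemma step_approx f (al rho eta : R) : cbdd f -> 0 < al -> 1 < rho -> 0 < eta ->
  exists D M0, (M0 <= D)%N /\ exists u : 'I_D -> T -> R[i],
  [/\ forall i, cbdd (u i), selects u,
      forall x be, 0 <= be ->
        \sum_(i < D) cabs (u i x) * rho `^ (be * (i%:R - M0%:R)) <= cabs (f x) `^ (be / al) &
      forall x, cabs (f x - \sum_(i < D) (rho `^ (al * (i%:R - M0%:R)))%:C * u i x) <=
                eta + cabs (f x) * (1 - rho `^ (- al))].
Proof.
move=> [mf [M fM]] al0 rho1 eta0.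
have rho0 : 0 < rho by exact: lt_trans rho1.
have ra1 : 1 < rho `^ al.
  have {1}<- : 1 `^ al = 1 :> R by rewrite powR1.
  by rewrite gt0_ltr_powR // nnegrE // ltW.
have [M0 hM0] := ex_expr_gt eta^-1 ra1.
have [D' hD'] := ex_expr_gt (M + 1) ra1.
pose D := (M0 + D')%N; pose a i := rho `^ (al * (i%:R - M0%:R)).
exists D, M0; split; first exact: leq_addr.
have a_gt0 i : 0 < a i by rewrite powR_gt0.
have aS i : a i.+1 = a i * rho `^ al.
  rewrite /a -powRD; last by apply/implyP => _; rewrite gt_eqF.
  by congr (_ `^ _); rewrite -natr1; ring.
have a_mono i k : (i <= k)%N -> a i <= a k.
  by move=> ik; rewrite /a ler_powR ?(ltW rho1) // ler_wpM2l ?(ltW al0) // lerB // ler_nat.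
have a0 : a 0%N <= eta.
  rewrite /a mulr0n sub0r mulrN powRN powRrM powR_mulrn ?powR_ge0 //.
  by rewrite -[leRHS]invrK lef_pV2 ?posrE ?invr_gt0 ?exprn_gt0 ?powR_gt0 // ltW.
have aD x : cabs (f x) < a D.
  rewrite (le_lt_trans (fM x)) // /a /D natrD addrC addKr powRrM powR_mulrn ?powR_ge0 //.
  by apply: lt_trans hD'; rewrite ltrDl.
pose L (i : nat) : set T := [set x | a i <= cabs (f x) < a i.+1].
have mL i : measurable (L i).
  rewrite (_ : L i = (fun x => cabs (f x)) @^-1` [set` `[a i, a i.+1[]); last first.
    by apply/seteqP; split => x /=; rewrite in_itv.
  by rewrite -[X in measurable X]setTI; apply: cmeas_cabs => //; exact: measurable_itv.
pose u (i : 'I_D) x : R[i] := f x * (cabs (f x) `^ (-1))%:C * (\1_(L i) x)%:C.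
have u_in (i : 'I_D) x : L i x -> u i x = f x * ((cabs (f x))^-1)%:C.
  by move=> Lx; rewrite /u powR_inv1 ?cabs_ge0 // indicE mem_set // mulr1.
have u_out (i : 'I_D) x : ~ L i x -> u i x = 0.
  by move=> Lx; rewrite /u indicE memNset // mulr0.
have u_abs (i : 'I_D) x : L i x -> cabs (u i x) = 1.
  move=> Lx; have /andP[ax _] := Lx; have fx := lt_le_trans (a_gt0 i) ax.
  by rewrite u_in // cabsM cabs_real ger0_norm ?invr_ge0 ?cabs_ge0 // divff // gt_eqF.
have L_uniq (i k : nat) x : L i x -> L k x -> i = k.
  move=> /andP[i1 i2] /andP[k1 k2]; apply/eqP; rewrite eqn_leq.
  apply/andP; split; rewrite leqNgt; apply/negP => /a_mono h.
    by move: (lt_le_trans k2 (le_trans h i1)); rewrite ltxx.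
  by move: (lt_le_trans i2 (le_trans h k1)); rewrite ltxx.
have L_ex x : (forall i : 'I_D, u i x = 0) /\ cabs (f x) <= eta \/
    exists i : 'I_D, L i x /\ forall i', i' != i -> u i' x = 0.
  have [fx|fx] := ltP (cabs (f x)) (a 0%N).
    left; split=> [i|]; last exact: le_trans (ltW fx) a0.
    by apply: u_out => /andP[h _]; move: (lt_le_trans fx (le_trans (a_mono 0%N i isT) h)); rewrite ltxx.
  have [i iD Li] := ex_level fx (aD x); right; exists (Ordinal iD); split=> // i' ii'.
  apply: u_out => Li'; move/eqP: ii'; apply; apply: val_inj => /=; exact: L_uniq Li' Li.
have cu i : cbdd (u i).
  split.
    apply: cmeasM; last by apply: cmeas_real; exact: measurable_indic.
    by apply: cmeasM => //; apply: cmeas_real; exact: measurable_cabs_powR.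
  exists 1 => x; have [Lx|Lx] := pselect (L i x); first by rewrite u_abs.
  by rewrite u_out // cabs0.
exists u; split=> //.
- by move=> x; have [[u0 _]|[i [Li u0]]] := L_ex x; [left|right; exists i; rewrite u_abs].
- move=> x be be0; have [[u0 _]|[i [Li u0]]] := L_ex x.
    by rewrite big1 ?powR_ge0 // => i _; rewrite u0 cabs0 mul0r.
  rewrite (bigD1 i) //= big1 ?addr0 => [|j ji]; last by rewrite u0 ?cabs0 ?mul0r.
  rewrite u_abs // mul1r.
  have -> : rho `^ (be * (i%:R - M0%:R)) = a i `^ (be / al).
    by rewrite /a -powRrM; congr (_ `^ _); field; rewrite gt_eqF.
  have /andP[ai _] := Li.
  by rewrite ge0_ler_powR ?nnegrE ?cabs_ge0 ?(ltW (a_gt0 _)) // divr_ge0 // ltW.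
- move=> x; have h0 : 0 <= 1 - rho `^ (- al).
    by rewrite subr_ge0 powRN invf_le1 ?powR_gt0 // ltW.
  have [[u0 fe]|[i [Li u0]]] := L_ex x.
    rewrite big1 ?subr0 => [|i _]; last by rewrite u0 mulr0.
    by rewrite (le_trans fe) // lerDl mulr_ge0 ?cabs_ge0.
  rewrite (bigD1 i) //= big1 ?addr0 => [|j ji]; last by rewrite u0 ?mulr0.
  have /andP[a1 a2] := Li; have fx := lt_le_trans (a_gt0 i) a1.
  rewrite u_in // -/(a i).
  have -> : f x - (a i)%:C * (f x * ((cabs (f x))^-1)%:C) =
      f x * ((cabs (f x))^-1)%:C * (cabs (f x) - a i)%:C.
    rewrite (rmorphB (real_complex R)) /= mulrBr; congr (_ - _); last by rewrite mulrC.
    by rewrite -mulrA -(rmorphM (real_complex R)) /= mulVf ?gt_eqF // mulr1.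
  rewrite !cabsM !cabs_real ger0_norm ?invr_ge0 ?cabs_ge0 // divff ?gt_eqF // mul1r.
  rewrite ger0_norm ?subr_ge0 // mulrBr mulr1.
  have : cabs (f x) * rho `^ (- al) <= a i.
    by rewrite powRN ler_pdivrMr ?powR_gt0 // -aS ltW.
  by move: eta0; lra.
Qed.

End Hoelder.

(** * Interpolation between [L^oo] to [L^4] and [L^2] to [L^2] *)

Section Interpolation.
Context {R : realType} d {T : measurableType d} (P : probability T R).
Implicit Types (f g k : T -> R[i]).
Variable U : (T -> R[i]) -> T -> R[i].
Hypothesis cbdd_U : forall f, cbdd f -> cbdd (U f).
Hypothesis UD : forall f g x, cbdd f -> cbdd g -> U (fun x => f x + g x) x = U f x + U g x.
Hypothesis UZ : forall (c : R[i]) f x, cbdd f -> U (fun x => c * f x) x = c * U f x.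
(** A crude sup-norm constant: it controls the error of the step approximations and disappears from
    the conclusion of [interpolation]. *)
Variable C : R.
Hypothesis C0 : 0 <= C.
Hypothesis U_sup : forall f M x, cbdd f -> (forall x, cabs (f x) <= M) -> cabs (U f x) <= C * M.
Hypothesis U_Loo_L4 : forall f M, cbdd f -> (forall x, cabs (f x) <= M) ->
  Er P (fun x => cabs (U f x) ^+ 4) <= M ^+ 4.
Hypothesis U_L2 : forall f, cbdd f ->
  Er P (fun x => cabs (U f x) ^+ 2) <= Er P (fun x => cabs (f x) ^+ 2).

Lemma U_sum D (c : 'I_D -> R[i]) (u : 'I_D -> T -> R[i]) x : (forall i, cbdd (u i)) ->
  U (fun x => \sum_i c i * u i x) x = \sum_i c i * U (u i) x.
Proof.
move=> cu; elim: (index_enum _) => [|i r IHr].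
  rewrite big_nil (_ : (fun x => _) = fun x => 0 * (0 : R[i])).
    by rewrite (@UZ 0 (fun=> 0)) ?mul0r //; exact: cbdd_cst.
  by apply/funext => y; rewrite big_nil mul0r.
rewrite big_cons -IHr -UZ // -UD.
- by congr U; apply/funext => y; rewrite big_cons.
- by apply: cbddM => //; exact: cbdd_cst.
- by apply: cbdd_sum => j; apply: cbddM => //; exact: cbdd_cst.
Qed.

(** Complex interpolation with a polynomial: [f_z = sum z^i u_i] and
    [k_z = sum rho^(3 (l - M1)) z^(E - l) v_l] make [Q(z) = E (U f_z k_z)] a polynomial. It is
    estimated by [L^4] against [L^(4/3)] on [|z| = 1], by [L^2] against [L^2] on [|z| = rho], and at
    [z = rho^th] by the three circles theorem. *)
Lemma step_interpolation (rho th : R) (D E M0 M1 : nat)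
    (u : 'I_D -> T -> R[i]) (v : 'I_E -> T -> R[i]) :
  1 < rho -> 0 <= th <= 1 -> (M1 <= E)%N ->
  (forall i, cbdd (u i)) -> selects u -> (forall l, cbdd (v l)) -> selects v ->
  Er P (fun x => \sum_(i < D) cabs (u i x) * rho `^ (2 * (i%:R - M0%:R))) <= 1 ->
  Er P (fun x => \sum_(l < E) cabs (v l x) * rho `^ (4 * (l%:R - M1%:R))) <= 1 ->
  cabs (Ec P (fun x => U (fun y => \sum_(i < D) (rho `^ (th * (i%:R - M0%:R)))%:C * u i y) x *
    \sum_(l < E) (rho `^ ((3 - th) * (l%:R - M1%:R)))%:C * v l x)) <= 1.
Proof.
move=> rho1 th01 ME cu su cv sv Hu Hv.
have rho0 : 0 < rho by exact: lt_trans rho1.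
have rhon0 (a : R) : rho `^ a != 0 by rewrite gt_eqF // powR_gt0.
have rhoD a b : rho `^ (a + b) = rho `^ a * rho `^ b.
  by rewrite powRD //; apply/implyP => _; rewrite gt_eqF.
have rhoX n : rho ^+ n = rho `^ n%:R by rewrite powR_mulrn // ltW.
pose w (l : 'I_E) := (rho `^ (3 * (l%:R - M1%:R)))%:C : R[i].
pose fz (z : R[i]) x := \sum_(i < D) z ^+ i * u i x.
(* Up to the constant [rho^(E - M1)], the moduli of the coefficients go from [rho^(3 (l - M1))] on
   the unit circle to [rho^(2 (l - M1))] on the circle of radius [rho]. The offset [E] keeps the
   powers of [z] nonnegative. *)
pose kz (z : R[i]) x := \sum_(l < E) (w l * z ^+ (E - l)) * v l x.
have cfz z : cbdd (fz z) by apply: cbdd_sum => i; apply: cbddM => //; exact: cbdd_cst.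
have ckz z : cbdd (kz z) by apply: cbdd_sum => i; apply: cbddM => //; exact: cbdd_cst.
pose Q : {poly R[i]} := \sum_(i < D) \sum_(l < E) (w l * Ec P (fun x => U (u i) x * v l x)) *: 'X^(i + (E - l)).
have cUu i l : cL1 P (fun x => U (u i) x * v l x).
  by apply: cbdd_L1; apply: cbddM => //; exact: cbdd_U.
have QE z : Q.[z] = Ec P (fun x => U (fz z) x * kz z x).
  have -> : (fun x => U (fz z) x * kz z x) =
      fun x => \sum_(i < D) \sum_(l < E) (z ^+ i * (w l * z ^+ (E - l))) * (U (u i) x * v l x).
    apply/funext => x; rewrite /fz U_sum // mulr_suml; apply: eq_bigr => i _.
    by rewrite mulr_sumr; apply: eq_bigr => l _; ring.
  have cc (c : R[i]) i l : cL1 P (fun x => c * (U (u i) x * v l x)).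
    by apply: cbdd_L1; apply: cbddM; [exact: cbdd_cst|apply: cbddM => //; exact: cbdd_U].
  rewrite Ec_sum; last first.
    move=> i; apply: cbdd_L1; apply: cbdd_sum => l.
    by apply: cbddM; [exact: cbdd_cst|apply: cbddM => //; exact: cbdd_U].
  rewrite /Q horner_sum; apply: eq_bigr => i _; rewrite Ec_sum // horner_sum.
  apply: eq_bigr => l _; rewrite hornerZ hornerXn EcZ // exprD; ring.
have lU (p : R) f : 0 <= p -> cbdd f -> rL1 P (fun x => cabs (f x) `^ p).
  by move=> p0 cf; apply: rbdd_L1; exact: rbdd_cabs_powR.
have lsum n (c : 'I_n -> R) (b : 'I_n -> T -> R[i]) : (forall i, cbdd (b i)) ->
    rL1 P (fun x => \sum_i cabs (b i x) * c i).
  move=> cb; apply: rbdd_L1; apply: rbdd_sum => i; apply: rbddM; last exact: rbdd_cst.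
  exact: cbdd_cabs.
have Q1 z : cabs z = 1 -> cabs Q.[z] <= 1.
  move=> z1; rewrite QE -[leRHS]mulr1.
  have pq : 4^-1 + (4 / 3)^-1 = 1 :> R by field.
  have q0 : 0 < 4 / 3 :> R by rewrite divr_gt0.
  have hA : Er P (fun x => cabs (U (fz z) x) `^ 4) <= 1 `^ 4.
    rewrite powR1; under eq_fun do rewrite (powR_mulrn 4) ?cabs_ge0 //.
    rewrite (le_trans (U_Loo_L4 (M := 1) (cfz z) _)) ?expr1n // => x.
    rewrite -[leLHS]powRr1 ?cabs_ge0 // selects_sum //.
    have [u0|[i [ui u0]]] := su x.
      by rewrite big1 // => i _; rewrite u0 cabs0 mul0r.
    rewrite (bigD1 i) //= big1 ?addr0 => [|j ji]; last by rewrite u0 ?cabs0 ?mul0r.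
    by rewrite ui mul1r cabsX z1 expr1n powR1.
  have hB : Er P (fun x => cabs (kz z x) `^ (4 / 3)) <= 1 `^ (4 / 3).
    rewrite powR1; apply: le_trans Hv; apply: le_Er; [exact: lU (ltW q0) _|exact: lsum|move=> x].
    rewrite selects_sum //; apply: ler_sum => l _; rewrite ler_wpM2l ?cabs_ge0 //.
    rewrite cabsM cabsX z1 expr1n mulr1 cabs_real ger0_norm ?powR_ge0 // -powRrM.
    by rewrite (_ : 3 * (l%:R - M1%:R) * (4 / 3) = 4 * (l%:R - M1%:R)) //; field.
  by have [] := hoelder_Ec (proj1 (cbdd_U (cfz z))) (proj1 (ckz z))
    (lU 4 _ (ler0n _ 4) (cbdd_U (cfz z))) (lU _ _ (ltW q0) (ckz z)) (ltr0n _ 4) q0 pq ltr01 ltr01 hA hB.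
pose N := (M0 + (E - M1))%N.
have Q2 z : cabs z = rho -> cabs Q.[z] <= rho ^+ N.
  move=> z1; rewrite QE /N exprD.
  have pq : 2^-1 + 2^-1 = 1 :> R by field.
  have hA : Er P (fun x => cabs (U (fz z) x) `^ 2) <= (rho ^+ M0) `^ 2.
    apply: (@le_trans _ _ (Er P (fun x => cabs (fz z x) ^+ 2))).
      by under eq_fun do rewrite (powR_mulrn 2) ?cabs_ge0 //; exact: U_L2.
    rewrite (_ : (fun x => _) = fun x => (rho ^+ M0) `^ 2 *
      \sum_(i < D) cabs (u i x) * rho `^ (2 * (i%:R - M0%:R))); last first.
      apply/funext => x; rewrite -(powR_mulrn 2) ?cabs_ge0 // selects_sum //.
      rewrite mulr_sumr; apply: eq_bigr => i _; rewrite mulrCA; congr (_ * _).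
      by rewrite cabsX z1 !rhoX -!powRrM -rhoD; congr (_ `^ _); ring.
    by rewrite ErZ ?ler_piMr ?powR_ge0 //; exact: lsum.
  have hB : Er P (fun x => cabs (kz z x) `^ 2) <= (rho ^+ (E - M1)) `^ 2.
    rewrite (_ : (fun x => _) = fun x => (rho ^+ (E - M1)) `^ 2 *
      \sum_(l < E) cabs (v l x) * rho `^ (4 * (l%:R - M1%:R))); last first.
      apply/funext => x; rewrite selects_sum //.
      rewrite mulr_sumr; apply: eq_bigr => l _; rewrite mulrCA; congr (_ * _).
      rewrite cabsM cabsX z1 cabs_real ger0_norm ?powR_ge0 // !rhoX -rhoD -!powRrM -rhoD.
      rewrite !natrB //; last exact: ltnW.
      by congr (_ `^ _); ring.
    by rewrite ErZ ?ler_piMr ?powR_ge0 //; exact: lsum.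
  by have [] := hoelder_Ec (proj1 (cbdd_U (cfz z))) (proj1 (ckz z))
    (lU 2 _ (ler0n _ 2) (cbdd_U (cfz z))) (lU 2 _ (ler0n _ 2) (ckz z)) (ltr0n _ 2) (ltr0n _ 2) pq
    (exprn_gt0 _ rho0) (exprn_gt0 _ rho0) hA hB.
have := three_circles rho1 th01 Q1 Q2.
rewrite QE.
have -> : (fun x => U (fz (rho `^ th)%:C) x * kz (rho `^ th)%:C x) = fun x => (rho `^ (th * N%:R))%:C *
   (U (fun y => \sum_(i < D) (rho `^ (th * (i%:R - M0%:R)))%:C * u i y) x *
    \sum_(l < E) (rho `^ ((3 - th) * (l%:R - M1%:R)))%:C * v l x).
  apply/funext => x.
  have -> : fz (rho `^ th)%:C = fun y => (rho `^ (th * M0%:R))%:C *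
      \sum_(i < D) (rho `^ (th * (i%:R - M0%:R)))%:C * u i y.
    apply/funext => y; rewrite mulr_sumr; apply: eq_bigr => i _; rewrite mulrA; congr (_ * _).
    rewrite -(rmorphXn (real_complex R)) -(rmorphM (real_complex R)) /=; congr (_%:C).
    by rewrite -powR_mulrn ?powR_ge0 // -powRrM -rhoD; congr (_ `^ _); ring.
  have -> : kz (rho `^ th)%:C x = (rho `^ (th * (E - M1)%:R))%:C *
      \sum_(l < E) (rho `^ ((3 - th) * (l%:R - M1%:R)))%:C * v l x.
    rewrite mulr_sumr; apply: eq_bigr => i _; rewrite mulrA; congr (_ * _).
    rewrite -(rmorphXn (real_complex R)) -!(rmorphM (real_complex R)) /=; congr (_%:C).
    rewrite -powR_mulrn ?powR_ge0 // -powRrM -!rhoD; congr (_ `^ _).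
    by rewrite !natrB //; [ring|exact: ltnW].
  rewrite UZ; last by apply: cbdd_sum => i; apply: cbddM => //; exact: cbdd_cst.
  rewrite /N natrD mulrDr rhoD (rmorphM (real_complex R)) /=; ring.
rewrite EcZ; last first.
  apply: cbdd_L1; apply: cbddM.
    by apply: cbdd_U; apply: cbdd_sum => i; apply: cbddM => //; exact: cbdd_cst.
  by apply: cbdd_sum => i; apply: cbddM => //; exact: cbdd_cst.
have rp : 0 < rho `^ (th * N%:R) by rewrite powR_gt0.
by rewrite cabsM cabs_real ger0_norm ?(ltW rp) // => h; rewrite -(ler_pM2l rp) mulr1.
Qed.

(** Step approximations reduce this to [step_interpolation]. The exponent [4 / (3 - th)] is
    conjugate to [4 / (1 + th)], so this is the dual form of a contraction from [L^(2 / th)] to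
    [L^(4 / (1 + th))]. *)
Lemma interpolation (th : R) f k : 0 < th -> th < 1 -> cbdd f -> cbdd k ->
  Er P (fun x => cabs (f x) `^ (2 / th)) <= 1 ->
  Er P (fun x => cabs (k x) `^ (4 / (3 - th))) <= 1 ->
  cabs (Ec P (fun x => U f x * k x)) <= 1.
Proof.
move=> th0 th1 cf ck.
have [mf [Mf0 fM0]] := cf; have [mk [Mk0 kM0]] := ck.
pose M := 1 + `|Mf0| + `|Mk0|.
have fM x : cabs (f x) <= M.
  by rewrite (le_trans (fM0 x)) // /M; have := ler_norm Mf0; have := normr_ge0 Mk0; lra.
have kM x : cabs (k x) <= M.
  by rewrite (le_trans (kM0 x)) // /M; have := ler_norm Mk0; have := normr_ge0 Mf0; lra.
have M1 : 1 <= M by rewrite /M; have := normr_ge0 Mk0; have := normr_ge0 Mf0; lra.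
suff h e : 0 < e -> Er P (fun x => cabs (f x) `^ (2 / th)) <= 1 ->
    Er P (fun x => cabs (k x) `^ (4 / (3 - th))) <= 1 ->
    cabs (Ec P (fun x => U f x * k x)) <= 1 + e.
  by move=> Hf Hk; apply/ler_addgt0Pr => e e0; exact: h.
move=> e0.
(* Chosen so that the two error terms, each at most [C eta (1 + M) M], add up to [e C / (1 + C)]. *)
pose eta := e / (2 * (1 + C) * M * (1 + M)).
have den0 : 0 < 2 * (1 + C) * M * (1 + M).
  by rewrite !mulr_gt0 //; move: C0 M1; lra.
have eta0 : 0 < eta by rewrite divr_gt0.
(* A cube root, because the scales [rho^th] and [rho^(3 - th)] have exponents at most 3 and must
   have ratio at most [1 + eta]. *)
pose rho := (1 + eta) `^ (3^-1).
have rho1 : 1 < rho.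
  have {1}<- : 1 `^ (3^-1) = 1 :> R by rewrite powR1.
  by rewrite gt0_ltr_powR ?invr_gt0 // ?nnegrE //; move: eta0; lra.
have rho_small al : 0 < al -> al <= 3 -> 1 - rho `^ (- al) <= eta.
  move=> al0 al3; have r3 : rho `^ al <= 1 + eta.
    have <- : rho `^ 3 = 1 + eta by rewrite /rho -powRrM mulVf ?powRr1 //; move: eta0; lra.
    by rewrite ler_powR // ltW.
  have ra : 0 < rho `^ al by rewrite powR_gt0 // (lt_trans ltr01).
  have ra1 : 1 <= rho `^ al by rewrite -[leLHS](powRr0 rho) ler_powR ?ltW.
  rewrite powRN -(ler_pM2r ra) mulrBl mul1r mulVf ?gt_eqF //.
  have : eta <= eta * rho `^ al by rewrite ler_peMr // ltW.
  by move: r3; lra.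
have th3 : 0 < 3 - th by lra.
have th_le3 : th <= 3 by lra.
have th_le3' : 3 - th <= 3 by lra.
have C1 : 0 < 1 + C by move: C0; lra.
have M2 : 0 < M by lra.
have M3 : 0 < 1 + M by lra.
have CC : C <= 1 + C by lra.
move=> Hf Hk.
have [D [M0 [MD [u [cu su Hu fu]]]]] := step_approx cf th0 rho1 eta0.
have [E [M1' [ME [v [cv sv Hv kv]]]]] := step_approx ck th3 rho1 eta0.
pose f' x := \sum_(i < D) (rho `^ (th * (i%:R - M0%:R)))%:C * u i x.
pose k' x := \sum_(l < E) (rho `^ ((3 - th) * (l%:R - M1'%:R)))%:C * v l x.
have cf' : cbdd f' by apply: cbdd_sum => i; apply: cbddM => //; exact: cbdd_cst.
have ck' : cbdd k' by apply: cbdd_sum => i; apply: cbddM => //; exact: cbdd_cst.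
have lsum n (c : 'I_n -> R) (b : 'I_n -> T -> R[i]) : (forall i, cbdd (b i)) ->
    rL1 P (fun x => \sum_i cabs (b i x) * c i).
  move=> cb; apply: rbdd_L1; apply: rbdd_sum => i; apply: rbddM; last exact: rbdd_cst.
  exact: cbdd_cabs.
have step : cabs (Ec P (fun x => U f' x * k' x)) <= 1.
  apply: step_interpolation => //; first by rewrite !ltW.
    apply: le_trans Hf; apply: le_Er => [||x]; [exact: lsum| |exact: Hu].
    by apply/rbdd_L1/rbdd_cabs_powR => //; rewrite divr_ge0 // ltW.
  apply: le_trans Hk; apply: le_Er => [||x]; [exact: lsum| |exact: Hv].
  by apply/rbdd_L1/rbdd_cabs_powR => //; rewrite divr_ge0 // ltW.
have ff' x : cabs (f x - f' x) <= eta * (1 + M).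
  rewrite (le_trans (fu x)) // [leRHS]mulrDr mulr1 lerD2l [leRHS]mulrC ler_pM ?cabs_ge0 //.
    by rewrite subr_ge0 -[leRHS](powRr0 rho) ler_powR ?(ltW rho1) // oppr_le0 ltW.
  by apply: rho_small.
have kk' x : cabs (k x - k' x) <= eta * (1 + M).
  rewrite (le_trans (kv x)) // [leRHS]mulrDr mulr1 lerD2l [leRHS]mulrC ler_pM ?cabs_ge0 //.
    by rewrite subr_ge0 -[leRHS](powRr0 rho) ler_powR ?(ltW rho1) // oppr_le0 ltW.
  by apply: rho_small.
have f'M x : cabs (f' x) <= M.
  rewrite (le_trans _ (fM x)) // -[leLHS]powRr1 ?cabs_ge0 // selects_sum //.
  apply: (@le_trans _ _ (\sum_(i < D) cabs (u i x) * rho `^ (th * (i%:R - M0%:R)))).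
    by apply: ler_sum => i _; rewrite cabs_real powRr1 // ger0_norm ?powR_ge0.
  by rewrite (le_trans (Hu x th (ltW th0))) // divff ?gt_eqF // powRr1 ?cabs_ge0.
have cff' : cbdd (fun x => f x - f' x) by exact: cbddB.
have ckk' : cbdd (fun x => k x - k' x) by exact: cbddB.
have cU1 : cL1 P (fun x => U (fun y => f y - f' y) x * k x).
  by apply: cbdd_L1; apply: cbddM => //; exact: cbdd_U.
have cU2 : cL1 P (fun x => U f' x * (k x - k' x)).
  by apply: cbdd_L1; apply: cbddM => //; exact: cbdd_U.
have cU3 : cL1 P (fun x => U f' x * k' x).
  by apply: cbdd_L1; apply: cbddM => //; exact: cbdd_U.
have -> : (fun x => U f x * k x) = fun x => U (fun y => f y - f' y) x * k x +
    U f' x * (k x - k' x) + U f' x * k' x.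
  apply/funext => x; rewrite -addrA -mulrDr subrK -mulrDl -UD //.
  by congr (U _ _ * _); apply/funext => y; rewrite subrK.
rewrite EcD //; last exact: cL1D.
rewrite EcD // (le_trans (cabsD _ _)) // addrC lerD //.
rewrite (le_trans (cabsD _ _)) //.
have e1 : cabs (Ec P (fun x => U (fun y => f y - f' y) x * k x)) <= C * (eta * (1 + M)) * M.
  rewrite (le_trans (cabs_Ec cU1)) // -[leRHS](Er_cst P).
  apply: le_Er => [||x]; [by case: cU1|exact: rL1_cst|].
  by rewrite cabsM ler_pM ?cabs_ge0 // U_sup.
have e2 : cabs (Ec P (fun x => U f' x * (k x - k' x))) <= C * M * (eta * (1 + M)).
  rewrite (le_trans (cabs_Ec cU2)) // -[leRHS](Er_cst P).
  apply: le_Er => [||x]; [by case: cU2|exact: rL1_cst|].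
  by rewrite cabsM ler_pM ?cabs_ge0 // U_sup.
apply: le_trans (lerD e1 e2) _.
have -> : C * (eta * (1 + M)) * M + C * M * (eta * (1 + M)) = e * (C / (1 + C)).
  by rewrite /eta; field; rewrite !gt_eqF.
by rewrite ler_piMr ?(ltW e0) // ler_pdivrMr ?mul1r.
Qed.

End Interpolation.

(** * One-variable projections from [L^r] to [L^s] *)

Section ProjectedFejer.
Variables (R : realType) (d : nat).
Local Notation torus := (@torus R d).
Local Notation P := (@haar R d).
Implicit Types (f g h : torus -> R[i]).

Lemma fcoef_out S f a : trig S f -> ~~ S a -> fcoef f a = 0.
Proof.
move=> tf Sa; have ta : trig (pred1 a) (@ex R d a).
  by apply: trig_ext (trig_ex (S := pred1 a) 1 (eqxx a)) => x; rewrite mul1r.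
by apply: Ec_trig_ortho tf ta => b Sb; apply: contra Sa => /eqP <-.
Qed.

Lemma cabs_fcoef f M a : cbdd f -> (forall x, cabs (f x) <= M) -> cabs (fcoef f a) <= M.
Proof.
move=> cf fM; have lf := cL1_exJ a (cbdd_L1 P cf).
rewrite (le_trans (cabs_Ec lf)) // -[leRHS](Er_cst P); apply: le_Er => [||x].
- by case: lf.
- exact: rL1_cst.
- by rewrite cabsM cabsJ cabs_ex mulr1.
Qed.

Section Projected.
Variables (n : nat) (j : 'I_d).
Local Notation box := {ffun 'I_d -> 'I_n.+1}.

(** The one-variable Riesz projection of the Fejer mean. Unlike the projection alone it is linear
    with a sup-norm bound on all bounded functions, as interpolation demands; on polynomials it
    tends to the projection as [n] grows. *)
Definition pfejer f (x : torus) : R[i] :=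
  (#|box|%:R)^-1 * \sum_(p : box * box)
    (nneg j (freq p.1 - freq p.2))%:R * (fcoef f (freq p.1 - freq p.2) * ex (freq p.1 - freq p.2) x).

Lemma pfejer_trig f : trig (nneg j) (pfejer f).
Proof.
apply: trigZ; apply: trig_sum => p.
have [Sa|nSa] := boolP (nneg j (freq p.1 - freq p.2)).
  by apply: trig_ext (trig_ex (fcoef f (freq p.1 - freq p.2)) Sa) => x; rewrite mul1r.
by apply: trig_ext (trig0 R (nneg j)) => x; rewrite mul0r.
Qed.

Lemma fejerBpfejer_trig f : trig (fun a => ~~ nneg j a) (fun x => fejer n f x - pfejer f x).
Proof.
have -> : (fun x => fejer n f x - pfejer f x) = fun x => (#|box|%:R)^-1 * \sum_(p : box * box)
    (~~ nneg j (freq p.1 - freq p.2))%:R * (fcoef f (freq p.1 - freq p.2) * ex (freq p.1 - freq p.2) x).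
  apply/funext => x; rewrite -mulrBr -sumrB; congr (_ * _); apply: eq_bigr => p _.
  by case: (nneg j _); rewrite ?mul1r ?mul0r ?subrr ?subr0.
apply: trigZ; apply: trig_sum => p.
have [Sa|nSa] := boolP (~~ nneg j (freq p.1 - freq p.2)).
  apply: trig_ext (trig_ex (S := fun a => ~~ nneg j a) (fcoef f (freq p.1 - freq p.2)) Sa) => x.
  by rewrite mul1r.
by apply: trig_ext (trig0 R _) => x; rewrite mul0r.
Qed.

Lemma pfejerD f g x : cbdd f -> cbdd g ->
  pfejer (fun x => f x + g x) x = pfejer f x + pfejer g x.
Proof.
move=> /(cbdd_L1 P) lf /(cbdd_L1 P) lg.
rewrite /pfejer -mulrDr -big_split /=; congr (_ * _); apply: eq_bigr => p _.
by rewrite fcoefD // -mulrDr mulrDl.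
Qed.

Lemma pfejerZ (c : R[i]) f x : cbdd f -> pfejer (fun x => c * f x) x = c * pfejer f x.
Proof.
move=> /(cbdd_L1 P) lf.
rewrite /pfejer [in RHS]mulrCA; congr (_ * _); rewrite mulr_sumr; apply: eq_bigr => p _.
by rewrite fcoefZ //; ring.
Qed.

Lemma pfejer_sup f M x : cbdd f -> (forall x, cabs (f x) <= M) ->
  cabs (pfejer f x) <= (#|box|%:R)^-1 * #|{: box * box}|%:R * M.
Proof.
move=> cf fM; have M0 : 0 <= M := le_trans (cabs_ge0 _) (fM x).
rewrite /pfejer cabsM cabsV -mulrA.
have -> : cabs (#|box|%:R : R[i]) = #|box|%:R :> R.
  by rewrite -(rmorph_nat (real_complex R)) cabs_real ger0_norm.
rewrite ler_wpM2l ?invr_ge0 // (le_trans (cabs_sum _ _ _)) //.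
apply: (@le_trans _ _ (\sum_(p : box * box) M)).
  apply: ler_sum => p _; rewrite !cabsM cabs_ex mulr1.
  case: (nneg j _); last by rewrite cabs0 mul0r.
  by rewrite cabs1 mul1r; exact: cabs_fcoef.
by rewrite -sum1_card natr_sum mulr_suml; apply: ler_sum => p _; rewrite mul1r.
Qed.

Lemma pfejer_Loo_L4 f M : cbdd f -> (forall x, cabs (f x) <= M) ->
  Er P (fun x => cabs (pfejer f x) ^+ 4) <= M ^+ 4.
Proof.
move=> cf fM; apply: (projection_Loo_L4 (f := fejer n f) (pfejer_trig f) (fejerBpfejer_trig f)) => x.
  by rewrite subrKC.
exact: fejer_sup.
Qed.

Lemma pfejer_L2 f : cbdd f ->
  Er P (fun x => cabs (pfejer f x) ^+ 2) <= Er P (fun x => cabs (f x) ^+ 2).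
Proof.
move=> cf; apply: le_trans (fejer_L2 n cf).
apply: (projection_L2 (f := fejer n f) (pfejer_trig f) (fejerBpfejer_trig f)) => x.
by rewrite subrKC.
Qed.

Lemma pfejerE f g h x : trig (nneg j) g -> trig (fun a => ~~ nneg j a) h ->
  (forall x, f x = g x + h x) -> pfejer f x = fejer n g x.
Proof.
move=> tg th fE; rewrite /pfejer /fejer; congr (_ * _); apply: eq_bigr => p _.
have -> : f = (fun x => g x + h x) by exact/funext.
rewrite fcoefD; [|exact: trig_cL1 tg|exact: trig_cL1 th].
have [Sa|nSa] := boolP (nneg j (freq p.1 - freq p.2)).
  by rewrite (fcoef_out th) ?addr0 ?mul1r // negbK.
by rewrite (fcoef_out tg) // !mul0r.
Qed.

End Projected.

(** Duality with the test function [k0 = conj g |g|^(s-2)], for which [E (g k0) = E |g|^s = Y] and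
    the norm in the conjugate exponent is [Y^(1/s')]. Interpolation gives [Y <= A Y^(1/s')], that
    is, [Y^(1/s) <= A]. *)
Lemma projection_Lr_Ls (j : 'I_d) (th A : R) f g h : 0 < th -> th < 1 -> 0 < A ->
  trig (nneg j) g -> trig (fun a => ~~ nneg j a) h -> (forall x, f x = g x + h x) ->
  Er P (fun x => cabs (f x) `^ (2 / th)) <= A `^ (2 / th) ->
  Er P (fun x => cabs (g x) `^ (4 / (1 + th))) <= A `^ (4 / (1 + th)).
Proof.
move=> th0 th1 A0 tg tgh fE.
have th2 : 0 < 1 + th by lra.
have th3 : 0 < 3 - th by lra.
have th4 : 0 < 2 - 2 * th by lra.
pose s := 4 / (1 + th); pose s' := 4 / (3 - th); pose r := 2 / th.
have s0 : 0 < s by rewrite divr_gt0.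
have s'0 : 0 < s' by rewrite divr_gt0.
have r0 : 0 < r by rewrite divr_gt0.
have s2 : 0 <= s - 2.
  have -> : s - 2 = (2 - 2 * th) / (1 + th) by rewrite /s; field; rewrite gt_eqF.
  by rewrite divr_ge0 // ltW.
have ss' : s^-1 + s'^-1 = 1 by rewrite /s /s'; field; rewrite !gt_eqF.
have ss1 : (s - 1) * s' = s by rewrite /s /s'; field; rewrite !gt_eqF.
move=> fA; rewrite -/s; pose Y := Er P (fun x => cabs (g x) `^ s); rewrite -/Y.
have Y0 : 0 <= Y by apply: Er_ge0 => x; exact: powR_ge0.
have [Ye|Yn0] := eqVneq Y 0; first by rewrite Ye powR_ge0.
have Ygt0 : 0 < Y by rewrite lt0r Yn0.
have cf : cbdd f.
  by rewrite (_ : f = fun x => g x + h x); [exact: cbddD (trig_cbdd tg) (trig_cbdd tgh)|exact/funext].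
have cg := trig_cbdd tg.
pose K := Y `^ s'^-1; have K0 : 0 < K by rewrite powR_gt0.
have KY : K `^ s' = Y by rewrite /K -powRrM (mulVf (lt0r_neq0 s'0)) (powRr1 Y0).
pose k0 x : R[i] := (g x)^* * (cabs (g x) `^ (s - 2))%:C.
have ck0 : cbdd k0.
  by apply: cbddM; [exact: cbddJ|apply: cbdd_real; exact: rbdd_cabs_powR].
have k0_abs x : cabs (k0 x) = cabs (g x) `^ (s - 1).
  rewrite cabsM cabsJ cabs_real ger0_norm ?powR_ge0 //.
  have [->|g0] := eqVneq (cabs (g x)) 0.
    rewrite mul0r powR0 //; apply/eqP => s1; move: ss1; rewrite s1 mul0r => /esym/eqP.
    by rewrite gt_eqF.
  rewrite -[X in X * _]powRr1 ?cabs_ge0 // -powRD; last by apply/implyP.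
  by congr (_ `^ _); ring.
have gk0 x : g x * k0 x = (cabs (g x) `^ s)%:C.
  rewrite /k0 mulrA mulc_conj -(rmorphM (real_complex R)) /=; congr (_%:C).
  have [->|g0] := eqVneq (cabs (g x)) 0; first by rewrite expr0n mul0r powR0 // gt_eqF.
  rewrite -powR_mulrn ?cabs_ge0 // -powRD; last by apply/implyP.
  by congr (_ `^ _); ring.
(* The interpolated operator produces the Fejer mean of [g] in place of [g]; uniform convergence on
   polynomials makes the difference cost at most [e]. *)
have key : Y <= A * K.
  apply/ler_addgt0Pr => e e0.
  have [mk [Mk kM]] := ck0.
  pose M := 1 + `|Mk|; have M0 : 0 < M by rewrite /M ltr_pwDl.
  have {}kM x : cabs (k0 x) <= M by rewrite (le_trans (kM x)) // (le_trans (ler_norm _)) // lerDr.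
  have [n hn] := fejer_cvg_trig tg (divr_gt0 e0 M0).
  have l1 : cL1 P (fun x => (g x - fejer n g x) * k0 x).
    by apply: cbdd_L1; apply: cbddM => //; apply: cbddB => //; exact: trig_cbdd (fejer_trigT n g).
  have l2 : cL1 P (fun x => fejer n g x * k0 x).
    by apply: cbdd_L1; apply: cbddM => //; exact: trig_cbdd (fejer_trigT n g).
  have Yabs : Y = cabs (Ec P (fun x => g x * k0 x)).
    by under eq_fun do rewrite gk0; rewrite Ec_real cabs_real ger0_norm.
  have Esplit : Ec P (fun x => g x * k0 x) =
      Ec P (fun x => fejer n g x * k0 x) + Ec P (fun x => (g x - fejer n g x) * k0 x).
    by rewrite -EcD //; congr Ec; apply/funext => x; ring.
  rewrite Yabs Esplit (le_trans (cabsD _ _)) // lerD //.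
  - pose f1 x := (A^-1)%:C * f x; pose k1 x := (K^-1)%:C * k0 x.
    have cf1 : cbdd f1 by apply: cbddM => //; exact: cbdd_cst.
    have ck1 : cbdd k1 by apply: cbddM => //; exact: cbdd_cst.
    have h1 : Er P (fun x => cabs (f1 x) `^ r) <= 1.
      rewrite (_ : (fun x => _) = fun x => (A `^ r)^-1 * cabs (f x) `^ r); last first.
        apply/funext => x; rewrite cabsM cabs_real ger0_norm ?invr_ge0 ?(ltW A0) //.
        by rewrite powRM ?invr_ge0 ?(ltW A0) ?cabs_ge0 // powRVl // ltW.
      rewrite ErZ; last by apply/rbdd_L1/rbdd_cabs_powR => //; exact: ltW.
      by rewrite mulrC ler_pdivrMr ?powR_gt0 // mul1r.
    have h2 : Er P (fun x => cabs (k1 x) `^ s') <= 1.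
      rewrite (_ : (fun x => _) = fun x => Y^-1 * cabs (g x) `^ s); last first.
        apply/funext => x; rewrite cabsM cabs_real ger0_norm ?invr_ge0 ?(ltW K0) //.
        have KV0 : 0 <= K^-1 by rewrite invr_ge0 ltW.
        rewrite (powRM _ KV0 (cabs_ge0 _)) (powRVl _ (ltW K0)) KY.
        by rewrite k0_abs -powRrM ss1.
      rewrite ErZ; last by apply/rbdd_L1/rbdd_cabs_powR => //; exact: ltW.
      by rewrite mulVf.
    have C0 : 0 <= (#|{ffun 'I_d -> 'I_n.+1}|%:R)^-1 * #|{: {ffun 'I_d -> 'I_n.+1} * {ffun 'I_d -> 'I_n.+1}}|%:R :> R.
      by rewrite mulr_ge0 ?invr_ge0.
    have := @interpolation R _ _ P (pfejer n j) (fun f cf => trig_cbdd (pfejer_trig n j f))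
      (pfejerD n j) (@pfejerZ n j) _ C0
      (pfejer_sup n j) (@pfejer_Loo_L4 n j) (@pfejer_L2 n j) th f1 k1 th0 th1 cf1 ck1 h1 h2.
    have -> : (fun x => pfejer n j f1 x * k1 x) = fun x => ((A * K)^-1)%:C * (fejer n g x * k0 x).
      apply/funext => x; rewrite pfejerZ // (pfejerE n _ tg tgh fE) /k1 invfM (rmorphM (real_complex R)) /=; ring.
    rewrite EcZ // cabsM cabs_real ger0_norm ?invr_ge0 ?mulr_ge0 ?(ltW A0) ?(ltW K0) //.
    by rewrite mulrC ler_pdivrMr ?mulr_gt0 // mul1r.
  - rewrite (le_trans (cabs_Ec l1)) // -[leRHS](Er_cst P); apply: le_Er => [||x].
    + by case: l1.
    + exact: rL1_cst.
    + rewrite cabsM (_ : e = e / M * M); last by rewrite mulfVK // gt_eqF.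
      by rewrite ler_pM ?cabs_ge0 // -cabsN opprB.
have YE : Y = Y `^ s^-1 * K.
  rewrite /K -powRD; last by rewrite ss' oner_eq0.
  by rewrite ss' powRr1.
have : Y `^ s^-1 <= A by rewrite -(ler_pM2r K0) -YE.
move=> h1; have -> : Y = (Y `^ s^-1) `^ s by rewrite -powRrM mulVf ?powRr1 // gt_eqF.
by rewrite ge0_ler_powR ?nnegrE ?powR_ge0 // ltW.
Qed.

End ProjectedFejer.

(** * Density of trigonometric polynomials *)

Section BoundedConvergence.
Context {R : realType} d {T : measurableType d} (P : probability T R).

Lemma bounded_cvg_L1 (u_ : nat -> T -> R) (u : T -> R) (M : R) :
  (forall n, measurable_fun setT (u_ n)) -> measurable_fun setT u ->
  (forall n x, `|u_ n x| <= M) -> {ae P, forall x, u_ n x @[n --> \oo] --> u x} ->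
  forall e, 0 < e -> exists n, Er P (fun x => `|u_ n x - u x|) <= e.
Proof.
move=> mu_ mu u_M cvu e e0.
have [] := @dominated_convergence _ T R P setT measurableT (fun n => EFin \o u_ n) (EFin \o u)
  (EFin \o cst M).
- by move=> n; exact/measurable_EFinP.
- exact/measurable_EFinP.
- apply: filterS cvu => x cvu _; apply: cvg_EFin; first exact: nearW.
  exact: cvu.
- exact: rL1_cst.
- by apply: aeW => x n _; rewrite /= lee_fin.
move=> _ /fine_cvg/cvgr0_norm_le /(_ e e0)[N _ /(_ N (leqnn N)) h] _; exists N.
apply: le_trans h; rewrite /= ger0_norm //; apply: fine_ge0; exact: integral_ge0.
Qed.

End BoundedConvergence.

(** Bernoulli gives the lower bound [1 - (2 s)^n]. These polynomials in [s] tend to the indicator of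
    [s < 1/2] on [[0, 1]] away from 1/2, a device of elementary proofs of the Stone-Weierstrass
    theorem. *)
Lemma smooth_step_lt (R : realType) (s : R) : 0 <= s -> s < 2^-1 ->
  (1 - s ^+ n) ^+ (2 ^ n) @[n --> \oo] --> (1 : R).
Proof.
move=> s0 s1.
have c0 : 1 - (2 * s) ^+ n @[n --> \oo] --> (1 : R).
  rewrite -[X in _ --> X](subr0 (1 : R)); apply: cvgB; first exact: cvg_cst.
  by apply: cvg_expr; rewrite ger0_norm; lra.
apply: (squeeze_cvgr _ c0 (cvg_cst _)); apply: nearW => n.
have sn : 0 <= s ^+ n <= 1 by rewrite exprn_ge0 // exprn_ile1 //; lra.
apply/andP; split; last by rewrite exprn_ile1 //; lra.
have := @bernoulli_ineq R (- s ^+ n) (2 ^ n); rewrite natrX => h.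
by apply: le_trans (h _); [rewrite exprMn mulrN|lra].
Qed.

(** The product of [(1 - s^n)^(2^n)] and [(1 + s^n)^(2^n)] is at most 1, and the second factor is at
    least [(2 s)^n] by Bernoulli. *)
Lemma smooth_step_gt (R : realType) (s : R) : 2^-1 < s -> s <= 1 ->
  (1 - s ^+ n) ^+ (2 ^ n) @[n --> \oo] --> (0 : R).
Proof.
move=> s0 s1; have s2 : 1 < 2 * s by lra.
have c0 : (2 * s)^-1 ^+ n @[n --> \oo] --> (0 : R).
  by apply: cvg_expr; rewrite ger0_norm ?invr_ge0 ?invf_lt1; lra.
apply: (squeeze_cvgr _ (cvg_cst _) c0); apply: nearW => n.
have sn : 0 <= s ^+ n <= 1 by rewrite exprn_ge0 ?exprn_ile1 //; lra.
apply/andP; split; first by rewrite exprn_ge0 //; lra.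
have b := @bernoulli_ineq R (s ^+ n) (2 ^ n); rewrite natrX in b.
have {}b : 1 + (2 * s) ^+ n <= (1 + s ^+ n) ^+ (2 ^ n) by rewrite exprMn; apply: b; lra.
have h : (1 - s ^+ n) ^+ (2 ^ n) * (1 + s ^+ n) ^+ (2 ^ n) <= 1.
  rewrite -exprMn exprn_ile1 //; first by rewrite mulr_ge0; lra.
  by have := sqr_ge0 (s ^+ n); lra.
have s2n : 0 < (2 * s) ^+ n by rewrite exprn_gt0 //; lra.
rewrite exprVn -div1r ler_pdivlMr //; apply: le_trans h.
rewrite ler_wpM2l ?exprn_ge0 //; lra.
Qed.

(** * Marginals of the Haar measure *)

Section Marginals.
Variable R : realType.
Local Notation RT := (g_sigma_algebraType R.-ocitv.-measurable).
Local Notation unif := (uniform_prob (@ltr01 R)).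

Lemma haar_coord d (j : 'I_d) (B : set RT) : measurable B ->
  haar R d ((fun v : torus R d => (v : 'rV[R]_d) ord0 j) @^-1` B) = unif B.
Proof.
elim: d j => [[]//|d IHd] j mB.
case: (unliftP ord0 j) => [j'|] ->.
  pose A := (fun v : torus R d => (v : 'rV[R]_d) ord0 j') @^-1` B.
  have E : @torus_cons R d @^-1` ((fun v : torus R d.+1 => (v : 'rV[R]_d.+1) ord0 (lift ord0 j')) @^-1` B) =
      setT `*` A.
    by apply/seteqP; split => p /=; rewrite torus_consS //; case.
  transitivity ((unif \x haar R d)%E (setT `*` A)); first by rewrite -E.
  rewrite product_measure1E //; last first.
    by have := measurable_coord j' measurableT mB; rewrite setTI.
  rewrite -[RHS]mul1e; congr (_ * _)%E; first exact: (@probability_setT _ _ _ unif).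
  exact: (IHd j' mB).
have E : @torus_cons R d @^-1` ((fun v : torus R d.+1 => (v : 'rV[R]_d.+1) ord0 ord0) @^-1` B) =
    B `*` setT.
  by apply/seteqP; split => p /=; rewrite torus_cons0 //; case.
transitivity ((unif \x haar R d)%E (B `*` setT)); first by rewrite -E.
rewrite product_measure1E // -[RHS]mule1; congr (_ * _)%E.
exact: (@probability_setT _ _ _ (haar R d)).
Qed.

(** The discarded coordinates are those where a smoothed step with jump at [a] need not converge to
    the indicator: the jump and the ends of the period. *)
Lemma ae_coord d (j : 'I_d) (a : R) :
  {ae haar R d, forall v : torus R d, 0 < (v : 'rV[R]_d) ord0 j < 1 /\ (v : 'rV[R]_d) ord0 j != a}.
Proof.
pose B : set RT := ~` (`]0, 1[ `\ a).
have mB : measurable B.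
  by apply: measurableC; apply: measurableD; [exact: measurable_itv|exact: measurable_set1].
exists ((fun v : torus R d => (v : 'rV[R]_d) ord0 j) @^-1` B); split.
- by have := measurable_coord j measurableT mB; rewrite setTI.
- transitivity (unif B); first exact: haar_coord.
  rewrite -[in LHS](setIT B) -integral_indic // integral_unif; last first.
    by apply/measurable_EFinP; exact: measurable_indic.
  rewrite integral_indic //.
  apply: countable_lebesgue_measure0; apply: finite_set_countable.
  apply: (@sub_finite_set _ _ [set 0; 1; a]); last exact: finite_set3.
  move=> x [/= Bx]; rewrite in_itv /= => /andP[x0 x1].
  have [->|xa] := eqVneq x a; first by right.
  have [->|x0'] := eqVneq x 0; first by left; left.
  have [->|x1'] := eqVneq x 1; first by left; right.
  exfalso; apply: Bx; split; last exact/eqP.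
  by rewrite /= in_itv /= !lt_neqAle x0 x1 x1' eq_sym x0'.
- move=> v nv [/=]; rewrite in_itv /= => v01 va; apply: nv; split=> //.
  by apply/eqP.
Qed.

End Marginals.

Import HBSimple.

(** * Approximation in [L^1], from sets to integrable functions *)

Section Density.
Variables (R : realType) (d : nat).
Local Notation torus := (@torus R d).
Local Notation P := (@haar R d).
Local Notation RT := (g_sigma_algebraType R.-ocitv.-measurable).
Implicit Types (f g h : torus -> R[i]) (A B : set torus).

Definition trig_approx f := forall e, 0 < e ->
  exists2 t, trig xpredT t & Er P (fun x => cabs (f x - t x)) <= e.

Lemma Er_dist_trans f g h : cL1 P f -> cL1 P g -> cL1 P h ->
  Er P (fun x => cabs (f x - h x)) <=
  Er P (fun x => cabs (f x - g x)) + Er P (fun x => cabs (g x - h x)).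
Proof.
move=> lf lg lh; have l1 := proj2 (cL1B lf lg); have l2 := proj2 (cL1B lg lh).
rewrite -ErD //; apply: le_Er; [exact: proj2 (cL1B lf lh)|exact: rL1D|move=> x].
by rewrite (_ : f x - h x = (f x - g x) + (g x - h x)) ?cabsD //; ring.
Qed.

Lemma trig_trig_approx S f : trig S f -> trig_approx f.
Proof.
move=> tf e e0; exists f; first by apply: trig_sub tf.
by under eq_fun do rewrite subrr cabs0; rewrite Er_cst ltW.
Qed.

Lemma trig_approx_lim f : cL1 P f ->
  (forall e, 0 < e -> exists g, [/\ cL1 P g, trig_approx g & Er P (fun x => cabs (f x - g x)) <= e]) ->
  trig_approx f.
Proof.
move=> lf h e e0; have e2 : 0 < e / 2 by rewrite divr_gt0.
have [g [lg ag fg]] := h _ e2; have [t tt gt] := ag _ e2; exists t => //.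
by rewrite (le_trans (Er_dist_trans lf lg (trig_cL1 tt))) // [leRHS](splitr e) lerD.
Qed.

Lemma trig_approxD f g : cL1 P f -> cL1 P g ->
  trig_approx f -> trig_approx g -> trig_approx (fun x => f x + g x).
Proof.
move=> lf lg af ag e e0; have e2 : 0 < e / 2 by rewrite divr_gt0.
have [t tt ft] := af _ e2; have [s ts gs] := ag _ e2.
exists (fun x => t x + s x); first exact: trigD.
have l1 := proj2 (cL1B lf (trig_cL1 tt)); have l2 := proj2 (cL1B lg (trig_cL1 ts)).
apply: le_trans (_ : Er P (fun x => cabs (f x - t x) + cabs (g x - s x)) <= _).
  apply: le_Er; [exact: proj2 (cL1B (cL1D lf lg) (cL1D (trig_cL1 tt) (trig_cL1 ts)))|exact: rL1D|move=> x].
  by rewrite (_ : f x + g x - (t x + s x) = (f x - t x) + (g x - s x)) ?cabsD //; ring.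
by rewrite ErD // [leRHS](splitr e) lerD.
Qed.

Lemma trig_approxMb f (b : torus -> R[i]) : cL1 P f -> trig xpredT b ->
  trig_approx f -> trig_approx (fun x => f x * b x).
Proof.
move=> lf tb af e e0; have [mb [M0 bM0]] := trig_cbdd tb.
pose M := 1 + `|M0|; have Mp : 0 < M by rewrite ltr_pwDl.
have bM x : cabs (b x) <= M by rewrite (le_trans (bM0 x)) // (le_trans (ler_norm _)) // lerDr.
have [t tt ft] := af _ (divr_gt0 e0 Mp).
exists (fun x => t x * b x); first by apply: (trigM (S := xpredT) (S' := xpredT)).
have l1 := cL1B lf (trig_cL1 tt).
apply: le_trans (_ : Er P (fun x => M * cabs (f x - t x)) <= _).
  apply: le_Er => [||x]; last by rewrite -mulrBl cabsM mulrC ler_wpM2r ?cabs_ge0.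
    have := proj2 (cL1M l1 (trig_cbdd tb)); congr (rL1 _ _).
    by apply/funext => x; rewrite mulrBl.
  by apply: rL1Z; case: l1.
by rewrite ErZ; [rewrite mulrC -ler_pdivlMr|case: l1].
Qed.

Lemma trig_approxM f g : cbdd f -> cbdd g ->
  trig_approx f -> trig_approx g -> trig_approx (fun x => f x * g x).
Proof.
move=> cf cg af ag; have lf := cbdd_L1 P cf; have lg := cbdd_L1 P cg.
apply: trig_approx_lim => [|e e0]; first exact: cL1M.
have [mf [M0 fM0]] := cf; pose M := 1 + `|M0|; have Mp : 0 < M by rewrite ltr_pwDl.
have fM x : cabs (f x) <= M by rewrite (le_trans (fM0 x)) // (le_trans (ler_norm _)) // lerDr.
have [t tt gt] := ag _ (divr_gt0 e0 Mp).
exists (fun x => f x * t x); split; first exact: cL1M lf (trig_cbdd tt).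
  exact: trig_approxMb.
have l1 := cL1B lg (trig_cL1 tt).
apply: le_trans (_ : Er P (fun x => M * cabs (g x - t x)) <= _).
  apply: le_Er => [||x]; last by rewrite -mulrBr cabsM ler_wpM2r ?cabs_ge0.
    exact: proj2 (cL1B (cL1M lf cg) (cL1M lf (trig_cbdd tt))).
  by apply: rL1Z; case: l1.
by rewrite ErZ; [rewrite mulrC -ler_pdivlMr|case: l1].
Qed.

Lemma trig_approx_ae_lim (u_ : nat -> torus -> R) (u : torus -> R) M :
  (forall n, measurable_fun setT (u_ n)) -> measurable_fun setT u ->
  (forall n x, `|u_ n x| <= M) -> (forall x, `|u x| <= M) ->
  {ae P, forall x, u_ n x @[n --> \oo] --> u x} ->
  (forall n, trig_approx (fun x => (u_ n x)%:C)) -> trig_approx (fun x => (u x)%:C).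
Proof.
move=> mu_ mu u_M uM cvu au.
have bu_ n : rbdd (u_ n) by split=> //; exists M.
have bu : rbdd u by split=> //; exists M.
apply: trig_approx_lim => [|e e0]; first exact/cbdd_L1/cbdd_real.
have [n hn] := bounded_cvg_L1 mu_ mu u_M cvu e0.
exists (fun x => (u_ n x)%:C); split=> //; first exact/cbdd_L1/cbdd_real.
rewrite (_ : (fun x => _) = fun x => `|u_ n x - u x|) //; apply/funext => x.
by rewrite -(rmorphB (real_complex R)) /= cabs_real distrC.
Qed.

(** The good sets. They form a sigma-algebra: complements and intersections come from sums and
    products of approximants, unions from a limit in [L^1]. It then suffices to treat half-lines in
    one coordinate. *)
Definition approx_set A := measurable A /\ trig_approx (fun x => (\1_A x)%:C).

Lemma cbdd_indic A : measurable A -> cbdd (fun x => (\1_A x)%:C : R[i]).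
Proof.
move=> mA; apply: cbdd_real; split; first exact: measurable_indic.
by exists 1 => x; rewrite indicE; case: (_ \in _); rewrite ?normr1 ?normr0.
Qed.

Lemma approx_setC A : approx_set A -> approx_set (~` A).
Proof.
move=> [mA aA]; split; first exact: measurableC.
have -> : (fun x => (\1_(~` A) x)%:C : R[i]) = (fun x => 1 + (\1_A x)%:C * (-1)).
  apply/funext => x; rewrite !indicE in_setC; case: (_ \in _) => /=.
    by rewrite mul1r subrr.
  by rewrite mul0r addr0.
apply: trig_approxD.
- exact/cbdd_L1/cbdd_cst.
- by apply: cbdd_L1; apply: cbddM; [exact: cbdd_indic|exact: cbdd_cst].
- exact: trig_trig_approx (trig_cst (S := xpredT) 1 isT).
- by apply: trig_approxMb => //; [exact/cbdd_L1/cbdd_indic|exact: trig_cst].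
Qed.

Lemma approx_setI A B : approx_set A -> approx_set B -> approx_set (A `&` B).
Proof.
move=> [mA aA] [mB aB]; split; first exact: measurableI.
have -> : (fun x => (\1_(A `&` B) x)%:C : R[i]) = (fun x => (\1_A x)%:C * (\1_B x)%:C).
  by apply/funext => x; rewrite indicI /= (rmorphM (real_complex R)).
by apply: trig_approxM => //; exact: cbdd_indic.
Qed.

Lemma approx_set0 : approx_set set0.
Proof.
split=> //; have := trig_trig_approx (trig0 R (xpredT : 'rV[int]_d -> bool)).
by congr trig_approx; apply/funext => x; rewrite indic0.
Qed.

Lemma approx_setU A B : approx_set A -> approx_set B -> approx_set (A `|` B).
Proof.
move=> aA aB; rewrite -(setCK (A `|` B)) setCU.
by apply: approx_setC; apply: approx_setI; exact: approx_setC.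
Qed.

Lemma approx_bigcup (F : nat -> set torus) : (forall n, approx_set (F n)) ->
  approx_set (\bigcup_k F k).
Proof.
move=> aF; pose G n := \big[setU/set0]_(k < n) F k.
have aG n : approx_set (G n).
  elim: n => [|n IHn]; rewrite /G ?big_ord0 ?big_ord_recr; first exact: approx_set0.
  exact: approx_setU.
have mU : measurable (\bigcup_k F k) by apply: bigcupT_measurable => k; case: (aF k).
have i1 (A : set torus) x : `|\1_A x : R| <= 1.
  by rewrite indicE; case: (_ \in _); rewrite ?normr1 ?normr0.
split=> //; apply: (@trig_approx_ae_lim (fun n x => \1_(G n) x) _ 1) => //.
- by move=> n; apply: measurable_indic; case: (aG n).
- apply: aeW => x; apply: cvg_near_cst.
  have [[k _ Fk]|nF] := pselect ((\bigcup_k F k) x).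
    exists k.+1 => // n /= kn; rewrite !indicE !mem_set //; first by exists k.
    by rewrite /G -bigcup_mkord; exists k.
  exists 0%N => // n _; rewrite !indicE !memNset // => Gx; apply: nF.
  have [k _ Fk] : (\bigcup_(i < n) F i) x by rewrite bigcup_mkord.
  by exists k.
- by move=> n; case: (aG n).
Qed.

Lemma approx_sigma : sigma_algebra setT approx_set.
Proof.
split; [exact: approx_set0|by move=> A aA; rewrite setTD; exact: approx_setC|].
exact: approx_bigcup.
Qed.

(* 1/2 - cos(pi a)/4 + cos(2 pi x_j - pi a)/4 = 1/2 - sin(pi (x_j - a)) sin(pi x_j)/2 *)
Definition arc (j : 'I_d) (a : R) (x : torus) : R :=
  2^-1 - 4^-1 * cos (pi * a) + 4^-1 * cos (2 * pi * (x : 'rV[R]_d) ord0 j - pi * a).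

Lemma arcE j a (x : torus) (y := (x : 'rV[R]_d) ord0 j) :
  arc j a x = 2^-1 - 2^-1 * (sin (pi * (y - a)) * sin (pi * y)).
Proof.
rewrite /arc -/y.
have -> : cos (pi * a) = cos (pi * y - pi * (y - a)) by congr cos; ring.
have -> : cos (2 * pi * y - pi * a) = cos (pi * y + pi * (y - a)) by congr cos; ring.
by rewrite cosB cosD; field.
Qed.

Lemma arc_trig j a : trig xpredT (fun x => (arc j a x)%:C).
Proof.
pose D : 'rV[int]_d := \row_i (i == j)%:R.
have exE x : ex D x = cis (2 * pi * (x : 'rV[R]_d) ord0 j).
  rewrite /ex /dotp (bigD1 j) //= mxE eqxx mul1r big1 ?addr0 // => i /negbTE ij.
  by rewrite mxE ij mul0r.
have t1 : trig xpredT (fun x => 2^-1 * (cis (- (pi * a)) * ex D x + cis (pi * a) * ex (- D) x)).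
  by apply: trigZ; apply: trigD; exact: trig_ex.
apply: trig_ext (trigD (trig_cst (S := xpredT) (2^-1 - 4^-1 * cos (pi * a))%:C isT) (trigZ (4^-1)%:C t1)) => x.
rewrite exN exE; have -> : cis (pi * a) = (cis (- (pi * a)))^* by rewrite -cisN opprK.
rewrite -conjM -cisD /arc (_ : 2 * pi * (x : 'rV[R]_d) ord0 j - pi * a = - (pi * a) + 2 * pi * (x : 'rV[R]_d) ord0 j); last by ring.
by apply: complexP; rewrite !(ReD, ImD, ReM, ImM, ReJ, ImJ) /=; field.
Qed.

Lemma arc_bounds j a x : 0 <= arc j a x <= 1.
Proof.
rewrite arcE; set u := sin _ * _; suff : `|u| <= 1 by rewrite ler_norml => /andP[]; lra.
by rewrite normrM mulr_ile1 // ler_norml ?sin_geN1 ?sin_le1.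
Qed.

(** For [0 <= a < 1] and almost every point, [arc j a] lies below 1/2 exactly when the coordinate
    exceeds [a], so the smooth steps in [arc] are polynomials tending to the indicator. For other
    [a] the indicator is almost everywhere constant. *)
Lemma approx_ray (j : 'I_d) (a : R) : approx_set [set x : torus | a < (x : 'rV[R]_d) ord0 j].
Proof.
set A := [set _ | _].
have mA : measurable A.
  rewrite (_ : A = (fun x : torus => (x : 'rV[R]_d) ord0 j) @^-1` `]a, +oo[).
    by have := measurable_coord j measurableT (measurable_itv `]a, +oo[); rewrite setTI.
  by apply/seteqP; split => x /=; rewrite in_itv /= andbT.
split=> //.
have i1 x : `|\1_A x : R| <= 1.
  by rewrite indicE; case: (_ \in _); rewrite ?normr1 ?normr0.
have [a0|a0] := ltP a 0.
  apply: (@trig_approx_ae_lim (fun n x => 1) _ 1) => //.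
  - by move=> n x; rewrite normr1.
  - have := ae_coord j (0 : R); apply: filterS => x [/andP[x0 x1] _]; apply: cvg_near_cst.
    by apply: nearW => n; rewrite indicE mem_set //; exact: lt_trans a0 x0.
  - by move=> n; exact: trig_trig_approx (trig_cst (S := xpredT) 1 isT).
have [a1|a1] := ltP a 1; last first.
  apply: (@trig_approx_ae_lim (fun n x => 0) _ 1) => //.
  - by move=> n x; rewrite normr0.
  - have := ae_coord j (0 : R); apply: filterS => x [/andP[x0 x1] _]; apply: cvg_near_cst.
    by apply: nearW => n; rewrite indicE memNset // => /lt_trans/(_ x1); rewrite ltNge a1.
  - by move=> n; exact: trig_trig_approx (trig_cst (S := xpredT) 0 isT).
pose q n x := (1 - arc j a x ^+ n) ^+ (2 ^ n).
have tq n : trig xpredT (fun x => (q n x)%:C).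
  have tX m (u : torus -> R) : trig xpredT (fun x => (u x)%:C) -> trig xpredT (fun x => (u x ^+ m)%:C).
    move=> tu; apply: trig_ext (trigX m isT _ tu) => // x.
    by rewrite (rmorphXn (real_complex R)).
  apply: (tX (2 ^ n)%N); apply: trig_ext (trigB (trig_cst (S := xpredT) 1 isT) (tX n _ (arc_trig j a))) => x.
  by rewrite (rmorphB (real_complex R)).
apply: (@trig_approx_ae_lim q _ 1) => //.
- by move=> n; have [[]] := trig_cbdd (tq n).
- move=> n x; have /andP[s0 s1] := arc_bounds j a x.
  have sn : 0 <= arc j a x ^+ n <= 1 by rewrite exprn_ge0 ?exprn_ile1.
  by rewrite ger0_norm ?exprn_ge0 ?exprn_ile1 //; lra.
- have := ae_coord j a; apply: filterS => x [/andP[x0 x1] xa].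
  have /andP[s0 s1] := arc_bounds j a x.
  have p0 := pi_gt0 R.
  have s2 : 0 < sin (pi * (x : 'rV[R]_d) ord0 j).
    by rewrite sin_gt0_pi // mulr_gt0 //= gtr_pMr.
  have [ax|ax] := ltP a ((x : 'rV[R]_d) ord0 j).
    rewrite indicE mem_set //; apply: smooth_step_lt => //.
    rewrite arcE; suff : 0 < sin (pi * ((x : 'rV[R]_d) ord0 j - a)) * sin (pi * (x : 'rV[R]_d) ord0 j) by lra.
    rewrite mulr_gt0 // sin_gt0_pi // mulr_gt0 ?subr_gt0 //= gtr_pMr //; lra.
  rewrite indicE memNset; last by rewrite /A /= ltNge ax.
  apply: smooth_step_gt => //; rewrite arcE.
  suff : 0 < sin (pi * (a - (x : 'rV[R]_d) ord0 j)) * sin (pi * (x : 'rV[R]_d) ord0 j).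
    by rewrite -opprB mulrN sinN mulNr; lra.
  have {}ax : (x : 'rV[R]_d) ord0 j < a by rewrite lt_neqAle xa.
  rewrite mulr_gt0 // sin_gt0_pi // mulr_gt0 ?subr_gt0 //= gtr_pMr //; lra.
- by move=> n; exact: trig_trig_approx (tq n).
Qed.

(** Two uses of the good-set principle: from rays to all Borel sets in one coordinate, and from
    cylinders to the sigma-algebra they generate. *)
Lemma measurable_approx A : measurable A -> approx_set A.
Proof.
apply: smallest_sub; first exact: approx_sigma.
move=> _ [j [B [mB ->]]].
pose S := [set B : set R | approx_set ((fun v : torus => (v : 'rV[R]_d) ord0 j) @^-1` B)].
suff : (@RGenOInfty.G R).-sigma.-measurable `<=` S by apply; rewrite -RGenOInfty.measurableE.
apply: smallest_sub.
  split.
  - by rewrite /S /= preimage_set0; exact: approx_set0.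
  - by move=> D aD; rewrite /S /= setTD preimage_setC; exact: approx_setC.
  - by move=> F aF; rewrite /S /= preimage_bigcup; exact: approx_bigcup.
move=> _ [a ->]; rewrite /S /=.
rewrite (_ : _ @^-1` _ = [set x : torus | a < (x : 'rV[R]_d) ord0 j]); first exact: approx_ray.
by apply/seteqP; split => x /=; rewrite in_itv /= andbT.
Qed.

Lemma cL1_real (u : torus -> R) : rL1 P u -> cL1 P (fun x => (u x)%:C).
Proof.
move=> lu; split; first exact: (cmeas_real (rL1_meas lu)).
rewrite (_ : (fun x => _) = fun x => `|u x|); first exact: rL1_norm.
by apply/funext => x; rewrite cabs_real.
Qed.

Lemma rL1_approx (u : torus -> R) : rL1 P u -> trig_approx (fun x => (u x)%:C).
Proof.
move=> lu; apply: trig_approx_lim => [|e e0].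
  exact: cL1_real.
have [g_ [ig _ cg]] := approximation_sfun_integrable measurableT lu.
have /fine_cvg/cvgr0_norm_le/(_ e e0)[N _ /(_ N (leqnn N)) hN] := cg.
have lgR : rL1 P (g_ N) by exact: ig.
exists (fun x => (g_ N x)%:C); split.
- exact: cL1_real.
- rewrite (_ : (fun x => _) = fun x => \sum_(i < size (finmap.enum_fset (fset_set (range (g_ N)))))
      (\1_(g_ N @^-1` [set (finmap.enum_fset (fset_set (range (g_ N))))`_i]) x)%:C *
        ((finmap.enum_fset (fset_set (range (g_ N))))`_i)%:C); last first.
    apply/funext => x; rewrite fimfunEord (rmorph_sum (real_complex R)); apply: eq_bigr => i _.
    by rewrite (rmorphM (real_complex R)) /= mulrC.
  have mg y : measurable (g_ N @^-1` [set y]) by exact: measurable_funPTI.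
  have ci y (c : R) : cbdd (fun x => (\1_(g_ N @^-1` [set y]) x)%:C * c%:C).
    by apply: cbddM; [exact: cbdd_indic|exact: cbdd_cst].
  elim: (index_enum _) => [|i r IHr].
    under eq_fun do rewrite big_nil; exact: trig_trig_approx (trig0 R (xpredT : 'rV[int]_d -> bool)).
  under eq_fun do rewrite big_cons.
  apply: trig_approxD => //; [exact/cbdd_L1|by apply: cbdd_L1; exact: cbdd_sum|].
  apply: trig_approxMb; [exact/cbdd_L1/cbdd_indic|exact: trig_cst|].
  by have [] := measurable_approx (mg ((finmap.enum_fset (fset_set (range (g_ N))))`_i)).
- apply: le_trans hN; rewrite /= ger0_norm ?fine_ge0 ?integral_ge0 //.
  rewrite le_eqVlt; apply/orP; left; apply/eqP; rewrite /Er /Rintegral; congr fine.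
  by apply: eq_integral => x _; rewrite -(rmorphB (real_complex R)) /= cabs_real.
Qed.

Lemma cL1_approx f : cL1 P f -> trig_approx f.
Proof.
move=> lf; have lr := cL1_Re lf; have li := cL1_Im lf.
have -> : f = fun x => (complex.Re (f x))%:C + (complex.Im (f x))%:C * 'i.
  by apply/funext => x; apply: complexP; rewrite !(ReD, ImD, ReM, ImM) /=; ring.
apply: trig_approxD; [exact: cL1_real| |exact: rL1_approx|].
  by apply: cL1M; [exact: cL1_real|exact: cbdd_cst].
by apply: trig_approxMb; [exact: cL1_real|exact: trig_cst|exact: rL1_approx].
Qed.

(** A polynomial [t] close to [f] is moved little by a Fejer mean of high order, and the mean of
    [f - t] stays small because Fejer means contract [L^1]. *)
Lemma fejer_cvg_L1 f : cL1 P f -> forall e, 0 < e ->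
  exists n, Er P (fun x => cabs (f x - fejer n f x)) <= e.
Proof.
move=> lf e e0; have e3 : 0 < e / 3 by rewrite divr_gt0.
have [t tt ft] := cL1_approx lf e3.
have [n hn] := fejer_cvg_trig tt e3; exists n.
have lt := trig_cL1 tt; have lft := trig_cL1 (fejer_trigT n t); have lff := trig_cL1 (fejer_trigT n f).
rewrite (le_trans (Er_dist_trans lf lt lff)) // (_ : e = e / 3 + (e / 3 + e / 3)); last by field.
rewrite lerD // (le_trans (Er_dist_trans lt lft lff)) // lerD //.
  rewrite -[leRHS](Er_cst P); apply: le_Er => [||x]; [by case: (cL1B lt lft)|exact: rL1_cst|].
  by rewrite -cabsN opprB.
apply: le_trans ft; have := fejer_L1 n (cL1B lf lt).
rewrite (_ : (fun x => cabs (fejer n (fun x => f x - t x) x)) =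
  fun x => cabs (fejer n t x - fejer n f x)) //.
apply/funext => x; have -> : fejer n (fun x => f x - t x) x = fejer n f x - fejer n t x.
  exact: fejerB.
by rewrite -cabsN opprB.
Qed.

End Density.

(** * Polynomial approximation of the logarithm *)

Section LogApproximation.
Variable R : realType.

Lemma geom_sum (t : R) n : (1 - t) * \sum_(k < n) t ^+ k = 1 - t ^+ n.
Proof.
elim: n => [|n IHn]; first by rewrite big_ord0 mulr0 expr0 subrr.
by rewrite big_ord_recr /= mulrDr IHn exprS; ring.
Qed.

(** The function [ln (1 - x) + sum x^(k+1) / (k+1)] vanishes at 0 and has derivative
    [- x^n / (1 - x)]; the mean value theorem gives the bound. *)
Lemma ln_series (t tau : R) n : 0 <= t -> t <= tau -> tau < 1 ->
  `|ln (1 - t) + \sum_(k < n) k.+1%:R^-1 * t ^+ k.+1| <= tau ^+ n / (1 - tau).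
Proof.
move=> t0 ttau tau1.
have [->|tn0] := eqVneq t 0.
  rewrite subr0 ln1 add0r big1 ?normr0 => [|k _]; last by rewrite expr0n mulr0.
  by rewrite divr_ge0 ?exprn_ge0 //; lra.
have tgt0 : 0 < t by rewrite lt0r tn0.
pose F (x : R) := ln (1 - x) + \sum_(k < n) k.+1%:R^-1 * x ^+ k.+1.
pose f (x : R) := - (1 - x)^-1 + \sum_(k < n) x ^+ k.
have dF (x : R) : x < 1 -> is_derive x 1 F (f x).
  move=> x1; have x10 : 0 < 1 - x by rewrite subr_gt0.
  have d1 : is_derive x 1 (fun y : R => 1 - y) (-1).
    have := is_deriveB (is_derive_cst (1 : R) x 1) (is_derive_id x (1 : R)).
    by rewrite sub0r.
  have d2 : is_derive x 1 (fun y : R => ln (1 - y)) (- (1 - x)^-1).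
    have := @is_derive1_comp R (@ln R) (fun y : R => 1 - y) x _ _ (is_derive1_ln x10) d1.
    by rewrite mulrN1.
  apply: is_deriveD => //.
  have dX k : is_derive x 1 (fun y : R => k.+1%:R^-1 * y ^+ k.+1) (x ^+ k).
    have h := is_deriveZ (k.+1%:R^-1 : R) (is_deriveX k.+1 (is_derive_id x (1 : R))).
    apply: (is_derive_eq (f := fun y : R => k.+1%:R^-1 * y ^+ k.+1)).
      rewrite (_ : (fun y : R => _) = (k.+1%:R^-1 : R) \*: ((id : R -> R) ^+ k.+1)); first exact: h.
      by apply/funext => y; rewrite /= exprfctE.
    by rewrite /GRing.scale /= mulr1 mulrA mulVf ?pnatr_eq0 // mul1r.
  elim: n {F f} => [|m IHm].
    under eq_fun do rewrite big_ord0; rewrite big_ord0; exact: is_derive_cst.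
  under eq_fun do rewrite big_ord_recr; rewrite big_ord_recr /=.
  exact: is_deriveD.
have cF : {within `[0, t], continuous F}.
  apply: continuous_in_subspaceT => x /set_mem /=; rewrite in_itv /= => /andP[_ xt].
  apply: differentiable_continuous; apply/derivable1_diffP.
  by have [] := dF x (le_lt_trans xt (le_lt_trans ttau tau1)).
have dF' x : x \in `]0, t[ -> is_derive x 1 F (f x).
  by rewrite in_itv /= => /andP[_ xt]; apply: dF; lra.
have [c] := MVT_segment t0 dF' cF; rewrite in_itv /= => /andP[c0 ct].
have -> : F 0 = 0.
  by rewrite /F subr0 ln1 add0r big1 // => k _; rewrite expr0n mulr0.
rewrite !subr0 -/(F t) => ->; have c1 : 0 < 1 - c by lra.
have -> : f c = - (c ^+ n / (1 - c)).
  rewrite /f; have := geom_sum c n  => h.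
  rewrite (_ : \sum_(k < n) c ^+ k = (1 - c ^+ n) / (1 - c)); first by field; rewrite gt_eqF.
  by rewrite -h mulrC mulKf // gt_eqF.
have cn : 0 <= c ^+ n by rewrite exprn_ge0.
rewrite mulNr normrN ger0_norm; last by rewrite !mulr_ge0 ?invr_ge0 // ltW.
have h1 : c ^+ n <= tau ^+ n by rewrite lerXn2r ?nnegrE //; lra.
have h2 : (1 - c)^-1 <= (1 - tau)^-1 by rewrite lef_pV2 ?posrE; lra.
apply: (@le_trans _ _ (c ^+ n / (1 - c))).
  by rewrite ler_piMr ?mulr_ge0 ?invr_ge0 ?(ltW c1) //; lra.
by rewrite ler_pM // invr_ge0 ltW.
Qed.

(** The logarithm is expanded at the right end: with [t = 1 - v / M] one has
    [ln v = ln M + ln (1 - t)], and [0 <= t <= 1 - a / M < 1] on the whole interval. *)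
Lemma ln_poly_approx (a M e : R) : 0 < a -> a <= M -> 0 < e ->
  exists p : {poly R}, forall v, a <= v <= M -> `|p.[v] - ln v| <= e.
Proof.
move=> a0 aM e0; have M0 : 0 < M := lt_le_trans a0 aM.
pose tau := 1 - a / M.
have aM1 : 0 < a / M by rewrite divr_gt0.
have aM2 : a / M <= 1 by rewrite ler_pdivrMr // mul1r.
have tau0 : 0 <= tau by rewrite /tau; lra.
have tau1 : tau < 1 by rewrite /tau; lra.
have [n hn] : exists n, tau ^+ n / (1 - tau) <= e.
  have [t0|t0] := eqVneq tau 0.
    by exists 1%N; rewrite t0 expr1 mul0r ltW.
  have tp : 0 < tau by rewrite lt0r t0.
  have t1 : 0 < 1 - tau by rewrite subr_gt0.
  have tv : 1 < tau^-1 by rewrite invf_gt1.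
  have [n hn] := ex_expr_gt (e * (1 - tau))^-1 tv.
  exists n; rewrite ler_pdivrMr //.
  rewrite -[leLHS]invrK -exprVn -[leRHS]invrK lef_pV2 ?posrE ?exprn_gt0 ?invr_gt0 ?mulr_gt0 //.
  exact: ltW.
pose p : {poly R} := polyC (ln M) - \sum_(k < n) (k.+1%:R^-1 : R) *: (1 - M^-1 *: 'X) ^+ k.+1.
exists p => v /andP[av vM].
have v0 : 0 < v := lt_le_trans a0 av.
have vM1 : v / M <= 1 by rewrite ler_pdivrMr // mul1r.
have vM2 : a / M <= v / M by rewrite ler_pM2r // invr_gt0.
have := @ln_series (1 - v / M) tau n _ _ tau1.
rewrite subKr lnM ?posrE ?invr_gt0 // lnV ?posrE // => h.
rewrite /p hornerD hornerN hornerC horner_sum.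
have -> : \sum_(k < n) (k.+1%:R^-1 *: (1 - M^-1 *: 'X) ^+ k.+1).[v] =
    \sum_(k < n) k.+1%:R^-1 * (1 - v / M) ^+ k.+1.
  by apply: eq_bigr => k _; rewrite hornerZ horner_exp hornerD hornerN hornerZ hornerX hornerC [M^-1 * v]mulrC.
rewrite -normrN; apply: le_trans hn; apply: le_trans (h _ _); [|by lra|by rewrite /tau; lra].
rewrite le_eqVlt; apply/orP; left; apply/eqP; congr `|_|; ring.
Qed.

End LogApproximation.

(** * Outer functions *)

Section EulerPowers.
Variable R : realType.
Implicit Types (x y m C K q : R) (z G : R[i]) (n : nat).

(** Apply [1 + y <= exp y] to [y = 2 x^2 - x]: the product [(1 + x) (1 + y)] is [1 + x^2 (1 + 2 x)],
    at least 1 for [x >= -1/2]. *)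
Lemma expR_le1D x : - 2^-1 <= x -> expR (x - 2 * x ^+ 2) <= 1 + x.
Proof.
move=> x2; have -> : x - 2 * x ^+ 2 = - (2 * x ^+ 2 - x) by ring.
rewrite expRN -div1r ler_pdivrMr ?expR_gt0 //.
have h : 1 + (2 * x ^+ 2 - x) <= expR (2 * x ^+ 2 - x) by exact: expR_ge1Dx.
have h1 : 0 <= 1 + x by lra.
apply: le_trans (ler_wpM2l h1 h).
rewrite (_ : (1 + x) * _ = 1 + x ^+ 2 * (1 + 2 * x)); last by ring.
by rewrite lerDl mulr_ge0 ?sqr_ge0 //; lra.
Qed.

Lemma exp1D_le x n : 0 <= 1 + x -> (1 + x) ^+ n <= expR (n%:R * x).
Proof.
move=> x1; rewrite mulrC expRM_natr lerXn2r ?nnegrE ?expR_ge0 //.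
exact: expR_ge1Dx.
Qed.

Lemma exp1D_ge x n : - 2^-1 <= x -> expR (n%:R * (x - 2 * x ^+ 2)) <= (1 + x) ^+ n.
Proof.
move=> x2; rewrite mulrC expRM_natr lerXn2r ?nnegrE ?expR_ge0 //; first by lra.
exact: expR_le1D.
Qed.

(** The tangent at [m] of a convex function. Integrated with [m] the mean, it plays the part of
    Jensen's inequality for [(1 + a / n)^n]. *)
Lemma exp1D_tangent y m n : -1 < m -> -1 <= y ->
  (1 + m) ^+ n + n%:R * (1 + m) ^+ n / (1 + m) * (y - m) <= (1 + y) ^+ n.
Proof.
move=> m1 y1; have m0 : 0 < 1 + m by lra.
have -> : 1 + y = (1 + m) * (1 + (y - m) / (1 + m)) by field; rewrite gt_eqF.
have h : -1 <= (y - m) / (1 + m) by rewrite ler_pdivlMr //; lra.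
rewrite exprMn; apply: le_trans (ler_wpM2l (exprn_ge0 n (ltW m0)) (bernoulli_ineq n h)).
by rewrite le_eqVlt; apply/orP; left; apply/eqP; field; rewrite gt_eqF.
Qed.

Lemma cabs_exp1D_sub1 z n : cabs ((1 + z) ^+ n - 1) <= (1 + cabs z) ^+ n - 1.
Proof.
elim: n => [|n IHn]; first by rewrite !expr0 !subrr cabs0.
rewrite (_ : (1 + z) ^+ n.+1 - 1 = ((1 + z) ^+ n - 1) * (1 + z) + z); last by rewrite exprSr; ring.
rewrite (_ : _ ^+ n.+1 - 1 = ((1 + cabs z) ^+ n - 1) * (1 + cabs z) + cabs z);
  last by rewrite exprSr; ring.
apply: le_trans (cabsD _ _) _; rewrite lerD2r cabsM ler_pM ?cabs_ge0 //.
by rewrite (le_trans (cabsD _ _)) ?cabs1.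
Qed.

(** The squared modulus is [(1 + x)^n] with [n x = 2 Re z + |z|^2 / n]. Since [|x| <= 3 C / n], the
    second-order loss [2 n x^2] is at most [18 C^2 / n], whence the condition on [n]. *)
Lemma sqr_cabs_euler z C e n : cabs z <= C -> (0 < n)%N -> 4 * C <= n%:R ->
  18 * C ^+ 2 <= e * n%:R ->
  expR (2 * complex.Re z - e) <= cabs ((1 + (n%:R^-1)%:C * z) ^+ n) ^+ 2 <=
  expR (2 * complex.Re z + e).
Proof.
move=> zC n0 nC ne; have n0' : 0 < n%:R :> R by rewrite ltr0n.
have C0 : 0 <= C by exact: le_trans (cabs_ge0 z) zC.
set t := n%:R : R in n0' nC ne *.
pose x := 2 * complex.Re z / t + (cabs z / t) ^+ 2.
have -> : cabs ((1 + (t^-1)%:C * z) ^+ n) ^+ 2 = (1 + x) ^+ n.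
  rewrite cabsX -exprM mulnC exprM; congr (_ ^+ n).
  rewrite /x expr_div_n !sqr_cabs ReD ImD ReM ImM /=; field; lra.
have zz := le_trans (Re_le_cabs z) zC.
have [zl zu] : - C <= complex.Re z /\ complex.Re z <= C by move: zz; rewrite ler_norml => /andP.
have s0 : 0 <= (cabs z / t) ^+ 2 by exact: sqr_ge0.
have s1 : (cabs z / t) ^+ 2 * t <= C ^+ 2 / t.
  rewrite expr_div_n (_ : _ * t = cabs z ^+ 2 / t); last by field; lra.
  by rewrite ler_pM2r ?invr_gt0 // lerXn2r ?nnegrE ?cabs_ge0.
have c1 : C ^+ 2 / t * 18 <= e by rewrite mulrC mulrA ler_pdivrMr.
have c0 : 0 <= C ^+ 2 / t by rewrite divr_ge0 ?sqr_ge0 ?(ltW n0').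
have xt : x * t = 2 * complex.Re z + (cabs z / t) ^+ 2 * t by rewrite /x; field; lra.
have x1 : - 2^-1 <= x.
  rewrite -(ler_pM2r n0') xt; have := mulr_ge0 s0 (ltW n0'); lra.
have d1 : C / t <= 4^-1 by rewrite ler_pdivrMr //; lra.
have d0 : 0 <= C / t by rewrite divr_ge0 ?(ltW n0').
apply/andP; split.
- apply: le_trans (exp1D_ge n x1); rewrite ler_expR -/t.
  have xa : `|x| <= 3 * (C / t).
    have x2 : `|x| <= 2 * (C / t) + (C / t) ^+ 2.
      apply: le_trans (ler_normD _ _) _; apply: lerD.
        rewrite -mulrA normrM ger0_norm // ler_pM2l // normrM normfV (gtr0_norm n0').
        by rewrite ler_pM2r ?invr_gt0.
      by rewrite ger0_norm // lerXn2r ?nnegrE ?divr_ge0 ?cabs_ge0 ?(ltW n0') // ler_pM2r ?invr_gt0.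
    apply: le_trans x2 _; have : (C / t) ^+ 2 <= C / t by rewrite expr2 ler_piMl //; lra.
    lra.
  have xs : x ^+ 2 <= 9 * (C / t) ^+ 2.
    rewrite -real_normK ?num_real // (_ : 9 * _ = (3 * (C / t)) ^+ 2); last by ring.
    by rewrite lerXn2r ?nnegrE // mulr_ge0.
  have -> : t * (x - 2 * x ^+ 2) = x * t - 2 * (t * x ^+ 2) by ring.
  have h : t * x ^+ 2 <= 9 * (C ^+ 2 / t).
    rewrite (_ : 9 * _ = t * (9 * (C / t) ^+ 2)); last by field; lra.
    by rewrite ler_pM2l.
  rewrite xt; have := mulr_ge0 s0 (ltW n0'); lra.
- have x1' : 0 <= 1 + x by lra.
  by apply: le_trans (exp1D_le n x1') _; rewrite ler_expR mulrC xt lerD2l; lra.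
Qed.

(** [Em] and [Ep] imitate [exp (-z)] and [exp z], and [v = |G|^2 + eps^2] is [exp (2 Re z)] up to a
    factor [q^2] either way; the Euler error costs one more [q]. So [v |Em|^2] lies between [q^-3]
    and [q^3], and [G conj(G Em) = v conj Em - eps^2 conj Em] is close to [Ep - eps^2 conj Em]. *)
Lemma outer_pointwise G z eps K q C n : 0 < eps -> 0 < K -> 1 < q ->
  cabs G ^+ 2 + eps ^+ 2 <= K ^+ 2 ->
  `|complex.Re z - 2^-1 * ln (cabs G ^+ 2 + eps ^+ 2)| <= ln q ->
  cabs z <= C -> (0 < n)%N -> 4 * C <= n%:R -> 18 * C ^+ 2 <= ln q * n%:R ->
  let Em := (1 + (n%:R^-1)%:C * (- z)) ^+ n in
  let Ep := (1 + (n%:R^-1)%:C * z) ^+ n in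
  [/\ cabs (G * Em) <= q ^+ 2, cabs Em <= q ^+ 2 / eps &
      cabs (G * (G * Em)^* - (Ep - (eps ^+ 2)%:C * Em^*)) <=
      2 * (q ^+ 3 - 1) * (K * q ^+ 2)].
Proof.
move=> e0 K0 q1 vK wv zC n0 nC nq Em Ep; set v := cabs G ^+ 2 + eps ^+ 2 in vK wv.
have q0 : 0 < q by lra.
have t0 : 0 < n%:R :> R by rewrite ltr0n.
have zNC : cabs (- z) <= C by rewrite cabsN.
have v0 : 0 < v by rewrite ltr_wpDl ?sqr_ge0 // exprn_gt0.
have /andP[_ Epu] := sqr_cabs_euler zC n0 nC nq.
have /andP[Eml Emu] := sqr_cabs_euler zNC n0 nC nq.
rewrite -/Ep in Epu; rewrite -/Em in Eml Emu.
have ReN : complex.Re (- z) = - complex.Re z by case: (z).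
rewrite ReN in Eml Emu.
move: wv; rewrite ler_norml => /andP[wl wu].
have qE k : q ^+ k = expR (k%:R * ln q) by rewrite mulrC expRM_natr lnK.
have vE : v = expR (ln v) by rewrite lnK.
have l0 : 0 < ln q by rewrite ln_gt0.
have q3 : 1 <= q ^+ 3 by rewrite exprn_ege1 // ltW.
have q34 : q ^+ 3 <= (q ^+ 2) ^+ 2 by rewrite -exprM ler_weXn2l // ltW.
have vEmu : v * cabs Em ^+ 2 <= q ^+ 3.
  rewrite vE qE; apply: le_trans (ler_wpM2l (expR_ge0 _) Emu) _.
  rewrite -expRD ler_expR; lra.
have vEml : (q ^+ 3)^-1 <= v * cabs Em ^+ 2.
  rewrite vE qE -expRN; apply: le_trans (ler_wpM2l (expR_ge0 _) Eml).
  rewrite -expRD ler_expR; lra.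
have Ep2 : cabs Ep ^+ 2 <= v * q ^+ 3.
  rewrite vE qE; apply: le_trans Epu _; rewrite -expRD ler_expR; lra.
have KqE : (K * q ^+ 2) ^+ 2 = K ^+ 2 * (q ^+ 2) ^+ 2 by ring.
have Kq0 : 0 <= K * q ^+ 2 by rewrite mulr_ge0 ?exprn_ge0 ?(ltW K0) ?(ltW q0).
have vq : v * q ^+ 3 <= (K * q ^+ 2) ^+ 2.
  by rewrite KqE ler_pM ?exprn_ge0 ?(ltW v0) ?(ltW q0).
have EpK : cabs Ep <= K * q ^+ 2.
  by rewrite -(@ler_pXn2r _ 2) ?nnegrE ?cabs_ge0 // (le_trans Ep2).
have vEmK : v * cabs Em <= K * q ^+ 2.
  rewrite -(@ler_pXn2r _ 2) ?nnegrE // ?mulr_ge0 ?cabs_ge0 ?(ltW v0) //.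
  apply: le_trans vq; by rewrite exprMn expr2 -mulrA ler_pM2l.
split.
- rewrite -(@ler_pXn2r _ 2) ?nnegrE ?cabs_ge0 ?exprn_ge0 ?(ltW q0) // cabsM exprMn.
  apply: le_trans q34; apply: le_trans vEmu; rewrite ler_wpM2r ?sqr_ge0 //.
  by rewrite lerDl sqr_ge0.
- rewrite ler_pdivlMr // -(@ler_pXn2r _ 2) ?nnegrE ?mulr_ge0 ?cabs_ge0 ?exprn_ge0 ?(ltW q0) ?(ltW e0) //.
  rewrite exprMn mulrC; apply: le_trans q34; apply: le_trans vEmu; rewrite ler_wpM2r ?sqr_ge0 //.
  by rewrite lerDr sqr_ge0.
(* [Ep Em] is [(1 - (z/n)^2)^n], which is close to 1 because [z^2] is divided by [n^2]. *)
pose r := Ep * Em - 1.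
have rq : cabs r <= q ^+ 3 - 1.
  rewrite /r /Ep /Em -exprMn.
  rewrite (_ : _ * _ = 1 + - ((n%:R^-1)%:C * z) ^+ 2); last by ring.
  apply: le_trans (cabs_exp1D_sub1 _ _) _; rewrite lerD2r cabsN cabsX cabsM cabs_real.
  rewrite ger0_norm ?invr_ge0 ?(ltW t0) //.
  have h : 0 <= 1 + (n%:R^-1 * cabs z) ^+ 2 by rewrite addr_ge0 ?sqr_ge0.
  apply: le_trans (exp1D_le n h) _; rewrite qE ler_expR.
  have zz : cabs z ^+ 2 <= C ^+ 2 by rewrite lerXn2r ?nnegrE ?cabs_ge0 // (le_trans (cabs_ge0 z)).
  rewrite (_ : _ * _ = cabs z ^+ 2 / n%:R); last by field; lra.
  rewrite ler_pdivrMr //; have := sqr_ge0 C; have : 0 < ln q * n%:R by rewrite mulr_gt0.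
  lra.
(* Both [v |Em|^2] and [Ep Em] are near 1. Multiplying the first by [Ep] and the second by
   [v conj Em] gives the same product, which cancels. *)
have -> : G * (G * Em)^* - (Ep - (eps ^+ 2)%:C * Em^*) =
    (v * cabs Em ^+ 2 - 1)%:C * Ep - r * (v%:C * Em^*).
  have -> : (v * cabs Em ^+ 2 - 1)%:C = v%:C * (Em * Em^*) - 1.
    by rewrite mulc_conj -(rmorphM (real_complex R)) (rmorphB (real_complex R)).
  have -> : v%:C = G * G^* + (eps ^+ 2)%:C by rewrite mulc_conj -(rmorphD (real_complex R)).
  by rewrite rmorphM /r; ring.
apply: le_trans (cabsB _ _) _; rewrite !cabsM !cabs_real cabsJ (gtr0_norm v0).
have t1 : `|v * cabs Em ^+ 2 - 1| <= q ^+ 3 - 1.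
  rewrite ler_norml lerD2r vEmu andbT opprB lerBrDr.
  apply: le_trans _ vEml.
  have q30 : 0 < q ^+ 3 by rewrite exprn_gt0.
  rewrite -[_^-1]mul1r ler_pdivlMr //.
  have := sqr_ge0 (q ^+ 3 - 1); lra.
have : `|v * cabs Em ^+ 2 - 1| * cabs Ep <= (q ^+ 3 - 1) * (K * q ^+ 2).
  by rewrite ler_pM ?cabs_ge0.
have : cabs r * (v * cabs Em) <= (q ^+ 3 - 1) * (K * q ^+ 2).
  by rewrite ler_pM ?cabs_ge0 // mulr_ge0 ?cabs_ge0 ?ltW.
by move=> h1 h2; rewrite -mulrA mulr_natl mulr2n lerD.
Qed.

End EulerPowers.

(** * The outer test function *)

Section OuterTest.
Variables (R : realType) (d : nat) (j : 'I_d).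
Local Notation torus := (@torus R d).
Local Notation P := (@haar R d).
Implicit Types (a u w : torus -> R) (B G : torus -> R[i]).

Definition fixed (k : 'rV[int]_d) := k ord0 j == 0.
Definition pos (k : 'rV[int]_d) := 0 < k ord0 j.

Lemma cabs_Ec_le f M : cbdd f -> (forall x, cabs (f x) <= M) -> cabs (Ec P f) <= M.
Proof.
move=> cf fM; have lf := cbdd_L1 P cf.
rewrite (le_trans (cabs_Ec lf)) // -[leRHS](Er_cst P); apply: le_Er => //.
- by case: lf.
- exact: rL1_cst.
Qed.

Lemma trigT_M f g : trig xpredT f -> trig xpredT g -> trig xpredT (fun x : torus => f x * g x).
Proof. exact: trigM. Qed.

Lemma trig_horner (p : {poly R}) u : trig xpredT (fun x => (u x)%:C) ->
  trig xpredT (fun x => (p.[u x])%:C).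
Proof.
move=> tu; elim/poly_ind: p => [|p c IHp].
  by apply: trig_ext (trig0 R xpredT) => x; rewrite horner0.
apply: trig_ext (trigD (trigT_M IHp tu) (trig_cst (S := xpredT) c%:C isT)) => x.
by rewrite !hornerE (rmorphD (real_complex R)) (rmorphM (real_complex R)).
Qed.

(** Harmonic conjugation in the [j]-th variable: the part with negative frequencies is conjugated
    and added to the part with positive ones, which keeps the real part. *)
Lemma trig_real_analytic w : trig xpredT (fun x => (w x)%:C) ->
  exists a B, [/\ trig fixed (fun x => (a x)%:C), trig pos B &
                  forall x, w x = a x + complex.Re (B x)].
Proof.
move=> /(trig_split fixed) [c [r [tc /(trig_split pos)[p [m [tp tm rE]]] wE]]].
have tc' : trig fixed c by apply: trig_sub tc.
exists (fun x => complex.Re (c x)), (fun x => p x + (m x)^*); split.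
- have := trigZ (2^-1) (trigD tc' (trigJ (S' := fixed) _ tc')).
  move=> h; apply: trig_ext (h _) => [x|k]; last by rewrite /fixed mxE oppr_eq0.
  by apply: complexP; rewrite /= ?ReM ?ImM ReD ImD ReJ ImJ /=; field.
- apply: trigD; first by apply: trig_sub tp => k /andP[].
  apply: trigJ tm => k /andP[/= /negPf k0]; rewrite /fixed in k0.
  by rewrite /pos -leNgt mxE oppr_gt0 lt_neqAle k0.
- move=> x; have := congr1 (@complex.Re R) (wE x).
  by rewrite /= rE !ReD ReJ.
Qed.

(** Every term of the expansion except [a^n] contains [B], hence has positive frequency in the
    [j]-th variable. *)
Lemma trig_expD a B n : trig fixed (fun x => (a x)%:C) -> trig pos B ->
  trig pos (fun x => ((a x)%:C + B x) ^+ n - ((a x) ^+ n)%:C).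
Proof.
move=> ta tB.
have t0 : trig (nneg j) (fun x => (a x)%:C + B x).
  apply: trigD; first by apply: trig_sub ta => k /eqP k0; rewrite /nneg k0.
  by apply: trig_sub tB => k /ltW.
have tn m : trig (nneg j) (fun x => ((a x)%:C + B x) ^+ m).
  apply: trigX t0 => [|k l]; first by rewrite /nneg mxE.
  by rewrite /nneg mxE; exact: addr_ge0.
elim: n => [|n IHn].
  by apply: trig_ext (trig0 R pos) => x; rewrite !expr0 subrr.
have h1 : trig pos (fun x => B x * ((a x)%:C + B x) ^+ n).
  by apply: trigM tB (tn n) => k l kp ln; rewrite /pos mxE ltr_wpDr.
have h2 : trig pos (fun x => (a x)%:C * (((a x)%:C + B x) ^+ n - ((a x) ^+ n)%:C)).
  by apply: trigM ta IHn => k l /eqP k0; rewrite /pos mxE k0 add0r.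
apply: trig_ext (trigD h1 h2) => x.
by rewrite exprS (rmorphXn (real_complex R)) (rmorphXn (real_complex R)) [in RHS]exprS; ring.
Qed.

(* [h = G * exp (- W)] where [W] is analytic in the [j]-th variable with real part
   [ln |G|]; the exponentials are Euler powers, so that every function is a trigonometric
   polynomial. *)
Lemma outer_test G eps K q : trig (nneg j) G -> 0 < eps -> 0 < K ->
  (forall x, cabs (G x) ^+ 2 + eps ^+ 2 <= K ^+ 2) -> 1 < q ->
  exists h, [/\ trig (nneg j) h, forall x, cabs (h x) <= q ^+ 2 &
    expR (Er P (fun x => 2^-1 * ln (cabs (G x) ^+ 2 + eps ^+ 2))) <=
    q ^+ 2 * (cabs (Ec P (fun x => G x * (h x)^*)) +
              2 * (q ^+ 3 - 1) * (K * q ^+ 2) + eps * q ^+ 2)].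
Proof.
move=> tG e0 K0 vK q1; pose v x := cabs (G x) ^+ 2 + eps ^+ 2.
have l0 : 0 < ln q by rewrite ln_gt0.
have q0 : 0 < q by lra.
have vge x : eps ^+ 2 <= v x by rewrite lerDr sqr_ge0.
have e20 : 0 < eps ^+ 2 by rewrite exprn_gt0.
have [] := @ln_poly_approx R (eps ^+ 2) (K ^+ 2) (ln q) e20 _ l0.
  by apply: le_trans (vK 0); exact: vge.
(* A polynomial in [v] stands for the logarithm so that [w], and with it [W], is a trigonometric
   polynomial. *)
move=> p pP; pose w x := 2^-1 * p.[v x].
have wv x : `|w x - 2^-1 * ln (v x)| <= ln q.
  rewrite -mulrBr normrM gtr0_norm ?invr_gt0 // mulrC ler_pdivrMr //.
  by apply: le_trans (pP _ _) _; rewrite ?vge ?vK //; lra.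
have tv : trig xpredT (fun x => (v x)%:C).
  have tG' : trig xpredT G by apply: trig_sub tG.
  have := trigD (trigT_M tG' (trigJ (S' := xpredT) _ tG')) (trig_cst (S := xpredT) (eps ^+ 2)%:C isT).
  move=> h; apply: trig_ext (h _) => // x.
  by rewrite mulc_conj (rmorphD (real_complex R)).
have tw : trig xpredT (fun x => (w x)%:C).
  apply: trig_ext (trigZ (2^-1)%:C (trig_horner p tv)) => x.
  by rewrite (rmorphM (real_complex R)).
have [a [B [ta tB wE]]] := trig_real_analytic tw.
pose W x := (a x)%:C + B x.
have ReW x : complex.Re (W x) = w x by rewrite /W ReD wE.
have [_ [C1 WC]] := cbddD (trig_cbdd ta) (trig_cbdd tB).
have [_ [C2 aC]] := trig_cbdd ta.
pose m := Er P a.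
pose C := Num.max C1 C2.
have WC' x : cabs (W x) <= C by rewrite le_max WC.
have aC' x : `|a x| <= C by rewrite -cabs_real le_max aC orbT.
have ba : rbdd a by exact: (cbdd_Re (trig_cbdd ta)).
have mC : `|m| <= C.
  apply: le_trans (normr_Er (rbdd_L1 P ba)) _; rewrite -[leRHS](Er_cst P).
  by apply: le_Er => //; [exact/rL1_norm/rbdd_L1|exact: rL1_cst].
have C0 : 0 <= C by exact: le_trans mC.
pose n := (Num.trunc (4 * C + 18 * C ^+ 2 / ln q)).+1.
have nb : 4 * C + 18 * C ^+ 2 / ln q < n%:R by exact: truncnS_gt.
have c2 : 0 <= 18 * C ^+ 2 / ln q by rewrite divr_ge0 ?(ltW l0) // mulr_ge0 ?sqr_ge0.
have n4 : 4 * C <= n%:R by lra.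
have n18 : 18 * C ^+ 2 <= ln q * n%:R by rewrite [leRHS]mulrC -ler_pdivrMr //; lra.
have n0 : 0 < n%:R :> R by rewrite ltr0n.
pose Em x := (1 + (n%:R^-1)%:C * (- W x)) ^+ n.
pose Ep x := (1 + (n%:R^-1)%:C * W x) ^+ n.
have pw x : [/\ cabs (G x * Em x) <= q ^+ 2, cabs (Em x) <= q ^+ 2 / eps &
      cabs (G x * (G x * Em x)^* - (Ep x - (eps ^+ 2)%:C * (Em x)^*)) <=
      2 * (q ^+ 3 - 1) * (K * q ^+ 2)].
  by apply: (@outer_pointwise R (G x) (W x) eps K q C n) => //; rewrite ReW; exact: wv.
have tW : trig (nneg j) W.
  apply: trigD; first by apply: trig_sub ta => k /eqP k0; rewrite /nneg k0.
  by apply: trig_sub tB => k /ltW.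
have nD k l : nneg j k -> nneg j l -> nneg j (k + l).
  by rewrite /nneg mxE; exact: addr_ge0.
have nn0 : nneg j 0 by rewrite /nneg mxE.
have tEm : trig (nneg j) Em.
  by apply: (trigX _ nn0 nD); apply: trigD (trig_cst 1 nn0) (trigZ _ (trigN tW)).
have tEp : trig (nneg j) Ep.
  by apply: (trigX _ nn0 nD); apply: trigD (trig_cst 1 nn0) (trigZ _ tW).
have th : trig (nneg j) (fun x => G x * Em x) by apply: trigM nD tG tEm.
exists (fun x => G x * Em x); split=> // [x|]; first by case: (pw x).
pose a' x := 1 + a x / n%:R.
(* [W] differs from the real function [a] by positive frequencies in the [j]-th variable, so
   integration replaces [W] with [a] in the Euler power. *)
have EcEp : Ec P Ep = (Er P (fun x => a' x ^+ n))%:C.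
  have ta' : trig fixed (fun x => (a' x)%:C).
    have f0 : fixed 0 by rewrite /fixed mxE.
    apply: trig_ext (trigD (trig_cst 1 f0) (trigZ (n%:R^-1)%:C ta)) => x.
    by rewrite /a' (rmorphD (real_complex R)) mulrC (rmorphM (real_complex R)).
  have tE := trig_expD n ta' (trigZ (n%:R^-1)%:C tB).
  have := Ec_trig0 _ tE; rewrite /pos mxE ltxx => /(_ isT) E0.
  have ba' : cbdd (fun x => (a' x ^+ n)%:C).
    apply: cbdd_real; apply: rbddX; apply: rbddD; first exact: rbdd_cst.
    by apply: rbddM => //; exact: rbdd_cst.
  rewrite -Ec_real -[LHS]subr0 -E0 -EcB; [|exact: trig_cL1 tEp|exact: trig_cL1 tE].
  congr Ec; apply/funext => x.
  have -> : Ep x = ((a' x)%:C + (n%:R^-1)%:C * B x) ^+ n.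
    rewrite /Ep /W /a' (rmorphD (real_complex R)) (mulrC (a x)) (rmorphM (real_complex R)).
    by rewrite rmorph1 mulrDr addrA.
  by rewrite opprB addrC subrK.
have mE : m = Er P w.
  have lB := trig_cL1 tB.
  have -> : w = (fun x => a x + complex.Re (B x)) by apply/funext.
  rewrite ErD ?(rbdd_L1 P ba) ?(cL1_Re lB) // -Re_Ec (Ec_trig0 _ tB) ?addr0 //.
  by rewrite /pos mxE ltxx.
have bw : rbdd w by exact: (cbdd_Re (trig_cbdd tw)).
have bv : rbdd v by exact: (cbdd_Re (trig_cbdd tv)).
have lv : rL1 P (fun x => 2^-1 * ln (v x)).
  apply: (@rL1_le _ _ _ _ _ (fun x => `|w x| + ln q)) => [|x|].
  - apply: measurable_funM; first exact: measurable_cst.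
    by apply: measurableT_comp; [exact: measurable_ln|case: bv].
  - rewrite -lerBlDl; apply: le_trans (wv x); rewrite distrC.
    exact: lerB_dist.
  - by apply: rL1D; [exact/rL1_norm/rbdd_L1|exact: rL1_cst].
have mge : Er P (fun x => 2^-1 * ln (v x)) <= m + ln q.
  rewrite mE -[X in _ + X](Er_cst P) -ErD; [|exact: rbdd_L1|exact: rL1_cst].
  apply: le_Er => // [|x]; first by apply: rL1D; [exact: rbdd_L1|exact: rL1_cst].
  by have := wv x; rewrite ler_norml => /andP[]; lra.
have mn : `|m / n%:R| <= 4^-1.
  rewrite normrM normfV (gtr0_norm n0) ler_pdivrMr //; lra.
have m2n : 2 * m ^+ 2 <= ln q * n%:R.
  have : m ^+ 2 <= C ^+ 2 by rewrite -real_normK ?num_real // lerXn2r ?nnegrE.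
  by have := sqr_ge0 C; lra.
have ba'n : rbdd (fun x => a' x ^+ n).
  apply: rbddX; apply: rbddD; first exact: rbdd_cst.
  by apply: rbddM => //; exact: rbdd_cst.
(* Jensen's inequality for the [n]-th power, through the tangent at [m]: its linear part has mean
   zero. *)
have mean : expR (m - ln q) <= Er P (fun x => a' x ^+ n).
  apply: (@le_trans _ _ ((1 + m / n%:R) ^+ n)).
    move: mn; rewrite ler_norml => /andP[mn _].
    have mn' : - 2^-1 <= m / n%:R by lra.
    apply: le_trans (exp1D_ge n mn'); rewrite ler_expR.
    rewrite (_ : n%:R * _ = m - 2 * m ^+ 2 / n%:R); last by field; lra.
    by rewrite lerD2l lerN2 ler_pdivrMr.
  pose c := n%:R * (1 + m / n%:R) ^+ n / (1 + m / n%:R).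
  have lc : rL1 P (fun x => c / n%:R * (a x - m)).
    by apply: rL1Z; apply: rL1B; [exact: rbdd_L1|exact: rL1_cst].
  have E0 : Er P (fun x => c / n%:R * (a x - m)) = 0.
    rewrite (ErZ (c / n%:R) (u := fun x => a x - m)); last first.
      by apply: rL1B; [exact: rbdd_L1|exact: rL1_cst].
    by rewrite ErB ?Er_cst ?subrr ?mulr0 //; [exact: rbdd_L1|exact: rL1_cst].
  rewrite -[leLHS]addr0 -E0 -[X in X + _](Er_cst P) -ErD //; last exact: rL1_cst.
  apply: le_Er => [||x]; [by apply: rL1D => //; exact: rL1_cst|exact: rbdd_L1|].
  have m1 : -1 < m / n%:R by move: mn; rewrite ler_norml => /andP[]; lra.
  have a1 : -1 <= a x / n%:R.
    rewrite ler_pdivlMr //; have := aC' x; rewrite ler_norml => /andP[]; lra.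
  rewrite (_ : c / n%:R * (a x - m) = c * (a x / n%:R - m / n%:R)); last by field; lra.
  exact: exp1D_tangent.
have EpE : cabs (Ec P Ep) <= cabs (Ec P (fun x => G x * (G x * Em x)^*)) +
    2 * (q ^+ 3 - 1) * (K * q ^+ 2) + eps * q ^+ 2.
  pose D x := G x * (G x * Em x)^* - (Ep x - (eps ^+ 2)%:C * (Em x)^*).
  have bGh : cbdd (fun x => G x * (G x * Em x)^*).
    by apply: cbddM; [exact: trig_cbdd tG|exact/cbddJ/(trig_cbdd th)].
  have bEm : cbdd (fun x => (eps ^+ 2)%:C * (Em x)^*).
    by apply: cbddM; [exact: cbdd_cst|exact/cbddJ/(trig_cbdd tEm)].
  have bD : cbdd D by apply: cbddB => //; apply: cbddB => //; exact: trig_cbdd tEp.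
  have -> : Ep = (fun x => G x * (G x * Em x)^* - D x + (eps ^+ 2)%:C * (Em x)^*).
    by apply/funext => x; rewrite /D; ring.
  rewrite EcD ?(EcB (g := D)); try by apply: cbdd_L1 => //; exact: cbddB.
  apply: le_trans (cabsD _ _) _; apply: lerD.
    apply: le_trans (cabsB _ _) _; rewrite lerD2l.
    by apply: cabs_Ec_le => // x; case: (pw x).
  apply: cabs_Ec_le => // x; rewrite cabsM cabsJ cabs_real (gtr0_norm e20).
  case: (pw x) => _ Emx _; apply: le_trans (ler_wpM2l (ltW e20) Emx) _.
  by rewrite le_eqVlt; apply/orP; left; apply/eqP; field; lra.
apply: (@le_trans _ _ (expR (m + ln q))); first by rewrite ler_expR.
(* One factor [q] pays for replacing the logarithm by [w], the other for the Euler power of the mean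
   [m]. *)
have -> : m + ln q = 2%:R * ln q + (m - ln q) by rewrite mulr2n; ring.
rewrite expRD [2%:R * _]mulrC expRM_natr lnK ?posrE // ler_pM2l ?exprn_gt0 //.
apply: le_trans mean _; apply: le_trans EpE.
by rewrite EcEp cabs_real ler_norm.
Qed.

End OuterTest.

(** * Duality *)

Section Duality.
Variables (R : realType) (d : nat).
Local Notation torus := (@torus R d).
Local Notation P := (@haar R d).
Implicit Types (f g h psi : torus -> R[i]) (S : 'rV[int]_d -> bool) (s : seq 'I_d).

(** The exponents reached after [n] projections: the reciprocals [1/2 - 2^-(n+1)] are the orbit of 0
    under [4/s = 1 + 2/r]. At [n = 0] the inverse of 0 defaults to 0 and would stand for infinity;
    only [n >= 1] is used as an exponent. *)
Definition rexp n : R := (2^-1 - 2^-1 ^+ n.+1)^-1.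

Lemma rexpV n : (rexp n)^-1 = 2^-1 - 2^-1 ^+ n.+1. Proof. exact: invrK. Qed.

Lemma rexpV_bounds n : 4^-1 <= (rexp n.+1)^-1 < 2^-1.
Proof.
have h0 : 0 < 2^-1 ^+ n :> R by rewrite exprn_gt0 // invr_gt0.
have h1 : 2^-1 ^+ n <= 1 :> R by rewrite exprn_ile1 // ?invr_ge0 // invf_le1 // ler1n.
by rewrite rexpV !exprS; apply/andP; split; lra.
Qed.

Lemma rexp_gt0 n : 0 < rexp n.+1.
Proof. by rewrite -invr_gt0; case/andP: (rexpV_bounds n) => + _; lra. Qed.

(* The first projection maps [L^oo] to [L^4] and the following ones map [L^(rexp n)] to
   [L^(rexp n.+1)], all of them contractively. *)
Lemma projections_Loo_Lr (j : 'I_d) s A S h : 0 < A -> trig S h -> (forall x, cabs (h x) <= A) ->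
  exists H, [/\ trig (fun a => S a && all (fun i => nneg i a) (j :: s)) H,
    trig (fun a => ~~ all (fun i => nneg i a) (j :: s)) (fun x => h x - H x) &
    Er P (fun x => cabs (H x) `^ rexp (size s).+1) <= A `^ rexp (size s).+1].
Proof.
move=> A0 th hA; elim: s j => [|i s IHs] j.
  have [g [k [tg tk hE]]] := trig_split (nneg j) th; exists g.
  split.
  - by apply: trig_sub tg => a /=; rewrite andbT.
  - apply: trig_ext (trig_sub _ tk) => [x|a /andP[_]]; first by rewrite hE addrC addKr.
    by rewrite /= andbT.
  have -> : rexp 1 = 4%:R by rewrite /rexp; field.
  rewrite powR_mulrn ?(ltW A0) //.
  rewrite (_ : (fun x => _) = (fun x => cabs (g x) ^+ 4)); last first.
    by apply/funext => x; rewrite powR_mulrn ?cabs_ge0.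
  apply: (projection_Loo_L4 (j := j) (h := k)) hE hA.
    by apply: trig_sub tg => a /andP[].
  by apply: trig_sub tk => a /andP[].
have [H' [tH' tD HA]] := IHs i.
have [g [k [tg tk HE]]] := trig_split (nneg j) tH'; exists g; split.
- by apply: trig_sub tg => a /= /andP[/andP[-> ->] ->].
- apply: trig_ext (trigD (trig_sub _ tD) (trig_sub _ tk)) => [x|a|a].
  + by rewrite HE; ring.
  + by rewrite /= => /negPf ->; rewrite andbF.
  + by move=> /andP[_ /negPf ja]; rewrite /= ja.
have /andP[r4 r2] := rexpV_bounds (size s).
(* With [r = 2 / th'], the next exponent [s = 4 / (1 + th')] satisfies [1/s = 1/4 + 1/(2 r)], which
   is the recursion of [rexp]. *)
pose th' := 2 * (rexp (size s).+1)^-1.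
have th0 : 0 < th' by rewrite /th'; lra.
have th1 : th' < 1 by rewrite /th'; lra.
have r0 := rexp_gt0 (size s).
have E1 : rexp (size s).+1 = 2 / th' by rewrite /th'; field; lra.
have E2 : rexp (size s).+2 = 4 / (1 + th').
  by apply: invr_inj; rewrite rexpV invf_div /th' rexpV [in LHS]exprS; field.
rewrite /= E2; rewrite /= E1 in HA.
apply: (projection_Lr_Ls (j := j) th0 th1 A0 _ _ HE HA).
  by apply: trig_sub tg => a /andP[].
by apply: trig_sub tk => a /andP[].
Qed.

Lemma riesz_duality (j0 : 'I_d) q A B psi g h :
  q^-1 = 2^-1 + 2^-1 ^+ d -> (2 <= d)%N -> 
  cL1 P psi -> rL1 P (fun x => cabs (psi x) `^ q) -> cL1 P g ->
  (forall a : 'rV[int]_d, fcoef g a = if [forall j, 0 <= a ord0 j] then fcoef psi a else 0) ->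
  0 < A -> 0 < B -> Er P (fun x => cabs (psi x) `^ q) <= B `^ q ->
  trig (nneg j0) h -> (forall x, cabs (h x) <= A) ->
  cabs (Ec P (fun x => g x * (h x)^*)) <= B * A.
Proof.
move=> qE d2 lpsi lpsiq lg gE A0 B0 psiB th hA.
(* The list of the variables other than [j0], in which [h] still has to be projected. As [d >= 2] it
   is nonempty, so the chain starts with a projection from [L^oo] to [L^4]. *)
have : uniq (rem j0 (enum 'I_d)) by rewrite rem_uniq ?enum_uniq.
have : size (rem j0 (enum 'I_d)) = d.-1 by rewrite size_rem ?mem_enum // size_enum_ord.
case sE : (rem j0 (enum 'I_d)) => [|j s] /=.
  by move=> sz; move: d2; rewrite -ltn_predRL -sz.
move=> sz _.
have [H [tH tD HA]] := projections_Loo_Lr j s A0 th hA.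
have dE : d = (size s).+2 by rewrite sz prednK // ltnW.
have allE (a : 'rV[int]_d) : nneg j0 a && all (fun i => nneg i a) (j :: s) = [forall j, 0 <= a ord0 j].
  apply/andP/forallP => [[a0 /allP as_] i|aP]; last by split; [exact: aP|apply/allP => i _; exact: aP].
  have [->//|ij] := eqVneq i j0.
  by apply: as_; rewrite -sE (rem_filter _ (enum_uniq _)) mem_filter /= ij mem_enum.
have lH := trig_cbdd tH; have lDh := trig_cbdd tD; have lh := trig_cbdd th.
have E1 : Ec P (fun x => g x * (h x - H x)^*) = 0.
  apply: (Ec_mul_trigJ0 lg _ tD) => a na; rewrite -/(fcoef g a) gE -allE.
  by rewrite (negPf na) andbF.
have E2 : Ec P (fun x => (psi x - g x) * (H x)^*) = 0.
  have lpg := cL1B lpsi lg.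
  apply: (Ec_mul_trigJ0 lpg _ tH) => a; rewrite allE => na.
  rewrite (_ : (fun x => _) = (fun x => psi x * (ex a x)^* - g x * (ex a x)^*)); last first.
    by apply/funext => x; rewrite mulrBl.
  rewrite EcB; [|exact: cL1_exJ|exact: cL1_exJ].
  by rewrite -/(fcoef psi a) -/(fcoef g a) gE na subrr.
have E3 : Ec P (fun x => g x * (h x)^*) = Ec P (fun x => psi x * (H x)^*).
  have -> : (fun x => g x * (h x)^*) =
      (fun x => psi x * (H x)^* + (g x * (h x - H x)^* - (psi x - g x) * (H x)^*)).
    by apply/funext => x; rewrite rmorphB; ring.
  rewrite EcD ?EcB ?E1 ?E2 ?subr0 ?addr0 //.
  - by apply: cL1M => //; exact: cbddJ.
  - by apply: cL1M => //; [exact: cL1B|exact: cbddJ].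
  - by apply: cL1M => //; exact: cbddJ.
  - by apply: cL1B; apply: cL1M => //; by [exact: cbddJ|exact: cL1B].
rewrite E3.
have h2 : 0 < 2^-1 ^+ d :> R by rewrite exprn_gt0 // invr_gt0.
have q0 : 0 < q by rewrite -invr_gt0 qE addr_gt0 // invr_gt0.
have HJ : (fun x => cabs (H x)^* `^ rexp (size s).+1) = (fun x => cabs (H x) `^ rexp (size s).+1).
  by apply/funext => x; rewrite cabsJ.
have r0 := rexp_gt0 (size s).
(* Since [size s = d - 2], the chain ends at the reciprocal exponent [1/2 - 2^-d], conjugate to that
   of [q]. *)
have qr : q^-1 + (rexp (size s).+1)^-1 = 1.
  rewrite qE rexpV -dE addrCA addrK -[RHS](mulVf (x := 2)) ?pnatr_eq0 //.
  by rewrite [in RHS]mulr2n mulrDr mulr1.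
have mH : cmeas (fun x => (H x)^*) by apply: cmeasJ; case: lH.
have lHr : rL1 P (fun x => cabs (H x)^* `^ rexp (size s).+1).
  by rewrite HJ; apply: rbdd_L1; apply: rbdd_cabs_powR => //; exact: ltW.
rewrite -HJ in HA.
exact: (proj2 (hoelder_Ec (proj1 lpsi) mH lpsiq lHr q0 r0 qr B0 A0 psiB HA)).
Qed.

End Duality.

(** * The logarithmic bound for the Riesz projection *)

Section LogBound.
Variables (R : realType).

(** With [t = |a - b| / eps] this amounts to [a^2 + eps^2 <= (b^2 + eps^2) exp (2 t)]. It yields
    both the integrability of the smoothed logarithm and its continuity along [L^1] limits. *)
Lemma half_ln_lipschitz (a b eps : R) : 0 <= a -> 0 <= b -> 0 < eps ->
  2^-1 * ln (a ^+ 2 + eps ^+ 2) <= 2^-1 * ln (b ^+ 2 + eps ^+ 2) + `|a - b| / eps.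
Proof.
move=> a0 b0 e0; set t := `|a - b| / eps.
have t0 : 0 <= t by rewrite divr_ge0 // ltW.
have te : t * eps = `|a - b| by rewrite divfK // gt_eqF.
have v0 x : 0 < x ^+ 2 + eps ^+ 2 by rewrite ltr_wpDl ?sqr_ge0 // exprn_gt0.
have ab : a <= b + t * eps by rewrite te -lerBlDl ler_norm.
have h : a ^+ 2 + eps ^+ 2 <= (b ^+ 2 + eps ^+ 2) * expR (2%:R * t).
  rewrite mulrC expRM_natl mulrC.
  have h1 : (1 + t) ^+ 2 <= expR t ^+ 2.
    by rewrite lerXn2r ?nnegrE ?expR_ge0 ?expR_ge1Dx // addr_ge0.
  apply: le_trans (ler_wpM2l (ltW (v0 b)) h1).
  have h2 : a ^+ 2 <= (b + t * eps) ^+ 2.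
    by rewrite lerXn2r ?nnegrE // (le_trans a0).
  have h3 : 0 <= t * (b - eps) ^+ 2 by rewrite mulr_ge0 ?sqr_ge0.
  have h4 : 0 <= t * (b ^+ 2 + eps ^+ 2) by rewrite mulr_ge0 // ltW.
  have h5 : 0 <= t ^+ 2 * b ^+ 2 by rewrite mulr_ge0 ?sqr_ge0.
  rewrite -subr_ge0 in h2; rewrite -subr_ge0.
  rewrite (_ : _ - _ = ((b + t * eps) ^+ 2 - a ^+ 2) +
    t * (b - eps) ^+ 2 + t * (b ^+ 2 + eps ^+ 2) + t ^+ 2 * b ^+ 2); last by ring.
  by rewrite addr_ge0 // addr_ge0 // addr_ge0.
rewrite -ler_ln ?posrE ?mulr_gt0 ?expR_gt0 // lnM ?posrE ?expR_gt0 // expRK in h.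
lra.
Qed.

Lemma le_of_scaled_le (X Y K : R) : 0 <= Y -> 0 <= K ->
  (forall q, 1 < q -> X <= q ^+ 2 * (Y * q ^+ 2 + 2 * (q ^+ 3 - 1) * (K * q ^+ 2))) ->
  X <= Y.
Proof.
move=> Y0 K0 XY; apply/ler_addgt0Pr => e e0.
(* From [(1 + t)^4 <= 1 + 15 t] and [(1 + t)^3 - 1 <= 7 t] the error is at most
   [t (15 Y + 14 K) + 210 K t^2], and [224 = 14 + 210]. *)
pose D := 15 * Y + 224 * K + 1.
have D0 : 0 < D by rewrite /D; lra.
pose t := Num.min 1 (e / D).
have t0 : 0 < t by rewrite lt_min ltr01 divr_gt0.
have t1 : t <= 1 by rewrite ge_min lexx.
have tD : t * D <= e by rewrite -ler_pdivlMr // ge_min lexx orbT.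
have := XY (1 + t); rewrite ltrDl => /(_ t0) h; apply: le_trans h _.
have p2 : t ^+ 2 <= t by rewrite expr2 ler_piMl // ltW.
have p3 : t ^+ 3 <= t by rewrite exprS ler_piMr ?(ltW t0) // exprn_ile1 // ltW.
have p4 : t ^+ 4 <= t by rewrite exprS ler_piMr ?(ltW t0) // exprn_ile1 // ltW.
have q4 : (1 + t) ^+ 4 <= 1 + 15 * t.
  rewrite (_ : _ ^+ 4 = 1 + 4 * t + 6 * t ^+ 2 + 4 * t ^+ 3 + t ^+ 4); last by ring.
  lra.
have q3 : (1 + t) ^+ 3 - 1 <= 7 * t.
  rewrite (_ : _ - 1 = 3 * t + 3 * t ^+ 2 + t ^+ 3); last by ring.
  lra.
rewrite (_ : _ * _ = (1 + t) ^+ 4 * (Y + 2 * K * ((1 + t) ^+ 3 - 1))); last by ring.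
have q40 : 0 <= (1 + t) ^+ 4 by rewrite exprn_ge0 // addr_ge0 // ltW.
have h : 2 * K * ((1 + t) ^+ 3 - 1) <= 2 * K * (7 * t) by rewrite ler_wpM2l // mulr_ge0.
apply: (@le_trans _ _ ((1 + 15 * t) * (Y + 2 * K * (7 * t)))).
  apply: ler_pM => //; last by rewrite lerD2l.
  by rewrite addr_ge0 // mulr_ge0 ?mulr_ge0 // subr_ge0 exprn_ege1 // lerDl ltW.
have kt : K * t ^+ 2 <= K * t by rewrite ler_wpM2l.
have -> : (1 + 15 * t) * (Y + 2 * K * (7 * t)) =
    Y + t * (15 * Y + 14 * K) + 210 * (K * t ^+ 2) by ring.
have : t * D = t * (15 * Y + 14 * K) + 210 * (K * t) + t by rewrite /D; ring.
lra.
Qed.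

Variable d : nat.
Local Notation torus := (@torus R d).
Local Notation P := (@haar R d).
Implicit Types (f g h psi : torus -> R[i]).

Lemma rL1_half_ln g eps : 0 < eps -> cL1 P g ->
  rL1 P (fun x => 2^-1 * ln (cabs (g x) ^+ 2 + eps ^+ 2)).
Proof.
move=> e0 [mg lg].
apply: (@rL1_le _ _ _ _ _ (fun x => `|2^-1 * ln (0 ^+ 2 + eps ^+ 2)| + eps^-1 * cabs (g x))).
- apply: measurable_funM; first exact: measurable_cst.
  apply: measurableT_comp; first exact: measurable_ln.
  by apply: measurable_funD; [exact/measurable_funX/cmeas_cabs|exact: measurable_cst].
- move=> x; rewrite -lerBlDl; apply: le_trans (lerB_dist _ _) _.
  have h1 := half_ln_lipschitz (cabs_ge0 (g x)) (lexx 0) e0.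
  have h2 := half_ln_lipschitz (lexx 0) (cabs_ge0 (g x)) e0.
  rewrite subr0 ger0_norm ?cabs_ge0 // in h1.
  rewrite sub0r normrN ger0_norm ?cabs_ge0 // in h2.
  rewrite ler_norml; apply/andP; split; rewrite mulrC; lra.
- by apply: rL1D; [exact: rL1_cst|exact: rL1Z].
Qed.

(** The order of the limits matters. The error in [outer_test] depends on the sup norm of the
    polynomial [G], so [tau] tends to 1 with [G] fixed, and only then does the distance [eta]
    between [G] and [g] tend to 0. Meanwhile [eps] is fixed and keeps the logarithm Lipschitz. *)
Lemma riesz_log_bound q B psi g eps :
  q^-1 = 2^-1 + 2^-1 ^+ d -> (2 <= d)%N ->
  cL1 P psi -> rL1 P (fun x => cabs (psi x) `^ q) -> cL1 P g ->
  (forall a : 'rV[int]_d, fcoef g a = if [forall j, 0 <= a ord0 j] then fcoef psi a else 0) ->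
  0 < B -> Er P (fun x => cabs (psi x) `^ q) <= B `^ q -> 0 < eps ->
  Er P (fun x => 2^-1 * ln (cabs (g x) ^+ 2 + eps ^+ 2)) <= ln (B + eps).
Proof.
move=> qE d2 lpsi lpsiq lg gE B0 psiB e0.
pose j0 : 'I_d := Ordinal (ltnW d2).
set X := Er P _.
have Be0 : 0 < B + eps by rewrite addr_gt0.
have key eta : 0 < eta -> X <= ln (B + eps) + eta * (eps^-1 + (B + eps)^-1).
  move=> eta0; have [n gn] := fejer_cvg_L1 lg eta0.
  pose G := fejer n g; rewrite -/G in gn.
  have tG : trig (nneg j0) G.
    apply: fejer_trig => a na; rewrite gE ifF //; apply: contraNF na => /forallP.
    exact.
  have lG := trig_cL1 tG.
  have [_ [M GM]] := trig_cbdd tG.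
  have M0 : 0 <= M by exact: le_trans (cabs_ge0 _) (GM 0).
  have K0 : 0 < M + eps by rewrite ltr_wpDl.
  have GK x : cabs (G x) ^+ 2 + eps ^+ 2 <= (M + eps) ^+ 2.
    have h1 : cabs (G x) ^+ 2 <= M ^+ 2 by rewrite lerXn2r ?nnegrE ?cabs_ge0.
    have h2 : 0 <= M * eps by rewrite mulr_ge0 // ltW.
    by rewrite sqrrD; lra.
  pose Y := Er P (fun x => 2^-1 * ln (cabs (G x) ^+ 2 + eps ^+ 2)).
  have EY : expR Y <= B + eta + eps.
    apply: (@le_of_scaled_le _ _ (M + eps)); [lra|exact: ltW|] => tau tau1.
    have [h [th hA hE]] := outer_test tG e0 K0 GK tau1.
    have t0 : 0 < tau by lra.
    have t20 : 0 < tau ^+ 2 by rewrite exprn_gt0.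
    apply: le_trans hE _; rewrite ler_pM2l //.
    have lh := trig_cbdd th.
    have h1 := riesz_duality qE d2 lpsi lpsiq lg gE t20 B0 psiB th hA.
    have l1 : cL1 P (fun x => g x * (h x)^*) by apply: cL1M => //; exact: cbddJ.
    have l2 : cL1 P (fun x => (g x - G x) * (h x)^*).
      by apply: cL1M; [exact: cL1B|exact: cbddJ].
    have h2 : cabs (Ec P (fun x => (g x - G x) * (h x)^*)) <= eta * tau ^+ 2.
      apply: le_trans (cabs_Ec l2) _; rewrite mulrC.
      apply: le_trans (ler_wpM2l (ltW t20) gn); rewrite -ErZ; last by case: (cL1B lg lG).
      apply: le_Er => [||x]; [by case: l2|by apply: rL1Z; case: (cL1B lg lG)|].
      by rewrite cabsM cabsJ mulrC ler_wpM2r ?cabs_ge0.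
    have h3 : cabs (Ec P (fun x => G x * (h x)^*)) <= (B + eta) * tau ^+ 2.
      have -> : (fun x => G x * (h x)^*) = (fun x => g x * (h x)^* - (g x - G x) * (h x)^*).
        by apply/funext => x; ring.
      rewrite EcB // mulrDl; apply: le_trans (cabsB _ _) _; exact: lerD.
    rewrite [leRHS](_ : _ = (B + eta) * tau ^+ 2 + 2 * (tau ^+ 3 - 1) * ((M + eps) * tau ^+ 2)
      + eps * tau ^+ 2); last by ring.
    by rewrite 2!lerD2r.
  have EX : X <= Y + eta / eps.
    have ler : rL1 P (fun x => eps^-1 * cabs (g x - G x)).
      by apply: rL1Z; case: (cL1B lg lG).
    have lY := rL1_half_ln e0 lG.
    have h1 : eps^-1 * Er P (fun x => cabs (g x - G x)) <= eta / eps.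
      by rewrite [leRHS]mulrC ler_wpM2l // invr_ge0 ltW.
    apply: le_trans (lerD (lexx _) h1).
    rewrite -ErZ; last by case: (cL1B lg lG).
    rewrite -ErD //; apply: le_Er => [||x]; [exact: rL1_half_ln|exact: rL1D|].
    apply: le_trans (half_ln_lipschitz (cabs_ge0 _) (cabs_ge0 (G x)) e0) _.
    rewrite lerD2l mulrC ler_wpM2l ?invr_ge0 ?(ltW e0) //; exact: cabs_lerB.
  have EY' : Y <= ln (B + eps) + eta / (B + eps).
    rewrite -(expRK Y); apply: (@le_trans _ _ (ln (B + eta + eps))).
      by rewrite ler_ln ?posrE ?expR_gt0 //; lra.
    rewrite (_ : B + eta + eps = (B + eps) * (1 + eta / (B + eps))); last by field; lra.
    have h : 0 < eta / (B + eps) by rewrite divr_gt0.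
    rewrite lnM ?posrE //; last by lra.
    by rewrite lerD2l; apply: le_ln1Dx; lra.
  by rewrite mulrDr; lra.
apply/ler_addgt0Pr => e e'0.
have D0 : 0 < eps^-1 + (B + eps)^-1 by rewrite addr_gt0 ?invr_gt0.
by have := key (e / (eps^-1 + (B + eps)^-1)); rewrite divfK ?gt_eqF // divr_gt0 // => ->.
Qed.

End LogBound.

(** * The upper bound *)

Import HBNNSimple.

(** Taken from the definition of the integral through suprema over simple functions, so that it
    applies to the arbitrary integrands of [tint]. *)
Lemma le_integral_pointwise d (T : measurableType d) (R : realType)
    (mu : {measure set T -> \bar R}) (D : set T) (f g : T -> \bar R) :
  (forall x, f x <= g x)%E -> (\int[mu]_(x in D) f x <= \int[mu]_(x in D) g x)%E.
Proof.
move=> fg; rewrite /integral.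
have fgD x : ((f \_ D) x <= (g \_ D) x)%E by rewrite /patch; case: ifP.
have nn (u v : T -> \bar R) : (forall x, u x <= v x)%E ->
    (ereal_sup [set sintegral mu h | h in [set h : {nnsfun T >-> R} | forall x, (h x)%:E <= u x]] <=
     ereal_sup [set sintegral mu h | h in [set h : {nnsfun T >-> R} | forall x, (h x)%:E <= v x]])%E.
  move=> uv; apply: le_ereal_sup => _ [h hu <-].
  by exists h => // x; exact: le_trans (hu x) (uv x).
apply: leeB; apply: nn => x; rewrite ?funeposE ?funenegE ge_max !le_max lexx ?orbT ?andbT.
  by rewrite fgD.
by rewrite leeN2 fgD.
Qed.

(** * From the norms and integrals of the statement to expectations *)

Section Bridges.
Variables (R : realType) (d : nat).
Local Notation torus := (@torus R d).
Local Notation P := (@haar R d).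
Implicit Types (f g h psi : torus -> R[i]).

Lemma cmeasurableP f : cmeasurable f <-> cmeas f.
Proof.
have h (u : torus -> R) : tmeasurable_fun u <-> measurable_fun setT u.
  split=> [mu _ B mB|mu B mB]; first by rewrite setTI; exact: mu.
  by rewrite -[_ @^-1` _]setTI; exact: mu.
by rewrite /cmeasurable /cmeas !h.
Qed.

Lemma tint_Er (u : torus -> R) : rL1 P u -> tint (fun x => (u x)%:E) = (Er P u)%:E.
Proof. by move=> lu; rewrite EFin_Er // -tint_integrable. Qed.

Lemma rL1_of_tint (u : torus -> R) : measurable_fun setT u -> (forall x, 0 <= u x) ->
  (tint (fun x => (u x)%:E) < +oo)%E -> rL1 P u.
Proof.
move=> mu u0; have mu' : measurable_fun setT (EFin \o u) by exact/measurable_EFinP.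
rewrite (tint_ge0 mu'); last by move=> x; rewrite lee_fin.
move=> uoo; apply/integrableP; split=> //; apply: le_lt_trans uoo.
by apply: le_integral_pointwise => x; rewrite /= ger0_norm.
Qed.

Lemma LpnormE p f : rL1 P (fun x => cabs (f x) `^ p) ->
  Lpnorm p f = (Er P (fun x => cabs (f x) `^ p) `^ p^-1)%:E.
Proof. by move=> lf; rewrite /Lpnorm tint_Er. Qed.

Lemma rL1_of_Lpnorm p f : p != 0 -> cmeas f -> (Lpnorm p f < +oo)%E ->
  rL1 P (fun x => cabs (f x) `^ p).
Proof.
move=> p0 mf; rewrite /Lpnorm => fp; apply: rL1_of_tint => [|x|].
- exact: measurable_cabs_powR.
- exact: powR_ge0.
- rewrite ltey; apply/eqP => foo; move: fp; rewrite foo poweRyr ?ltxx //.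
  by rewrite invr_eq0.
Qed.

Lemma cL1_of_Lp p f : 1 <= p -> cmeas f -> rL1 P (fun x => cabs (f x) `^ p) -> cL1 P f.
Proof.
move=> p1 mf lf; apply: (@cL1_le _ _ _ _ _ (fun x => 1 + cabs (f x) `^ p)) => // [x|].
  have [c1|c1] := leP (cabs (f x)) 1; first by rewrite ler_wpDr ?powR_ge0.
  rewrite ler_wpDl // -[leLHS]powRr1 ?cabs_ge0 //.
  by rewrite ler_powR // ltW.
by apply: rL1D => //; exact: rL1_cst.
Qed.

Lemma Riesz_projP psi g : cL1 P psi -> is_Riesz_proj psi g <->
  (cL1 P g /\ forall a : 'rV[int]_d, fcoef g a =
     if [forall j, 0 <= a ord0 j] then fcoef psi a else 0).
Proof.
move=> lpsi; split=> [[/cmeasurableP mg [gl gE]]|[lg gE]].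
  have lg : cL1 P g.
    by split=> //; apply: rL1_of_tint => [|x|]; [exact: cmeas_cabs|exact: cabs_ge0|].
  split=> // a; have := gE a; rewrite fourierE // -/(fcoef g a) => ->.
  by case: ifP => // _; rewrite fourierE.
split; first by apply/cmeasurableP; case: lg.
split=> [|a]; first by rewrite tint_Er ?ltry //; case: lg.
by rewrite fourierE // -/(fcoef g a) gE; case: ifP => // _; rewrite fourierE.
Qed.

End Bridges.

Lemma le_tint (R : realType) d (f g : 'rV[R]_d -> \bar R) :
  (forall x, f x <= g x)%E -> (tint f <= tint g)%E.
Proof.
elim: d f g => [|d IHd] f g fg /=; first exact: fg.
by apply: le_integral_pointwise => x; exact: IHd.
Qed.

(** Taking [B = N + e/2] and [eps = e/2] covers a vanishing norm [N], and the bound on the smoothed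
    logarithm suffices because [ln |g| <= ln (|g|^2 + eps^2) / 2]. *)
Lemma admissible_p0 (R : realType) d (q : R) : (2 <= d)%N -> q^-1 = 2^-1 + 2^-1 ^+ d ->
  admissible_p d q%:E 0.
Proof.
move=> d2 qE; split=> // psi g [/cmeasurableP mpsi psiq] gpsi; rewrite /Lnorm_p eqxx.
have h0 : 0 < 2^-1 ^+ d :> R by rewrite exprn_gt0 // invr_gt0.
have h1 : 2^-1 ^+ d <= 2^-1 :> R.
  rewrite -[d]prednK 1?ltnW // exprS ler_piMr ?invr_ge0 // exprn_ile1 ?invr_ge0 //.
  by rewrite invf_le1 // ler1n.
have q0 : 0 < q by rewrite -invr_gt0 qE addr_gt0 // invr_gt0.
have q1 : 1 <= q by rewrite -[q]invrK invf_ge1 ?invr_gt0 // qE; lra.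
have lpsiq := rL1_of_Lpnorm (lt0r_neq0 q0) mpsi psiq.
have lpsi := cL1_of_Lp q1 mpsi lpsiq.
have [lg gE] := (Riesz_projP _ lpsi).1 gpsi.
rewrite /= LpnormE //; set N := Er _ _ `^ _.
have N0 : 0 <= N by exact: powR_ge0.
apply/lee_addgt0Pr => e e0; have e2 : 0 < e / 2 by rewrite divr_gt0.
have B0 : 0 < N + e / 2 by rewrite ltr_wpDl.
have psiB : Er (haar R d) (fun x => cabs (psi x) `^ q) <= (N + e / 2) `^ q.
  have E0 : 0 <= Er (haar R d) (fun x => cabs (psi x) `^ q) by apply: Er_ge0 => x; exact: powR_ge0.
  apply: (@le_trans _ _ (N `^ q)).
    by rewrite /N -powRrM mulVf ?gt_eqF // powRr1.
  by rewrite ge0_ler_powR ?nnegrE ?(ltW q0) ?(ltW B0) // lerDl ltW.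
have hX := riesz_log_bound qE d2 lpsi lpsiq lg gE B0 psiB e2.
set u := (fun x => 2^-1 * ln (cabs (g x) ^+ 2 + (e / 2) ^+ 2)) in hX.
have lu : rL1 (haar R d) u by exact: rL1_half_ln.
have key : (tint (fun x => if cabs (g x) == 0%R then -oo else (ln (cabs (g x)))%:E) <=
    (ln (N + e))%:E)%E.
  apply: (@le_trans _ _ (tint (fun x => (u x)%:E))).
    apply: le_tint => x; case: eqP => [_|/eqP gx]; first exact: leNye.
    have g0 : 0 < cabs (g x) by rewrite lt0r gx cabs_ge0.
    rewrite lee_fin /u ler_pdivlMl // -[2]/(2%:R) mulr_natl -lnXn //.
    by rewrite ler_ln ?posrE ?exprn_gt0 ?ltr_wpDl ?sqr_ge0 ?exprn_gt0 // lerDl sqr_ge0.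
  rewrite tint_Er // lee_fin (le_trans hX) // ler_ln ?posrE; lra.
have Ne : N + e = expR (ln (N + e)) by rewrite lnK // posrE ltr_wpDl.
(* The mean of [ln |g|] may be [-oo], in which case [expeR] gives 0. *)
rewrite -EFinD Ne; move: key; rewrite /L0norm; case: tint => [r| |] //=.
by rewrite !lee_fin ler_expR.
Qed.

Lemma qfrak_upper (R : realType) d : (2 <= d)%N ->
  (qfrak R d <= (2 / (1 + 2 ^- (d - 1)) : R)%:E)%E.
Proof.
move=> d2; apply: ereal_inf_lbound.
have h0 : 0 < 2 ^- (d - 1) :> R by rewrite invr_gt0 exprn_gt0.
have h1 : 2 ^- (d - 1) <= 1 :> R by rewrite invf_le1 ?exprn_gt0 // exprn_ege1 // ler1n.
split; first by rewrite lee_fin ler_pdivlMr; lra.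
have a0 : admissible_p d (2 / (1 + 2 ^- (d - 1)) : R)%:E 0.
  apply: admissible_p0 => //; rewrite invf_div mulrDl mul1r; congr (_ + _).
  rewrite exprVn -[in RHS](subnK (ltnW d2)) exprD expr1 invfM //.
rewrite /pfrak asboolT; last by exists 0.
by apply: ereal_sup_ubound; exists 0.
Qed.

(** * The lower bound *)

Section OneVariable.
Variable R : realType.
Implicit Types x y m : R.

Lemma le_of_derive_ge0 (a : R) (F F' : R -> R) :
  (forall x, a <= x -> is_derive x 1 F (F' x)) -> (forall x, a <= x -> 0 <= F' x) ->
  forall x, a <= x -> F a <= F x.
Proof.
move=> dF F0 x ax.
have [||c] := @MVT_segment R F F' a x ax.
- by move=> y; rewrite in_itv /= => /andP[/ltW ay _]; exact: dF.
- apply: derivable_within_continuous => y; rewrite in_itv /= => /andP[ay _].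
  by have [] := dF y ay.
rewrite in_itv /= => /andP[ac _] FE.
by rewrite -subr_ge0 FE mulr_ge0 ?F0 // subr_ge0.
Qed.

Lemma expR_ge_quadratic x : 0 <= x -> 1 + x + x ^+ 2 / 2 <= expR x.
Proof.
move=> x0; pose F y := expR y - 1 - y - 2^-1 * y ^+ 2.
have dF y : 0 <= y -> is_derive y 1 F (expR y - 1 - y).
  by move=> _; rewrite /F; apply: is_derive_eq; rewrite /GRing.scale /=; field.
have F'0 y : 0 <= y -> 0 <= expR y - 1 - y by move=> _; have := expR_ge1Dx y; lra.
have := le_of_derive_ge0 dF F'0 x0; rewrite /F expR0; lra.
Qed.

Lemma ln_ge_quadratic x : 0 <= x -> x - x ^+ 2 / 2 <= ln (1 + x).
Proof.
move=> x0; pose F y := ln y - y + 1 + 2^-1 * (y - 1) ^+ 2.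
have dF y : 1 <= y -> is_derive y 1 F (y^-1 - 1 + (y - 1)).
  move=> y1; have y0 : 0 < y by lra.
  have := is_derive1_ln y0 => ?; rewrite /F; apply: is_derive_eq.
  by rewrite /GRing.scale /=; field; rewrite ?gt_eqF.
have F'0 y : 1 <= y -> 0 <= y^-1 - 1 + (y - 1).
  move=> y1; have y0 : 0 < y by lra.
  rewrite (_ : _ + _ = (y - 1) ^+ 2 / y); last by field; lra.
  by rewrite divr_ge0 ?sqr_ge0 // ltW.
have x1 : 1 <= 1 + x by lra.
have := le_of_derive_ge0 dF F'0 x1; rewrite /F ln1.
rewrite (_ : 1 + x - 1 = x); last by ring.
lra.
Qed.

Lemma powR_le_linear x m : 0 <= m <= 1 -> 1 <= x -> x `^ m <= 1 + m * (x - 1).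
Proof.
move=> /andP[m0 m1] x1; pose F y := m * (y - 1) - y `^ m.
have dF y : 1 <= y -> is_derive y 1 F (m - m * y `^ (m - 1)).
  move=> y1; have y0 : 0 < y by lra.
  have := is_derive1_powR m y0 => ?; rewrite /F; apply: is_derive_eq.
  by rewrite /GRing.scale /=; field; rewrite ?gt_eqF.
have F'0 y : 1 <= y -> 0 <= m - m * y `^ (m - 1).
  move=> y1; rewrite subr_ge0 ler_piMr // -[leRHS](powRr0 y) ler_powR //; lra.
have := le_of_derive_ge0 dF F'0 x1; rewrite /F powR1; lra.
Qed.

(** The derivative of the difference is nonnegative by [powR_le_linear] at the exponent [m - 1],
    which lies in [[0, 1]]. *)
Lemma powR_le_quadratic x m : 1 <= m <= 2 -> 0 <= x ->
  (1 + x) `^ m <= 1 + m * x + m * (m - 1) / 2 * x ^+ 2.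
Proof.
move=> /andP[m1 m2] x0.
pose F y := m * (y - 1) + m * (m - 1) / 2 * (y - 1) ^+ 2 - y `^ m.
have dF y : 1 <= y -> is_derive y 1 F (m * (1 + (m - 1) * (y - 1) - y `^ (m - 1))).
  move=> y1; have y0 : 0 < y by lra.
  have := is_derive1_powR m y0 => ?; rewrite /F; apply: is_derive_eq.
  by rewrite /GRing.scale /=; field; rewrite ?gt_eqF.
have F'0 y : 1 <= y -> 0 <= m * (1 + (m - 1) * (y - 1) - y `^ (m - 1)).
  move=> y1; rewrite mulr_ge0 //; first by lra.
  by rewrite subr_ge0 powR_le_linear //; lra.
have x1 : 1 <= 1 + x by lra.
have := le_of_derive_ge0 dF F'0 x1; rewrite /F powR1.
rewrite (_ : 1 + x - 1 = x); last by ring.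
lra.
Qed.

End OneVariable.

(* For [q < 4 / 3] the gap is [q (3 - 9 q / 4) e^2] up to [O(e^3)]. *)
Lemma gap_inequality (R : realType) (q : R) : 1 <= q -> q < 4 / 3 ->
  exists2 e, 0 < e &
    let k := e * (1 + 3 * e) ^+ 2 / (1 + 2 * e) ^+ 2 in
    let L := 2 * e - (2 * e) ^+ 2 / 2 + k - 3 / 2 * k ^+ 2 in
    let m := 3 / 2 * q in
    0 <= L /\ 1 + m * (2 * e) + m * (m - 1) / 2 * (6 * e ^+ 2) < 1 + q * L + (q * L) ^+ 2 / 2.
Proof.
(* The factor 100 gives [e <= 1/100] and beats the cubic errors, whose total coefficient [27 + 6 q]
   is at most 35. *)
move=> q1 q43; have [e eE] : exists e, 100 * e = 3 - 9 / 4 * q.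
  by exists ((3 - 9 / 4 * q) / 100); field.
have e0 : 0 < e by lra.
have e1 : e <= 1 / 100 by lra.
exists e => // k L m.
have b0 : 0 < 1 + 2 * e by lra.
pose t := (1 + 3 * e) / (1 + 2 * e).
have kE : k = e * t ^+ 2 by rewrite /k /t expr_div_n -[LHS]mulrA.
have e2 : 0 <= e ^+ 2 by rewrite sqr_ge0.
have e3 : 0 <= e ^+ 3 by rewrite exprn_ge0 // ltW.
have e4 : 0 <= e ^+ 4 by rewrite exprn_ge0 // ltW.
have e21 : e ^+ 2 <= e / 100 by rewrite expr2 ler_pM2l //; lra.
have e32 : e ^+ 3 <= e ^+ 2 / 100 by rewrite exprSr ler_wpM2l //; lra.
have e43 : e ^+ 4 <= e ^+ 3 / 100 by rewrite exprSr ler_wpM2l //; lra.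
have tl : 1 + e - 2 * e ^+ 2 <= t.
  rewrite ler_pdivlMr //.
  have -> : (1 + e - 2 * e ^+ 2) * (1 + 2 * e) = 1 + 3 * e - 4 * e ^+ 3 by ring.
  lra.
have tu : t <= 1 + e.
  rewrite ler_pdivrMr //.
  have -> : (1 + e) * (1 + 2 * e) = 1 + 3 * e + 2 * e ^+ 2 by ring.
  lra.
have t0 : 0 <= 1 + e - 2 * e ^+ 2 by lra.
have t2l : 1 + 2 * e - 4 * e ^+ 2 <= t ^+ 2.
  apply: (@le_trans _ _ ((1 + e - 2 * e ^+ 2) ^+ 2)).
    rewrite (_ : (1 + e - 2 * e ^+ 2) ^+ 2 = 1 + 2 * e - 3 * e ^+ 2 - 4 * e ^+ 3 + 4 * e ^+ 4); last by ring.
    lra.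
  by rewrite lerXn2r ?nnegrE // (le_trans t0).
have t4u : t ^+ 4 <= 1 + 15 * e.
  apply: (@le_trans _ _ ((1 + e) ^+ 4)).
    by rewrite lerXn2r ?nnegrE ?(le_trans t0) //; lra.
  rewrite (_ : (1 + e) ^+ 4 = 1 + 4 * e + 6 * e ^+ 2 + 4 * e ^+ 3 + e ^+ 4); last by ring.
  lra.
have kl : e + 2 * e ^+ 2 - 4 * e ^+ 3 <= k.
  rewrite kE (_ : e + 2 * e ^+ 2 - 4 * e ^+ 3 = e * (1 + 2 * e - 4 * e ^+ 2)); last by ring.
  by rewrite ler_pM2l.
have k2 : k ^+ 2 <= e ^+ 2 + 15 * e ^+ 3.
  rewrite kE (_ : (e * t ^+ 2) ^+ 2 = e ^+ 2 * t ^+ 4); last by ring.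
  rewrite (_ : e ^+ 2 + 15 * e ^+ 3 = e ^+ 2 * (1 + 15 * e)); last by ring.
  by rewrite ler_wpM2l.
(* A third-order lower expansion of [L]; the coefficient 27 covers [4 + 45/2], contributed by the
   bounds on [k] and [k^2]. *)
pose l := 3 * e - 3 / 2 * e ^+ 2 - 27 * e ^+ 3.
have lL : l <= L.
  rewrite /L /l (_ : (2 * e) ^+ 2 = 4 * e ^+ 2); last by ring.
  lra.
have l0 : 3 * e - 2 * e ^+ 2 <= l by rewrite /l; lra.
have l00 : 0 <= 3 * e - 2 * e ^+ 2 by lra.
have L0 : 0 <= L by lra.
split=> //.
have L2 : 9 * e ^+ 2 - 12 * e ^+ 3 <= L ^+ 2.
  apply: (@le_trans _ _ ((3 * e - 2 * e ^+ 2) ^+ 2)).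
    rewrite (_ : (3 * e - 2 * e ^+ 2) ^+ 2 = 9 * e ^+ 2 - 12 * e ^+ 3 + 4 * e ^+ 4); last by ring.
    lra.
  rewrite lerXn2r ?nnegrE //; lra.
have q0 : 0 < q by lra.
have h1 : q * l <= q * L by rewrite ler_pM2l.
have h2 : q ^+ 2 * (9 * e ^+ 2 - 12 * e ^+ 3) <= (q * L) ^+ 2.
  by rewrite exprMn ler_wpM2l // sqr_ge0.
have gap : 0 < q * e ^+ 2 * (100 * e - (27 + 6 * q) * e).
  rewrite !mulr_gt0 ?exprn_gt0 // -mulrBl mulr_gt0 //; lra.
have gapE : q * e ^+ 2 * (100 * e - (27 + 6 * q) * e) =
    q * l + q ^+ 2 * (9 * e ^+ 2 - 12 * e ^+ 3) / 2 -
    (m * (2 * e) + m * (m - 1) / 2 * (6 * e ^+ 2)).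
  by rewrite eE /l /m; field.
rewrite gapE in gap; clear - gap h1 h2; lra.
Qed.

(** * Jensen's inequality for [Lnorm_p] *)

Section Jensen.
Variables (R : realType) (d : nat).
Local Notation torus := (@torus R d).
Local Notation P := (@haar R d).

Lemma rL1_ln_cabs (g : torus -> R[i]) (c : R) : cbdd g -> 0 < c -> (forall x, c <= cabs (g x)) ->
  rL1 P (fun x => ln (cabs (g x))).
Proof.
move=> bg c0 cg; have g0 x : 0 < cabs (g x) by exact: lt_le_trans (cg x).
have [_ [M gM]] := bg.
apply: (@rL1_le _ _ _ _ _ (fun=> `|ln c| + `|ln M|)) => [|x|]; last exact: rL1_cst.
  by apply: measurableT_comp; [exact: measurable_ln|exact: cmeas_cabs (cbdd_L1 P bg).1].
have h1 : ln c <= ln (cabs (g x)) by rewrite ler_ln ?posrE.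
have h2 : ln (cabs (g x)) <= ln M by rewrite ler_ln ?posrE // (lt_le_trans (g0 x)).
have := ler_norm (ln M); have := ler_norm (- ln c); rewrite normrN => h3 h4.
have := normr_ge0 (ln M); have := normr_ge0 (ln c) => h5 h6.
rewrite ler_norml; apply/andP; split; lra.
Qed.

(** For [p > 0] this follows from the tangent [ln y <= y / N - 1 + ln N] at the mean [N] of [|g|^p];
    for [p = 0] it is an equality. One estimate of the logarithmic mean thus refutes all [p] at
    once. *)
Lemma expR_Er_ln_le_Lnorm (g : torus -> R[i]) (p c : R) : cbdd g -> 0 < c ->
  (forall x, c <= cabs (g x)) -> 0 <= p ->
  ((expR (Er P (fun x => ln (cabs (g x)))))%:E <= Lnorm_p p g)%E.
Proof.
move=> bg c0 cg p0.
have g0 x : 0 < cabs (g x) by exact: lt_le_trans (cg x).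
have lln := rL1_ln_cabs bg c0 cg.
rewrite /Lnorm_p; case: eqP => [_|/eqP pn0].
  rewrite /L0norm (_ : (fun x => _) = (fun x => (ln (cabs (g x)))%:E)); last first.
    by apply/funext => x; rewrite gt_eqF.
  by rewrite tint_Er.
have {p0 pn0}p0 : 0 < p by rewrite lt0r pn0.
have lp : rL1 P (fun x => cabs (g x) `^ p).
  by apply: rbdd_L1; apply: rbdd_cabs_powR => //; exact: ltW.
rewrite LpnormE // lee_fin; set N := Er P (fun x => _ `^ _).
have N0 : 0 < N.
  apply: (@lt_le_trans _ _ (c `^ p)); first exact: powR_gt0.
  rewrite -[leLHS](Er_cst P); apply: le_Er => // [|x]; first exact: rL1_cst.
  by rewrite ge0_ler_powR ?nnegrE ?cabs_ge0 ?(ltW p0) ?(ltW c0).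
rewrite /powR gt_eqF // ler_expR mulrC ler_pdivlMr // mulrC -ErZ //.
have -> : ln N = Er P (fun x => N^-1 * cabs (g x) `^ p + (ln N - 1)).
  rewrite ErD; [|exact: rL1Z|exact: rL1_cst].
  by rewrite ErZ // Er_cst mulVf ?gt_eqF //; ring.
apply: le_Er => [||x]; [exact: rL1Z|by apply: rL1D; [exact: rL1Z|exact: rL1_cst]|].
have y0 : 0 < cabs (g x) `^ p by rewrite powR_gt0.
rewrite -ln_powR -[X in ln X](divfK (lt0r_neq0 N0)) lnM ?posrE ?divr_gt0 //.
have h : -1 < cabs (g x) `^ p / N - 1 by rewrite ltrBrDr addNr divr_gt0.
have := le_ln1Dx h; rewrite addrCA subrr addr0 [N^-1 * _]mulrC; lra.
Qed.

End Jensen.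

(** * The extremal example *)

Section Example.
Variables (R : realType) (d : nat) (j0 j1 : 'I_d).
Hypothesis j01 : j0 != j1.
Local Notation torus := (@torus R d).
Local Notation P := (@haar R d).
Variable t : R.

(** The exponents of [z1 z2] and, below, of [z2 / z1]. The frequency [al + k be] lies in N^d exactly
    when [|k| <= 1], and this decides which terms the projection keeps. *)
Definition al : 'rV[int]_d := delta_mx ord0 j0 + delta_mx ord0 j1.
Definition be : 'rV[int]_d := delta_mx ord0 j1 - delta_mx ord0 j0.
Definition twocos (x : torus) : R := 2 * complex.Re (ex be x).

Definition psi_ex (x : torus) : R[i] :=
  ex al x * (Complex 1 (t * twocos x) * (1 + t ^+ 2 * twocos x ^+ 2)%:C).
(** With [w = z2 / z1] and [s = w + 1/w], the terms of [s^2] and [s^3] of degree between -1 and 1 in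
    [w] are [2] and [3 s]; hence the factors [1 + 2 t^2] and [1 + 3 t^2]. *)
Definition g_ex (x : torus) : R[i] :=
  ex al x * Complex (1 + 2 * t ^+ 2) (t * (1 + 3 * t ^+ 2) * twocos x).

Let w (x : torus) := ex be x.
Let w' (x : torus) := ex (- be) x.

Let RCD (a b : R) : (a + b)%:C = a%:C + b%:C. Proof. exact: rmorphD. Qed.
Let RCM (a b : R) : (a * b)%:C = a%:C * b%:C. Proof. exact: rmorphM. Qed.
Let RCX (a : R) n : (a ^+ n)%:C = a%:C ^+ n. Proof. exact: rmorphXn. Qed.
Let RCn n : (n%:R : R)%:C = n%:R. Proof. exact: rmorph_nat. Qed.

(** Stated as a vanishing expression, so that identities modulo [w w' = 1] become ring identities
    once an explicit multiple of it is added. *)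
Let ww x : w x * w' x - 1 = 0.
Proof. by rewrite /w /w' -exD subrr ex0 subrr. Qed.

Let twocosE x : (twocos x)%:C = w x + w' x.
Proof. by rewrite /w' exN /w /twocos; apply: complexP; rewrite /= ?ReD ?ImD ?ReJ ?ImJ; ring. Qed.

Let al0 : al ord0 j0 = 1. Proof. by rewrite !mxE !eqxx (negPf j01). Qed.
Let al1 : al ord0 j1 = 1. Proof. by rewrite !mxE !eqxx eq_sym (negPf j01). Qed.
Let be0 : be ord0 j0 = -1. Proof. by rewrite !mxE !eqxx (negPf j01). Qed.
Let be1 : be ord0 j1 = 1. Proof. by rewrite !mxE !eqxx eq_sym (negPf j01). Qed.

Let beN1 : (- be) ord0 j1 = -1. Proof. by rewrite mxE be1. Qed.

Let npos (a : 'rV[int]_d) := [forall j, 0 <= a ord0 j].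

Let complexE' (a b : R) : Complex a b = a%:C + Complex 0 1 * b%:C.
Proof. by apply: complexP; rewrite /= ?ReD ?ImD ?ReM ?ImM /=; ring. Qed.

Let u2 x : ex (al + be + be) x = ex al x * w x * w x. Proof. by rewrite 2!exD. Qed.
Let u2' x : ex (al - be - be) x = ex al x * w' x * w' x. Proof. by rewrite 2!exD. Qed.
Let u3 x : ex (al + be + be + be) x = ex al x * w x * w x * w x. Proof. by rewrite 3!exD. Qed.
Let u3' x : ex (al - be - be - be) x = ex al x * w' x * w' x * w' x. Proof. by rewrite 3!exD. Qed.

Lemma trig_g_ex : trig npos g_ex.
Proof.
have bp : npos (al + be).
  by apply/forallP => j; rewrite !mxE eqxx /=; case: (j == j0); case: (j == j1).
have bn : npos (al - be).
  by apply/forallP => j; rewrite !mxE eqxx /=; case: (j == j0); case: (j == j1).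
have a0 : npos al.
  by apply/forallP => j; rewrite !mxE eqxx /=; case: (j == j0); case: (j == j1).
pose c : R[i] := Complex 0 1 * (t * (1 + 3 * t ^+ 2))%:C.
have h := trigD (trig_ex (1 + 2 * t ^+ 2)%:C a0) (trigD (trig_ex c bp) (trig_ex c bn)).
apply: trig_ext h => x; rewrite /g_ex complexE'.
rewrite (RCM _ (twocos x)) twocosE (exD al be) (exD al (- be)).
by rewrite -/(w x) -/(w' x) /c; ring.
Qed.

Lemma trig_psi_sub_g : trig (fun a => ~~ npos a) (fun x => psi_ex x - g_ex x).
Proof.
pose N a := ~~ npos a.
have n2 : N (al + be + be).
  by apply/negP => /forallP /(_ j0); rewrite 2!mxE al0 be0.
have n2' : N (al - be - be).
  by apply/negP => /forallP /(_ j1); rewrite 2!mxE al1 beN1.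
have n3 : N (al + be + be + be).
  by apply/negP => /forallP /(_ j0); rewrite 3!mxE al0 be0.
have n3' : N (al - be - be - be).
  by apply/negP => /forallP /(_ j1); rewrite 3!mxE al1 beN1.
pose e : R[i] := (t ^+ 2)%:C; pose c : R[i] := Complex 0 1 * t%:C * e.
have h := trigD (trigD (trig_ex e n2) (trig_ex e n2')) (trigD (trig_ex c n3) (trig_ex c n3')).
apply: trig_ext h => x; rewrite u2 u2' u3 u3' /psi_ex /g_ex (complexE' 1) (complexE' (1 + 2 * t ^+ 2)).
move: (twocos x) (twocosE x) => S SE; rewrite /c /e !(RCD, RCM, RCX, RCn) SE.
apply/eqP; rewrite -subr_eq0; apply/eqP.
(* The cofactor of [w w' - 1], read off from the expansions of [S^2] and [S^3]. *)
rewrite -[RHS](mulr0 (- ex al x * (2 * t%:C ^+ 2 + 3 * Complex 0 1 * t%:C ^+ 3 * (w x + w' x)))).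
by rewrite -(ww x); ring.
Qed.

Lemma cbdd_psi_ex : cbdd psi_ex.
Proof.
have := cbddD (trig_cbdd trig_psi_sub_g) (trig_cbdd trig_g_ex).
by rewrite (_ : (fun x => _) = psi_ex) //; apply/funext => x; rewrite subrK.
Qed.

Lemma Riesz_proj_ex : is_Riesz_proj psi_ex g_ex.
Proof.
have bp := cbdd_psi_ex; have bg := trig_cbdd trig_g_ex.
have lp := cbdd_L1 P bp; have lg := cbdd_L1 P bg.
apply/Riesz_projP => //; split=> // a.
case: ifP => [aN|aN]; last by apply: (fcoef_out trig_g_ex); rewrite /npos aN.
have := fcoefD a (trig_cL1 trig_psi_sub_g) lg.
rewrite (_ : (fun x => _) = psi_ex); last by apply/funext => x; rewrite subrK.
by rewrite (fcoef_out trig_psi_sub_g) ?add0r // /npos aN.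
Qed.

Lemma rbdd_twocos : rbdd twocos.
Proof.
by apply: rbddM; [exact: rbdd_cst|apply: cbdd_Re; exact: cbdd_ex].
Qed.

Let nz (a : 'rV[int]_d) := a != 0.
Let nz_be n : nz (be *+ n.+1) /\ nz (- be *+ n.+1).
Proof.
have h (c : 'rV[int]_d) : c ord0 j1 != 0 -> nz (c *+ n.+1).
  by apply: contraNneq => /matrixP/(_ ord0 j1); rewrite mulmxnE mxE => /eqP; rewrite mulrn_eq0.
by split; apply: h; rewrite ?beN1 ?be1.
Qed.

Let exMn (a : 'rV[int]_d) n (x : torus) : ex (a *+ n) x = ex a x ^+ n.
Proof. by elim: n => [|n IHn]; rewrite ?mulr0n ?ex0 // mulrS exD IHn exprS. Qed.

(** The mean is the constant term; for the second and fourth powers of [w + 1/w] it is a central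
    binomial coefficient, 2 and 6. *)
Let Er_of_trig (u : torus -> R) (c : R) (f : torus -> R[i]) :
  (forall x, (u x)%:C = c%:C + f x) -> trig nz f -> Er P u = c.
Proof.
move=> uE tf; have := Ec_real P u.
rewrite (_ : (fun x => _) = (fun x => c%:C + f x)); last exact/funext.
rewrite EcD; [|exact/cbdd_L1/cbdd_cst|exact: trig_cL1 tf].
rewrite Ec_cst (Ec_trig0 _ tf) ?addr0 /nz ?eqxx //.
by move/(congr1 (@complex.Re R)) => /= ->.
Qed.

Lemma Er_twocos2 : Er P (fun x => twocos x ^+ 2) = 2.
Proof.
have [p2 m2] := nz_be 1.
apply: Er_of_trig (trigD (trig_ex 1 p2) (trig_ex 1 m2)) => x.
rewrite !exMn RCX twocosE -/(w x) -/(w' x) RCn.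
apply/eqP; rewrite -subr_eq0; apply/eqP; rewrite -[RHS](mulr0 2) -(ww x); ring.
Qed.

Lemma Er_twocos4 : Er P (fun x => twocos x ^+ 4) = 6.
Proof.
have [p2 m2] := nz_be 1; have [p4 m4] := nz_be 3.
apply: Er_of_trig (trigD (trigD (trig_ex 1 p4) (trig_ex 1 m4))
  (trigD (trig_ex 4 p2) (trig_ex 4 m2))) => x.
rewrite !exMn RCX twocosE -/(w x) -/(w' x) RCn.
apply/eqP; rewrite -subr_eq0; apply/eqP.
rewrite -[RHS](mulr0 (4 * w x ^+ 2 + 4 * w' x ^+ 2 + 6 * (w x * w' x + 1))) -(ww x); ring.
Qed.

End Example.

(** * Exponents below 4/3 *)

Section LowerBound.
Variables (R : realType) (d : nat).
Local Notation P := (@haar R d).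

Lemma cabs_psi_ex_powR (j0 j1 : 'I_d) (t q : R) x :
  cabs (psi_ex j0 j1 t x) `^ q = (1 + t ^+ 2 * twocos j0 j1 x ^+ 2) `^ (3 / 2 * q).
Proof.
set v := t ^+ 2 * twocos j0 j1 x ^+ 2.
have v0 : 0 <= v by rewrite mulr_ge0 ?sqr_ge0.
have v1 : 0 < 1 + v by rewrite ltr_wpDr.
have -> : 3 / 2 * q = (2^-1 + 1) * q by field.
rewrite powRrM powRD; last by rewrite gt_eqF ?implybT.
rewrite powRr1 ?(ltW v1) // powR12_sqrt ?(ltW v1) //.
rewrite /psi_ex (cabsM (ex _ x)) (cabsM (Complex 1 _)) cabs_ex mul1r cabs_real (gtr0_norm v1) /cabs /=.
by rewrite expr1n exprMn.
Qed.

Lemma ln_cabs_g_ex (j0 j1 : 'I_d) (t : R) x :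
  let b := 1 + 2 * t ^+ 2 in let k := t ^+ 2 * (1 + 3 * t ^+ 2) ^+ 2 / b ^+ 2 in
  ln (cabs (g_ex j0 j1 t x)) = ln b + 2^-1 * ln (1 + k * twocos j0 j1 x ^+ 2).
Proof.
move=> b k; set s := twocos _ _ _.
have b0 : 0 < b by have := sqr_ge0 t; rewrite /b; lra.
have k0 : 0 <= k * s ^+ 2 by rewrite mulr_ge0 ?divr_ge0 ?sqr_ge0 // mulr_ge0 ?sqr_ge0.
have k1 : 0 < 1 + k * s ^+ 2 by rewrite ltr_wpDr.
have E : cabs (g_ex j0 j1 t x) ^+ 2 = b ^+ 2 * (1 + k * s ^+ 2).
  rewrite /g_ex cabsM cabs_ex mul1r sqr_cabs /= -/s -/b /k.
  by field; rewrite gt_eqF.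
have g0 : 0 < cabs (g_ex j0 j1 t x).
  rewrite lt0r cabs_ge0 andbT; apply/eqP => g0; move: E; rewrite g0 expr0n /= => /esym/eqP.
  by rewrite gt_eqF // mulr_gt0 // exprn_gt0.
clearbody s k b; have := congr1 (@ln R) E.
rewrite lnM ?posrE ?exprn_gt0 // (lnXn 2 g0) (lnXn 2 b0) -[ln b *+ 2]mulr_natl -[X in X = _]mulr_natl.
move: (ln (cabs _)) (ln b) (ln (1 + _)); clear => x y z; lra.
Qed.

(** By [expR_Er_ln_le_Lnorm] an admissible [p] would give [exp (q E ln |g|) <= E |psi|^q]. Quadratic
    Taylor bounds express both sides through the moments 2 and 6 of [twocos], and [gap_inequality]
    contradicts the result. *)
Lemma not_admissible_p (q p : R) : (2 <= d)%N -> 1 <= q -> q < 4 / 3 ->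
  ~ admissible_p d q%:E p.
Proof.
move=> d2 q1 q43 [p0 adm].
have [j0 [j1 j01]] : exists j0 j1 : 'I_d, j0 != j1.
  by exists (Ordinal (ltnW d2)), (Ordinal d2).
have q0 : 0 < q by lra.
have [e e0 [L0 gap]] := gap_inequality q1 q43.
have [t te] : exists t, t ^+ 2 = e by exists (Num.sqrt e); rewrite sqr_sqrtr // ltW.
pose psi : torus R d -> R[i] := psi_ex j0 j1 t.
pose g : torus R d -> R[i] := g_ex j0 j1 t.
pose s : torus R d -> R := twocos j0 j1.
have bpsi : cbdd psi by exact: cbdd_psi_ex.
have bg : cbdd g by exact: (trig_cbdd (trig_g_ex j0 j1 t)).
have bs : rbdd s by exact: rbdd_twocos.
have lpsi : rL1 P (fun x => cabs (psi x) `^ q).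
  by apply: rbdd_L1; apply: rbdd_cabs_powR => //; exact: ltW.
have := adm psi g; rewrite /= LpnormE // => /(_ _ (Riesz_proj_ex j01 t)) h.
have {h} : (Lnorm_p p g <= (Er P (fun x => cabs (psi x) `^ q) `^ q^-1)%:E)%E.
  apply: h; split; first by apply/cmeasurableP; case: bpsi.
  by rewrite /= LpnormE // ltry.
set b := 1 + 2 * e; set k := e * (1 + 3 * e) ^+ 2 / b ^+ 2.
have b1 : 1 < b by rewrite /b; lra.
have k0 : 0 < k by rewrite /k divr_gt0 ?mulr_gt0 ?exprn_gt0 //; lra.
have gE x : ln (cabs (g x)) = ln b + 2^-1 * ln (1 + k * s x ^+ 2).
  by have := ln_cabs_g_ex j0 j1 t x; rewrite te.
have ks0 x : 0 <= k * s x ^+ 2 by rewrite mulr_ge0 ?sqr_ge0 // ltW.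
have b0 : 0 < b by lra.
have cg x : b <= cabs (g x).
  rewrite /g /g_ex cabsM cabs_ex mul1r te; apply: le_trans (Re_le_cabs _); exact: ler_norm.
have lln := rL1_ln_cabs bg b0 cg.
have Er_quartic A B C : Er P (fun x => C + A * s x ^+ 2 + B * s x ^+ 4) = C + A * 2 + B * 6.
  have l2 := rbdd_L1 P (rbddX 2 bs); have l4 := rbdd_L1 P (rbddX 4 bs).
  have lc := rL1_cst P C; have lA := rL1Z A l2; have lB := rL1Z B l4.
  rewrite (ErD (rL1D lc lA) lB) (ErD lc lA) Er_cst (ErZ A l2) (ErZ B l4).
  by rewrite Er_twocos2 // Er_twocos4.
have rL1_quartic A B C : rL1 P (fun x => C + A * s x ^+ 2 + B * s x ^+ 4).
  by apply: rL1D; [apply: rL1D; [exact: rL1_cst|]|]; apply: rL1Z; apply: rbdd_L1; exact: rbddX.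
(* The bound [ln (1 + x) >= x - x^2 / 2] is used twice: for [b = 1 + 2 e] and for [k s^2], whose
   mean is [2 k] and mean square [6 k^2]. *)
have Lge : 2 * e - (2 * e) ^+ 2 / 2 + k - 3 / 2 * k ^+ 2 <= Er P (fun x => ln (cabs (g x))).
  apply: (@le_trans _ _ (Er P (fun x => ln b + k / 2 * s x ^+ 2 + - (k ^+ 2 / 4) * s x ^+ 4))).
    have e2 : 0 <= 2 * e by lra.
    rewrite Er_quartic; have := ln_ge_quadratic e2; rewrite -/b; lra.
  apply: le_Er => // x; rewrite gE -addrA lerD2l.
  have := ln_ge_quadratic (ks0 x).
  have -> : (k * s x ^+ 2) ^+ 2 = k ^+ 2 * s x ^+ 4 by ring.
  lra.
set L := _ + k - _ in Lge L0 gap.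
have Ele : Er P (fun x => cabs (psi x) `^ q) <=
    1 + 3 / 2 * q * (2 * e) + 3 / 2 * q * (3 / 2 * q - 1) / 2 * (6 * e ^+ 2).
  set m := 3 / 2 * q; have m12 : 1 <= m <= 2 by rewrite /m; lra.
  have -> : 1 + m * (2 * e) + m * (m - 1) / 2 * (6 * e ^+ 2) =
      1 + m * e * 2 + m * (m - 1) / 2 * e ^+ 2 * 6 by ring.
  rewrite -Er_quartic; apply: le_Er => // x; rewrite cabs_psi_ex_powR te -/m -/(s x).
  have es0 : 0 <= e * s x ^+ 2 by rewrite mulr_ge0 ?sqr_ge0 // ltW.
  apply: le_trans (powR_le_quadratic m12 es0) _.
  by rewrite le_eqVlt; apply/orP; left; apply/eqP; ring.
set E := Er P (fun x => cabs (psi x) `^ q) in Ele *.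
have E0 : 0 <= E by apply: Er_ge0 => x; exact: powR_ge0.
move=> /(le_trans (expR_Er_ln_le_Lnorm bg b0 cg p0)); rewrite lee_fin => h.
have {h} : expR (q * Er P (fun x => ln (cabs (g x)))) <= E.
  have -> : E = (E `^ q^-1) `^ q by rewrite -powRrM mulVf ?gt_eqF // powRr1.
  rewrite mulrC expRM; apply: ge0_ler_powR => //; rewrite ?nnegrE ?expR_ge0 ?powR_ge0 //.
  exact: ltW.
apply/negP; rewrite -ltNge; apply: le_lt_trans Ele _; apply: lt_le_trans gap _.
apply: le_trans (expR_ge_quadratic (mulr_ge0 (ltW q0) L0)) _.
by rewrite ler_expR ler_pM2l.
Qed.

End LowerBound.

Lemma qfrak_lower (R : realType) d : (2 <= d)%N -> ((4 / 3 : R)%:E <= qfrak R d)%E.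
Proof.
move=> d2; apply: le_ereal_inf_tmp => q [q1 q0].
case: q q1 q0 => [q| |]; [|by move=> _ _; exact: leey|by rewrite leeNy_eq].
rewrite lee_fin => q1 q0; rewrite lee_fin leNgt; apply/negP => q43; move: q0.
rewrite /pfrak asboolF; first by rewrite lee_fin ler0N1.
by move=> [p adm]; exact: (not_admissible_p d2 q1 q43 adm).
Qed.

Theorem theorem11 (R : realType) (d : nat) :
  (2 <= d)%N ->
  ((4 / 3 : R)%:E <= qfrak R d)%E /\
  (qfrak R d <= (2 / (1 + 2 ^- (d - 1)) : R)%:E)%E.
Proof. by move=> d2; split; [exact: qfrak_lower|exact: qfrak_upper]. Qed.
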